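(* Let $t \geq 1$ be a fixed integer. Given simple graphs $G$ and $H$ as input, it can be decided in polynomial time whether $G \simeq_t^{\mathrm{L}^+} H$.
   Context: Graphs are finite and undirected; simple means without loops and multiple edges. For a set $X$ and $k \in \mathbb{N}$, $\binom{X}{\leq k}$ is the set of subsets of $X$ of size at most $k$. An element $(g,h) \in V(G)\times V(H)$ is written $gh$. A set $\{g_1h_1,\dots,g_\ell h_\ell\} \subseteq V(G)\times V(H)$ is a partial isomorphism if for all $i,j\in[\ell]$: $g_i=g_j \Leftrightarrow h_i=h_j$, and $g_ig_j\in E(G) \Leftrightarrow h_ih_j \in E(H)$. $G \simeq_t^{\mathrm{L}^+} H$ means that the following system (the level-$t$ Lasserre relaxation for graph isomorphism with non-negativity constraints) in real variables $y_I$, $I \in \binom{V(G)\times V(H)}{\leq 2t}$, is (exactly) feasible: (i) the matrix $(y_{I\cup J})_{I,J\in\binom{V(G)\times V(H)}{\leq t}}$ is positive semidefinite; (ii) $\sum_{h\in V(H)} y_{I\cup\{gh\}} = y_I$ for all $I \in \binom{V(G)\times V(H)}{\leq 2t-2}$ and $g\in V(G)$; (iii) $\sum_{g\in V(G)} y_{I\cup\{gh\}} = y_I$ for all $I \in \binom{V(G)\times V(H)}{\leq 2t-2}$ and $h\in V(H)$; (iv) $y_I=0$ for every $I\in\binom{V(G)\times V(H)}{\leq 2t}$ that is not a partial isomorphism; (v) $y_\emptyset=1$; (vi) $y_I\geq 0$ for all $I \in \binom{V(G)\times V(H)}{\leq 2t}$. Polynomial time means polynomial in the size of $G$ and $H$;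 the integer $t$ is fixed and not part of the input. *)

(* Defs.v *)
(* MathComp; [R : realType] of MathComp-Analysis plays the role of the reals. *)
From mathcomp Require Import all_boot all_order all_algebra.
From mathcomp Require Import reals.

Set Implicit Arguments.
Unset Strict Implicit.
Unset Printing Implicit Defensive.

Import Order.TTheory GRing.Theory Num.Theory.

(* Simple graphs *)

Record sgraph := SGraph {
  vertex :> finType;
  edge : rel vertex;
  edge_sym : symmetric edge;
  edge_irrefl : irreflexive edge }.

(* The level-t Lasserre relaxation with non-negativity constraints *)

Definition partial_iso (G H : sgraph) (I : {set G * H}) : bool :=
  [forall p in I, forall q in I,
     ((p.1 == q.1) == (p.2 == q.2)) && (edge p.1 q.1 == edge p.2 q.2)].

Definition psd (R : realType) (n : nat) (A : 'M[R]_n) : Prop :=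
  A^T%R = A /\ forall v : 'rV[R]_n, (0 <= (v *m A *m v^T) ord0 ord0)%R.

(* The rows and columns of the moment matrix are the sets of size at most [t],
   listed by [enum_val]. *)
Definition moment_matrix (R : realType) (T : finType) (t : nat)
    (y : {set T} -> R) : 'M[R]_#|[set I : {set T} | #|I| <= t]| :=
  (\matrix_(i, j) y (enum_val i :|: enum_val j))%R.

(* [y] is total on [{set G * H}], but its values at sets of more than [2 * t]
   elements do not occur in any of the constraints. *)
Record lasserre_solution (R : realType) (t : nat) (G H : sgraph)
    (y : {set G * H} -> R) : Prop := LasserreSolution {
  las_psd : psd (moment_matrix t y);
  las_suml : forall (I : {set G * H}) (g : G), #|I| <= 2 * t - 2 ->
    (\sum_(h : H) y (I :|: [set (g, h)]))%R = y I;
  las_sumr : forall (I : {set G * H}) (h : H), #|I| <= 2 * t - 2 ->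
    (\sum_(g : G) y (I :|: [set (g, h)]))%R = y I;
  las_niso : forall I : {set G * H}, #|I| <= 2 * t ->
    ~~ partial_iso I -> y I = 0%R;
  las_unit : y set0 = 1%R;
  las_ge0 : forall I : {set G * H}, #|I| <= 2 * t -> (0 <= y I)%R }.

Definition lasserre_equiv (R : realType) (t : nat) (G H : sgraph) : Prop :=
  exists y : {set G * H} -> R, lasserre_solution t y.

(* Deterministic multi-tape Turing machines and polynomial time *)

Inductive move := MoveLeft | Stay | MoveRight.

(* [None] is the blank, [Some (inl b)] the input symbol [b], and the
   [Some (inr a)] are the auxiliary work symbols. *)
Definition symbol (A : finType) : finType := option (bool + A).

(* [verdict q = Some b] if [q] is a halting state, accepting when [b] is [true]
   and rejecting otherwise; [verdict q = None] if [q] is not halting. *)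
Record machine := Machine {
  tapes : nat; (* the machine has [tapes.+1] tapes *)
  aux : finType;
  state : finType;
  start : state;
  verdict : state -> option bool;
  delta : state -> {ffun 'I_tapes.+1 -> symbol aux} ->
          state * {ffun 'I_tapes.+1 -> symbol aux * move} }.

(* A two-way infinite tape: the cells to the left of the head, nearest first,
   and the cells from the head on; all the cells not listed are blank. *)
Definition tape (A : finType) : Type := seq (symbol A) * seq (symbol A).

Definition read (A : finType) (u : tape A) : symbol A := head None u.2.

Definition write_move (A : finType) (u : tape A) (am : symbol A * move) :
    tape A :=
  let: (l, r) := u in
  let: (a, m) := am in
  let r' := a :: behead r in
  match m with
  | MoveLeft => (behead l, head None l :: r')
  | Stay => (l, r')
  | MoveRight => (a :: l, behead r)
  end.

Definition config (M : machine) : Type :=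
  state M * {ffun 'I_(tapes M).+1 -> tape (aux M)}.

Definition init (M : machine) (w : seq bool) : config M :=
  (start M,
   [ffun i => if i == ord0 then ([::], [seq Some (inl b) | b <- w])
              else ([::], [::])]).

Definition step (M : machine) (c : config M) : config M :=
  if verdict c.1 is Some _ then c else
  let: (q, act) := delta c.1 [ffun i => read (c.2 i)] in
  (q, [ffun i => write_move (c.2 i) (act i)]).

(* Halting configurations are fixed by [step], so this says that [M] halts on
   [w] after at most [n] steps, with verdict [b]. *)
Definition decides_within (M : machine) (w : seq bool) (n : nat) (b : bool) :
    Prop :=
  verdict (iter n (@step M) (init M w)).1 = Some b.

Definition poly_time_decidable (X : Type) (enc : X -> seq bool)
    (P : X -> Prop) : Prop :=
  exists (M : machine) (p : {poly nat}), forall x : X,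
    exists b : bool,
      decides_within M (enc x) (p.[size (enc x)])%R b /\ (b <-> P x).

(* The number of vertices in unary, an end marker and the adjacency matrix row
   by row, for the vertex order given by [enum]. *)
Definition encode_graph (G : sgraph) : seq bool :=
  nseq #|G| true ++ false :: [seq edge x y | x <- enum G, y <- enum G].

Definition encode_pair (GH : sgraph * sgraph) : seq bool :=
  encode_graph GH.1 ++ encode_graph GH.2.

(* Main.v *)
Require Import Defs.
From mathcomp Require Import all_boot all_order all_algebra.
From mathcomp Require Import reals boolp.
From mathcomp Require Import zify ring lra.

Set Implicit Arguments.
Unset Strict Implicit.
Unset Printing Implicit Defensive.

(* The relaxation is decided by a colour refinement of the [2t]-tuples of
   vertices of both graphs. Two tuples keep the same colour if they have the same
   atomic type, if their images under every map of the coordinates have the same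
   colour, and if, writing a tuple as a pair [(x1, x2)] of [t]-tuples, the numbers
   of [t]-tuples [z] with prescribed colours of [(x1, z)] and [(z, x2)] agree.

   If [y] is a solution and [y] is positive at the set of pairs of [x] and [w],
   then [x] and [w] have the same colour: the moment matrix, indexed by pairs of
   [t]-tuples, is a positive semidefinite coupling, and a vanishing argument for
   its quadratic form shows that it intertwines the colour classes of both graphs
   together with their products. Conversely, if the stable colouring has equally
   many tuples of every colour in both graphs, then
   [y = [colours agree] / (size of the colour class)] is a solution. Its moment
   matrix [M] satisfies [M^2 = K M] for a positive definite matrix [K], which
   makes it positive semidefinite.

   The refinement has polynomially many rounds, each given by a bounded number of
   nested loops over positions of the input, and programs of this kind can be
   run by multi-tape Turing machines in polynomial time. *)

(** * Polynomial-time Turing machines *)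

(** Exact feasibility of semidefinite programs is not known to be in polynomial time in general,
    hence the detour through a combinatorial criterion that matches the relaxation exactly. Two
    points are tight. The sums are only imposed at sets of size up to [2 * t - 2], while the
    argument strips pairs one by one from sets of size [2 * t]; the missing size [2 * t - 1] is
    recovered from semidefiniteness. And a vanishing quadratic form only yields equalities of
    averages; non-negativity turns them into equalities on the support of [y]. The matrix [K] arises
    from squaring [M]: stability allows the middle tuple of [H] to be counted in [G], and a double
    count of triangles moves that count to the other side of the product, so that what remains in
    front of [M] acts on the coordinate of [G] alone. Colours have no names. A colour is given by a
    reference tuple of [G], so that one bit per pair of a tuple and a reference describes the whole
    colouring. *)

Definition upd (A : Type) (f : nat -> A) (i : nat) (v : A) : nat -> A :=
  fun j => if j == i then v else f j.

Lemma upd_same (A : Type) (f : nat -> A) i v : upd f i v i = v.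
Proof. by rewrite /upd eqxx. Qed.

Lemma upd_other (A : Type) (f : nat -> A) i v j : j != i -> upd f i v j = f j.
Proof. by rewrite /upd => /negPf->. Qed.

Lemma upd_id (A : Type) (f : nat -> A) i : upd f i (f i) = f.
Proof. by apply/funext => j; rewrite /upd; case: eqP => // ->. Qed.

(** * A small imperative language on tapes with exact running times *)

Notation sym := (symbol unit).

(* The content of a tape and the position of its head; the cells to the left of
   position [0] are blank and never visited. *)
Definition atape : Type := ((nat -> sym) * nat)%type.

Definition store : Type := nat -> atape.

Definition rd (T : store) (i : nat) : sym := (T i).1 (T i).2.

Inductive cmd :=
| Wr of nat & sym
| Mv of nat & bool
| Seq of cmd & cmd
| If of nat & pred sym & cmd & cmd
| While of nat & pred sym & cmd.

Inductive exec : cmd -> store -> nat -> store -> Prop :=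
| ExWr T i a : exec (Wr i a) T 1 (upd T i (upd (T i).1 (T i).2 a, (T i).2))
| ExRight T i : exec (Mv i true) T 1 (upd T i ((T i).1, (T i).2.+1))
| ExLeft T i : 0 < (T i).2 ->
    exec (Mv i false) T 1 (upd T i ((T i).1, (T i).2.-1))
| ExSeq c1 c2 T n1 T1 n2 T2 : exec c1 T n1 T1 -> exec c2 T1 n2 T2 ->
    exec (Seq c1 c2) T (n1 + n2) T2
| ExIf i p c1 c2 T n T' : exec (if p (rd T i) then c1 else c2) T n T' ->
    exec (If i p c1 c2) T n.+1 T'
| ExWhileF i (p : pred sym) c T : ~~ p (rd T i) -> exec (While i p c) T 1 T
| ExWhileT i (p : pred sym) c T n1 T1 n2 T2 : p (rd T i) ->
    exec c T n1 T1 -> exec (While i p c) T1 n2 T2 ->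
    exec (While i p c) T (n1 + n2).+1 T2.

Fixpoint maxt (c : cmd) : nat :=
  match c with
  | Wr i _ | Mv i _ => i
  | Seq a b => maxn (maxt a) (maxt b)
  | If i _ a b => maxn i (maxn (maxt a) (maxt b))
  | While i _ a => maxn i (maxt a)
  end.

(** * Compilation of programs into finite control *)

Section Compile.

(** The control points inside [c]; the [None] added for [If] and [While] is the point at which the
    test is made. *)
Fixpoint ctl (c : cmd) : finType :=
  match c with
  | Wr _ _ | Mv _ _ => unit
  | Seq a b => (ctl a + ctl b)%type
  | If _ _ a b => option (ctl a + ctl b)
  | While _ _ a => option (ctl a)
  end.

Fixpoint entry (c : cmd) : ctl c :=
  match c return ctl c with
  | Wr _ _ | Mv _ _ => tt
  | Seq a b => inl (entry a)
  | If _ _ a b => None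
  | While _ _ a => None
  end.

Definition action : Type := (nat * sym * move)%type.

Fixpoint next (c : cmd) : ctl c -> (nat -> sym) -> option (ctl c) * action :=
  match c return ctl c -> (nat -> sym) -> option (ctl c) * action with
  | Wr i a => fun _ _ => (None, (i, a, Stay))
  | Mv i d => fun _ r => (None, (i, r i, if d then MoveRight else MoveLeft))
  | Seq a b => fun s r =>
      match s with
      | inl s' => let: (o, x) := next s' r in
          (Some (if o is Some s'' then inl s'' else inr (entry b)), x)
      | inr s' => let: (o, x) := next s' r in (omap inr o, x)
      end
  | If i p a b => fun s r =>
      match s with
      | None => (Some (Some (if p (r i) then inl (entry a) else inr (entry b))),
                 (i, r i, Stay))
      | Some (inl s') => let: (o, x) := next s' r in
          (omap (fun s'' => Some (inl s'')) o, x)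
      | Some (inr s') => let: (o, x) := next s' r in
          (omap (fun s'' => Some (inr s'')) o, x)
      end
  | While i p a => fun s r =>
      match s with
      | None => (if p (r i) then Some (Some (entry a)) else None,
                 (i, r i, Stay))
      | Some s' => let: (o, x) := next s' r in (Some o, x)
      end
  end.

(** The two-way tape continues to the left of cell 0, but [atape] has no cell there, so such moves
    are excluded. *)
Definition legal (x : action) (T : store) : bool :=
  match x with (i, _, MoveLeft) => 0 < (T i).2 | _ => true end.

Definition act (x : action) (T : store) : store :=
  let: (i, a, m) := x in
  upd T i (upd (T i).1 (T i).2 a,
    match m with
    | MoveLeft => (T i).2.-1 | Stay => (T i).2 | MoveRight => (T i).2.+1
    end).

Inductive run (c : cmd) : ctl c -> store -> nat -> store -> Prop :=
| RunLast s T x : next s (rd T) = (None, x) -> legal x T -> run s T 1 (act x T)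
| RunMore s s' T x n T' : next s (rd T) = (Some s', x) -> legal x T ->
    run s' (act x T) n T' -> run s T n.+1 T'.

Lemma act_read T i : act (i, rd T i, Stay) T = T.
Proof. by rewrite /act /rd upd_id -surjective_pairing upd_id. Qed.

Lemma run_seqr a b (s : ctl b) T n T1 :
  run s T n T1 -> run (c := Seq a b) (inr s) T n T1.
Proof.
elim=> {s T n T1} [s T x e l|s s' T x n T' e l _ IH].
  by apply: (RunLast (c := Seq a b) _ l); rewrite /= e.
by apply: (RunMore (c := Seq a b) _ l IH); rewrite /= e.
Qed.

Lemma run_seql a b (s : ctl a) T n T1 m T2 :
  run s T n T1 -> run (entry b) T1 m T2 ->
  run (c := Seq a b) (inl s) T (n + m) T2.
Proof.
move=> r1 r2; elim: r1 r2 => {s T n T1} [s T x e l|s s' T x n T' e l _ IH] r2.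
  by apply: (RunMore (c := Seq a b) _ l (run_seqr _ r2)); rewrite /= e.
by apply: (RunMore (c := Seq a b) _ l (IH r2)); rewrite /= e.
Qed.

Lemma run_ifl i p a b (s : ctl a) T n T1 :
  run s T n T1 -> run (c := If i p a b) (Some (inl s)) T n T1.
Proof.
elim=> {s T n T1} [s T x e l|s s' T x n T' e l _ IH].
  by apply: (RunLast (c := If i p a b) _ l); rewrite /= e.
by apply: (RunMore (c := If i p a b) _ l IH); rewrite /= e.
Qed.

Lemma run_ifr i p a b (s : ctl b) T n T1 :
  run s T n T1 -> run (c := If i p a b) (Some (inr s)) T n T1.
Proof.
elim=> {s T n T1} [s T x e l|s s' T x n T' e l _ IH].
  by apply: (RunLast (c := If i p a b) _ l); rewrite /= e.
by apply: (RunMore (c := If i p a b) _ l IH); rewrite /= e.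
Qed.

Lemma run_while i p a (s : ctl a) T n T1 m T2 :
  run s T n T1 -> run (c := While i p a) None T1 m T2 ->
  run (c := While i p a) (Some s) T (n + m) T2.
Proof.
move=> r1 r2; elim: r1 r2 => {s T n T1} [s T x e l|s s' T x n T' e l _ IH] r2.
  by apply: (RunMore (c := While i p a) _ l r2); rewrite /= e.
by apply: (RunMore (c := While i p a) _ l (IH r2)); rewrite /= e.
Qed.

Lemma exec_run c T n T' : exec c T n T' -> run (entry c) T n T'.
Proof.
elim=> {c T n T'}.
- by move=> T i a; apply: (RunLast (x := (i, a, Stay))).
- move=> T i; have := RunLast (c := Mv i true) (s := tt) (T := T)
    (x := (i, rd T i, MoveRight)) erefl isT.
  by rewrite /act /rd upd_id.
- move=> T i l; have := RunLast (c := Mv i false) (s := tt) (T := T)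
    (x := (i, rd T i, MoveLeft)) erefl l.
  by rewrite /act /rd upd_id.
- by move=> c1 c2 T n1 T1 n2 T2 _ r1 _ r2; apply: run_seql r1 r2.
- move=> i p c1 c2 T n T' _ r.
  apply: (@RunMore (If i p c1 c2) None _ T (i, rd T i, Stay) n T' erefl isT); rewrite act_read.
  by case: (p _) r => r; [apply: run_ifl|apply: run_ifr].
- move=> i p c T /negPf np; rewrite -{2}(act_read T i).
  by apply: RunLast => //=; rewrite np.
- move=> i p c T n1 T1 n2 T2 pT _ r1 _ r2.
  apply: (@RunMore (While i p c) None (Some (entry c)) _ (i, rd T i, Stay)) => //.
    by rewrite /= pT.
  by rewrite act_read; apply: run_while r1 r2.
Qed.

Lemma next_ext c (s : ctl c) r r' :
  (forall i, i <= maxt c -> r i = r' i) -> next s r = next s r'.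
Proof.
elim: c s => [i a|i d|a IHa b IHb|i p a IHa b IHb|i p a IHa] //= s h.
- by rewrite h.
- case: s => s; [rewrite IHa|rewrite IHb] => // j hj; apply: h; lia.
- case: s => [[s|s]|]; [rewrite IHa|rewrite IHb|rewrite h] => // [j hj|j hj|];
    try (apply: h); lia.
- case: s => [s|]; [rewrite IHa|rewrite h] => // [j hj|]; try (apply: h); lia.
Qed.

Section Machine.
Variables (c : cmd) (K : nat).
Hypotheses (cK : maxt c <= K) (K0 : 0 < K).

Definition look (r : {ffun 'I_K.+1 -> sym}) (i : nat) : sym :=
  if insub i is Some k then r k else None.

(* When the control leaves [c], the verdict is read off tape [1]. *)
Definition compile : machine := {|
  tapes := K; aux := unit; state := (option (ctl c) + bool)%type;
  start := inl (Some (entry c));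
  verdict := fun q => if q is inr b then Some b else None;
  delta := fun q r =>
    match q with
    | inl (Some s) =>
        let: (o, (i, a, m)) := next s (look r) in
        (inl o, [ffun j : 'I_K.+1 => if j == i :> nat then (a, m) else (r j, Stay)])
    | inl None =>
        (inr (look r 1 == Some (inl true)), [ffun j => (r j, Stay)])
    | inr b => (inr b, [ffun j => (r j, Stay)])
    end |}.

(** The left list is stored nearest cell first, which reverses the index. Comparing by [nth None]
    identifies lists that differ in trailing blanks. *)
Definition tape_rep (u : tape unit) (v : atape) : Prop :=
  (forall k, nth None u.2 k = v.1 (v.2 + k)) /\
  (forall k, nth None u.1 k = if k < v.2 then v.1 (v.2 - k.+1) else None).

Lemma tape_rep_read u v : tape_rep u v -> read u = v.1 v.2.
Proof. by case=> h _; rewrite /read -nth0 h addn0. Qed.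

Lemma tape_rep_act u v a m :
  tape_rep u v -> (if m is MoveLeft then 0 < v.2 else true) ->
  tape_rep (write_move u (a, m)) (upd v.1 v.2 a,
    match m with
    | MoveLeft => v.2.-1 | Stay => v.2 | MoveRight => v.2.+1
    end).
Proof.
case: u v => [l r] [f p] [/= hr hl]; case: m => /= hp; split=> k /=.
- case: k => [|[|k]] /=.
  + rewrite -nth0 hl hp addn0 subn1 upd_other //; lia.
  + by rewrite (_ : p.-1 + 1 = p) ?upd_same //; lia.
  + rewrite nth_behead hr upd_other; last by lia.
    congr (f _); lia.
- rewrite nth_behead hl.
  case: ifP => h; case: ifP => h' //; try lia.
  rewrite upd_other; last by lia.
  congr (f _); lia.
- case: k => [|k] /=; first by rewrite addn0 upd_same.
  by rewrite nth_behead hr upd_other //; lia.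
- rewrite hl; case: ifP => // h; rewrite upd_other //; lia.
- rewrite nth_behead hr upd_other; last by lia.
  congr (f _); lia.
- case: k => [|k] /=; first by rewrite subn1 upd_same.
  rewrite hl ltnS; case: ifP => // h; rewrite upd_other; last by lia.
  congr (f _); lia.
Qed.

Definition store_rep (u : {ffun 'I_K.+1 -> tape unit}) (T : store) : Prop :=
  forall j, tape_rep (u j) (T j).

Lemma look_rep u T i : store_rep u T -> i <= K ->
  look [ffun j => read (u j)] i = rd T i.
Proof.
move=> h iK; rewrite /look (insubT (fun i => i < K.+1) iK) ffunE.
by rewrite (tape_rep_read (h _)).
Qed.

Lemma step_rep (s : ctl c) o x u T :
  store_rep u T -> next s (rd T) = (o, x) -> legal x T ->
  exists2 u', step (M := compile) (inl (Some s), u) = (inl o, u') &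
    store_rep u' (act x T).
Proof.
move=> h e l; rewrite /step /=.
rewrite (@next_ext _ _ _ (rd T)) => [|i hi]; last first.
  by apply: look_rep => //; apply: leq_trans cK.
rewrite e; case: x e l => [[i a] m] e l; eexists; first reflexivity.
move=> j; rewrite !ffunE /act /upd; case: eqP => [ji|_].
  by rewrite -ji; apply: tape_rep_act => //; move: l; rewrite /= -ji; case: (m).
have := tape_rep_act (read (u j)) (m := Stay) (h j) isT.
by rewrite (tape_rep_read (h j)) upd_id -surjective_pairing.
Qed.

Lemma run_rep (s : ctl c) n u T T' :
  store_rep u T -> run s T n T' ->
  exists2 u', iter n (step (M := compile)) (inl (Some s), u) = (inl None, u') &
    store_rep u' T'.
Proof.
move=> h r; elim: r u h => {s T n T'} [s T x e l|s s' T x n T' e l _ IH] u h.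
  exact: step_rep h e l.
have [u1 e1 h1] := step_rep h e l.
have [u2 e2 h2] := IH u1 h1; exists u2 => //.
by rewrite iterSr e1.
Qed.

Lemma decides_within_leq (M : machine) w m n b :
  m <= n -> decides_within M w m b -> decides_within M w n b.
Proof.
move=> mn h; rewrite /decides_within -(subnK mn) iterD.
by elim: (n - m) => //= k IH; rewrite /step IH.
Qed.

(** The word starts in cell 1, so that cell 0 is a blank at which a scan to the left stops. *)
Definition input_tape (w : seq bool) : nat -> sym :=
  fun p => if p is q.+1 then (if q < size w then Some (inl (nth false w q)) else None)
           else None.

Definition init_store (w : seq bool) : store :=
  fun i => if i == 0 then (input_tape w, 1) else (fun=> None, 0).

(** The additional step leads from [inl None] to the state that carries the verdict. *)
Lemma compile_decides w n T' : exec c (init_store w) n T' ->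
  decides_within compile w n.+1 (rd T' 1 == Some (inl true)).
Proof.
move=> /exec_run r; rewrite /decides_within /init.
have h0 : store_rep (init compile w).2 (init_store w).
  move=> j; rewrite /= ffunE /init_store -val_eqE /=; case: eqP => _; last first.
    by split=> k //=; rewrite nth_nil // if_same.
  split=> k /=; last by rewrite nth_nil; case: k.
  case: ltnP => hk; first by rewrite (nth_map false).
  by rewrite nth_default // size_map.
have [u' e hu] := run_rep h0 r.
by rewrite iterS e /step /= (look_rep hu K0).
Qed.

End Machine.
End Compile.

(** * Program specifications with time bounds *)

Definition does (c : cmd) (T : store) (B : nat) (Q : store -> Prop) : Prop :=
  exists n T', [/\ exec c T n T', n <= B & Q T'].

Lemma does_weaken c T B B' (Q Q' : store -> Prop) :
  B <= B' -> (forall T', Q T' -> Q' T') -> does c T B Q -> does c T B' Q'.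
Proof.
move=> BB QQ [n [T' [e h q]]]; exists n, T'; split=> //; last exact: QQ.
exact: leq_trans BB.
Qed.

Lemma does_seq c1 c2 T B1 B2 (Q1 Q : store -> Prop) :
  does c1 T B1 Q1 -> (forall T1, Q1 T1 -> does c2 T1 B2 Q) ->
  does (Seq c1 c2) T (B1 + B2) Q.
Proof.
move=> [n1 [T1 [e1 h1 q1]]] /(_ T1 q1)[n2 [T2 [e2 h2 q2]]].
exists (n1 + n2), T2; split=> //; [exact: ExSeq e1 e2|exact: leq_add].
Qed.

Lemma does_if i (p : pred sym) c1 c2 T B (Q : store -> Prop) :
  does (if p (rd T i) then c1 else c2) T B Q -> does (If i p c1 c2) T B.+1 Q.
Proof. by move=> [n [T' [e h q]]]; exists n.+1, T'; split=> //; apply: ExIf. Qed.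

(** [J] is an invariant indexed by the number of rounds that remain; each round costs the body and
    one test, and the final test costs one more step. *)
Lemma does_while i (p : pred sym) c B (J : nat -> store -> Prop) k T :
  (forall k T, J k.+1 T -> p (rd T i) /\ does c T B (J k)) ->
  (forall T, J 0 T -> ~~ p (rd T i)) ->
  J k T -> does (While i p c) T (k * B.+1).+1 (J 0).
Proof.
move=> hS h0; elim: k T => [|k IH] T hJ.
  by exists 1, T; split=> //; apply: ExWhileF; apply: h0.
have [pT [n1 [T1 [e1 l1 q1]]]] := hS _ _ hJ.
have [n2 [T2 [e2 l2 q2]]] := IH T1 q1.
exists (n1 + n2).+1, T2; split=> //; first exact: ExWhileT pT e1 e2.
by rewrite mulSn; lia.
Qed.

Lemma does_wr i a T :
  does (Wr i a) T 1 (eq (upd T i (upd (T i).1 (T i).2 a, (T i).2))).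
Proof. by exists 1; eexists; split; [apply: ExWr| |]. Qed.

Lemma does_right i T : does (Mv i true) T 1 (eq (upd T i ((T i).1, (T i).2.+1))).
Proof. by exists 1; eexists; split; [apply: ExRight| |]. Qed.

Lemma does_left i f p T : T i = (f, p.+1) ->
  does (Mv i false) T 1 (eq (upd T i (f, p))).
Proof.
move=> Ti; exists 1; eexists; split; [apply: ExLeft|by []|]; by rewrite Ti.
Qed.

Lemma upd_upd (A : Type) (f : nat -> A) i v v' :
  upd (upd f i v) i v' = upd f i v'.
Proof. by apply/funext => j; rewrite /upd; case: eqP. Qed.

Definition nonblank (a : sym) : bool := a != None.

Definition mark : sym := Some (inr tt).

Definition nomark (a : sym) : bool := a != mark.

Definition rewind (i : nat) : cmd :=
  Seq (Mv i false) (Seq (While i nonblank (Mv i false)) (Mv i true)).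

Lemma does_rewind i w T : T i = (input_tape w, (size w).+1) ->
  does (rewind i) T (2 * size w + 3) (eq (upd T i (input_tape w, 1))).
Proof.
move=> Ti; rewrite (_ : 2 * size w + 3 = 1 + ((size w * 2).+1 + 1)); last by lia.
apply: (does_seq (does_left Ti)) => _ <-.
pose J k T' := k <= size w /\ T' = upd T i (input_tape w, k).
apply: (does_seq (Q1 := J 0)).
  apply: (@does_while _ _ _ _ J).
  - move=> k _ [hk ->]; split; first by rewrite /rd upd_same /= hk.
    apply: does_weaken (does_left _); [by []| |exact: upd_same].
    by move=> _ <-; rewrite upd_upd; split=> //; apply: ltnW.
  - by move=> _ [_ ->]; rewrite /rd upd_same.
  - by [].
move=> _ [_ ->]; apply: does_weaken (does_right _ _); [by []|].
by move=> _ <-; rewrite upd_same upd_upd.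
Qed.

(** * Variables, counters and memory on the tapes *)

Definition Vt (i : nat) : nat := 4 + i.*2.
Definition Ct (i : nat) : nat := 5 + i.*2.

(** The value of a counter is its head position: counting is one move, and the test for zero reads
    the mark. *)
Definition counter_tape : nat -> sym := fun p => if p is 0 then mark else None.

(** A false bit is a blank cell, so the all-false memory needs no initialisation beyond the mark in
    cell 0. *)
Definition mem_tape (m : nat -> bool) : nat -> sym :=
  fun p => if p is a.+1 then (if m a then Some (inl true) else None) else mark.

(* Tape [1] holds a flag, tape [2] a scratch counter, tape [3] the memory, tape
   [Vt i] a copy of the input whose head is the [i]-th variable and tape [Ct i]
   the [i]-th counter. *)
Record ginv (D : nat) (w : seq bool) (fl : sym) (s : nat) (m : nat -> bool)
    (q : nat) (v c : nat -> nat) (T : store) : Prop := Ginv {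
  inv_flag : (T 1).2 = 0 /\ (T 1).1 0 = fl;
  inv_scratch : T 2 = (counter_tape, s);
  inv_mem : T 3 = (mem_tape m, q);
  inv_var : forall i, i < D -> T (Vt i) = (input_tape w, v i);
  inv_ctr : forall i, i < D -> T (Ct i) = (counter_tape, c i) }.

Section Moves.
Variables (D : nat) (w : seq bool).

Lemma ginv_wr_flag fl s m q v c T a : ginv D w fl s m q v c T ->
  does (Wr 1 a) T 1 (ginv D w a s m q v c).
Proof.
case=> [[h1 h1'] h2 h3 h4 h5]; apply: does_weaken (does_wr _ _ _) => // _ <-.
split=> [||||i iD]; try by rewrite upd_other ?h2 ?h3.
- by rewrite upd_same h1 /= upd_same.
- by move=> i iD; rewrite upd_other ?h4 // /Vt; lia.
- by rewrite upd_other ?h5 // /Ct; lia.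
Qed.

Lemma ginv_wr_mem fl s m q v c T b : ginv D w fl s m q.+1 v c T ->
  does (Wr 3 (if b then Some (inl true) else None)) T 1
    (ginv D w fl s (upd m q b) q.+1 v c).
Proof.
case=> [h1 h2 h3 h4 h5]; apply: does_weaken (does_wr _ _ _) => // _ <-.
split=> [||||i iD]; try by rewrite upd_other ?h2 ?h3.
- rewrite upd_same h3; congr (_, _); apply/funext => -[|p] //=.
  by rewrite /upd /= eqSS; case: eqP.
- by move=> i iD; rewrite upd_other ?h4 // /Vt; lia.
- by rewrite upd_other ?h5 // /Ct; lia.
Qed.

Lemma ginv_right_scratch fl s m q v c T : ginv D w fl s m q v c T ->
  does (Mv 2 true) T 1 (ginv D w fl s.+1 m q v c).
Proof.
case=> [h1 h2 h3 h4 h5]; apply: does_weaken (does_right _ _) => // _ <-.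
split=> [||||i iD]; try by rewrite upd_other ?h2 ?h3.
- by rewrite upd_same h2.
- by move=> i iD; rewrite upd_other ?h4 // /Vt; lia.
- by rewrite upd_other ?h5 // /Ct; lia.
Qed.

Lemma ginv_left_scratch fl s m q v c T : ginv D w fl s.+1 m q v c T ->
  does (Mv 2 false) T 1 (ginv D w fl s m q v c).
Proof.
case=> [h1 h2 h3 h4 h5]; apply: does_weaken (does_left h2) => // _ <-.
split=> [||||i iD]; try by rewrite upd_other ?h2 ?h3.
- by rewrite upd_same.
- by move=> i iD; rewrite upd_other ?h4 // /Vt; lia.
- by rewrite upd_other ?h5 // /Ct; lia.
Qed.

Lemma ginv_right_mem fl s m q v c T : ginv D w fl s m q v c T ->
  does (Mv 3 true) T 1 (ginv D w fl s m q.+1 v c).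
Proof.
case=> [h1 h2 h3 h4 h5]; apply: does_weaken (does_right _ _) => // _ <-.
split=> [||||i iD]; try by rewrite upd_other ?h2 ?h3.
- by rewrite upd_same h3.
- by move=> i iD; rewrite upd_other ?h4 // /Vt; lia.
- by rewrite upd_other ?h5 // /Ct; lia.
Qed.

Lemma ginv_left_mem fl s m q v c T : ginv D w fl s m q.+1 v c T ->
  does (Mv 3 false) T 1 (ginv D w fl s m q v c).
Proof.
case=> [h1 h2 h3 h4 h5]; apply: does_weaken (does_left h3) => // _ <-.
split=> [||||i iD]; try by rewrite upd_other ?h2 ?h3.
- by rewrite upd_same.
- by move=> i iD; rewrite upd_other ?h4 // /Vt; lia.
- by rewrite upd_other ?h5 // /Ct; lia.
Qed.

Lemma ginv_set_var fl s m q v c T j p : ginv D w fl s m q v c T -> 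
  ginv D w fl s m q (upd v j p) c (upd T (Vt j) (input_tape w, p)).
Proof.
case=> [h1 h2 h3 h4 h5]; split=> [||||i iD]; try by rewrite upd_other ?h2 ?h3.
- move=> i iD; have [->|ij] := eqVneq i j; first by rewrite !upd_same.
  by rewrite !upd_other ?h4 // /Vt; lia.
- by rewrite upd_other ?h5 // /Ct /Vt; lia.
Qed.

Lemma ginv_set_ctr fl s m q v c T j p : ginv D w fl s m q v c T -> 
  ginv D w fl s m q v (upd c j p) (upd T (Ct j) (counter_tape, p)).
Proof.
case=> [h1 h2 h3 h4 h5]; split=> [||||i iD]; try by rewrite upd_other ?h2 ?h3.
- by move=> i iD; rewrite upd_other ?h4 // /Ct /Vt; lia.
- have [->|ij] := eqVneq i j; first by rewrite !upd_same.
  by rewrite !upd_other ?h5 // /Ct; lia.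
Qed.

Lemma ginv_right_var fl s m q v c T j : j < D -> ginv D w fl s m q v c T ->
  does (Mv (Vt j) true) T 1 (ginv D w fl s m q (upd v j (v j).+1) c).
Proof.
move=> jD h; apply: does_weaken (does_right _ _) => // _ <-.
by rewrite (inv_var h jD); apply: ginv_set_var.
Qed.

Lemma ginv_left_var fl s m q v c T j p : j < D -> v j = p.+1 ->
  ginv D w fl s m q v c T ->
  does (Mv (Vt j) false) T 1 (ginv D w fl s m q (upd v j p) c).
Proof.
move=> jD vj h; have := inv_var h jD; rewrite vj => Tj.
apply: does_weaken (does_left Tj) => // _ <-; exact: ginv_set_var.
Qed.

Lemma ginv_right_ctr fl s m q v c T j : j < D -> ginv D w fl s m q v c T ->
  does (Mv (Ct j) true) T 1 (ginv D w fl s m q v (upd c j (c j).+1)).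
Proof.
move=> jD h; apply: does_weaken (does_right _ _) => // _ <-.
by rewrite (inv_ctr h jD); apply: ginv_set_ctr.
Qed.

Lemma ginv_left_ctr fl s m q v c T j p : j < D -> c j = p.+1 ->
  ginv D w fl s m q v c T ->
  does (Mv (Ct j) false) T 1 (ginv D w fl s m q v (upd c j p)).
Proof.
move=> jD cj h; have := inv_ctr h jD; rewrite cj => Tj.
apply: does_weaken (does_left Tj) => // _ <-; exact: ginv_set_ctr.
Qed.

Lemma nomark_mem fl s m q v c T : ginv D w fl s m q v c T ->
  nomark (rd T 3) = (0 < q).
Proof. by move=> h; rewrite /rd (inv_mem h) /=; case: q {h} => //= q; case: (m q). Qed.

Lemma nomark_ctr fl s m q v c T j : j < D -> ginv D w fl s m q v c T ->
  nomark (rd T (Ct j)) = (0 < c j).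
Proof. by move=> jD h; rewrite /rd (inv_ctr h jD) /=; case: (c j). Qed.

Lemma nomark_scratch fl s m q v c T : ginv D w fl s m q v c T ->
  nomark (rd T 2) = (0 < s).
Proof. by move=> h; rewrite /rd (inv_scratch h) /=; case: s {h}. Qed.

Lemma nonblank_var fl s m q v c T j : j < D -> ginv D w fl s m q v c T ->
  nonblank (rd T (Vt j)) = (0 < v j <= size w).
Proof.
by move=> jD h; rewrite /rd (inv_var h jD) /=; case: (v j) => //= p; case: ltnP.
Qed.

End Moves.

Definition vpos (r : seq nat) : nat -> nat := fun i => (nth 0 r i).+1.

Definition layout D w (r : seq nat) m c T : Prop :=
  exists fl, ginv D w fl 0 m 0 (vpos r) c T.

(** By the default of [nth], an unbound variable already stands at the value 0, so a loop binds its
    variable without executing anything. *)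
Lemma vpos_rcons0 r : vpos (rcons r 0) = vpos r.
Proof.
apply/funext => i; rewrite /vpos nth_rcons; case: ltngtP => // h;
  by rewrite nth_default // leq_eqVlt h ?orbT // eqxx.
Qed.

Lemma vpos_rcons r a i : vpos (rcons r a) i = if i == size r then a.+1 else vpos r i.
Proof.
rewrite /vpos nth_rcons; case: ltngtP => // h.
by rewrite nth_default // ltnW.
Qed.

Lemma upd_vpos_rcons r a p : upd (vpos (rcons r a)) (size r) p.+1 = vpos (rcons r p).
Proof.
by apply/funext => i; rewrite /upd !vpos_rcons; case: eqP.
Qed.

(** The head on a copy of the input is itself the loop variable: the blank after the word ends the
    loop, and the rewinding resets the variable to 0. *)
Definition For (d : nat) (c : cmd) : cmd :=
  Seq (While (Vt d) nonblank (Seq c (Mv (Vt d) true))) (rewind (Vt d)).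

Lemma does_for D w r (m : nat -> nat -> bool) (k : nat -> nat -> nat) c B T :
  size r < D ->
  (forall a T, a < size w -> layout D w (rcons r a) (m a) (k a) T ->
     does c T B (layout D w (rcons r a) (m a.+1) (k a.+1))) ->
  layout D w r (m 0) (k 0) T ->
  does (For (size r) c) T (size w * B.+2 + (2 * size w + 4))
    (layout D w r (m (size w)) (k (size w))).
Proof.
move=> rD hc [fl hT].
pose J j T' := j <= size w /\
   layout D w (rcons r (size w - j)) (m (size w - j)) (k (size w - j)) T'.
rewrite (_ : _ + _ = (size w * B.+2).+1 + (2 * size w + 3)); last by lia.
apply: (does_seq (Q1 := J 0)).
  apply: (@does_while _ _ _ _ J (size w)).
  - move=> j T1 [hj [fl1 h1]]; split.
      by rewrite (nonblank_var rD h1) vpos_rcons eqxx; lia.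
    rewrite -addn1; apply: (does_seq (hc _ _ _ (ex_intro _ _ h1))); first by lia.
    move=> T2 [fl2 h2]; apply: does_weaken (ginv_right_var rD h2) => // T3 h3.
    split; first exact: ltnW.
    exists fl2; move: h3; rewrite upd_vpos_rcons [vpos _ _]vpos_rcons eqxx.
    by rewrite subnSK.
  - move=> T1 [_ [fl1 h1]]; rewrite (nonblank_var rD h1) vpos_rcons eqxx; lia.
  - by split=> //; rewrite subnn; exists fl; rewrite vpos_rcons0.
move=> T1 [_]; rewrite subn0 => -[fl1 h1].
have := inv_var h1 rD; rewrite vpos_rcons eqxx => h1v.
apply: does_weaken (does_rewind h1v) => // _ <-.
exists fl1; have := ginv_set_var (size r) 1 h1.
by rewrite upd_vpos_rcons vpos_rcons0.
Qed.

(** The shift keeps the base at least 2 even at [n = 0], so that constants and sums are absorbed by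
    the exponent. *)
Definition pbounded (f : nat -> nat) : Prop := exists e, forall n, f n <= (n + 2) ^ e.

Lemma pbounded_add f g : pbounded f -> pbounded g -> pbounded (fun n => f n + g n).
Proof.
move=> [a ha] [b hb]; exists (maxn a b).+1 => n.
rewrite expnS (leq_trans (leq_add (ha n) (hb n))) //.
have p x : x <= maxn a b -> (n + 2) ^ x <= (n + 2) ^ maxn a b.
  by move=> h; rewrite leq_exp2l //; lia.
have := p a (leq_maxl _ _); have := p b (leq_maxr _ _); nia.
Qed.

Lemma pbounded_mul f g : pbounded f -> pbounded g -> pbounded (fun n => f n * g n).
Proof.
by move=> [a ha] [b hb]; exists (a + b) => n; rewrite expnD leq_mul.
Qed.

Lemma pbounded_const k : pbounded (fun=> k).
Proof.
exists k => n; apply: leq_trans (leq_trans (ltnW (ltn_expl k (isT : 1 < 2))) _) => //.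
by case: k => // k; rewrite leq_exp2r ?leq_addl.
Qed.

Lemma pbounded_id : pbounded id.
Proof. by exists 1 => n; rewrite expn1 leq_addr. Qed.

Definition flag (T : store) : bool := rd T 1 == Some (inl true).

(** * Expressions and statements computable in polynomial time *)

Definition bexp : Type := seq bool -> (nat -> bool) -> seq nat -> bool.
Definition nexp : Type := seq bool -> (nat -> bool) -> seq nat -> nat.
Definition stmt : Type := seq bool -> (nat -> bool) -> seq nat -> nat -> bool.

Definition zero_below (e : nat) (k : nat -> nat) := forall i, i < e -> k i = 0.

Definition below (n : nat) (r : seq nat) := all (fun a => a < n) r.

(* The counters from [e0] on may be in use while [c] is executed. *)
Definition bcomp (d : nat) (P : bexp) : Prop :=
  exists c e0 B, pbounded B /\
  forall D w m r k T, e0 <= D -> size r = d -> below (size w) r ->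
    zero_below e0 k -> layout D w r m k T ->
    does c T (B (size w)) (fun T' => layout D w r m k T' /\ flag T' = P w m r).

(* The value is added to the counter [j]. *)
Definition ncomp (d : nat) (F : nexp) : Prop :=
  exists (c : nat -> cmd) e0 B, pbounded B /\
  forall w m r, size r = d -> below (size w) r -> F w m r <= B (size w) /\
  forall D k T j, e0 <= j -> j < D -> zero_below e0 k -> layout D w r m k T ->
    does (c j) T (B (size w)) (layout D w r m (upd k j (k j + F w m r))).

Definition scomp (d : nat) (S : stmt) : Prop :=
  exists c e0 B, pbounded B /\
  forall D w m r k T, e0 <= D -> size r = d -> below (size w) r ->
    zero_below e0 k -> layout D w r m k T ->
    does c T (B (size w)) (layout D w r (S w m r) k).

Lemma zero_below_leq e e' k : e <= e' -> zero_below e' k -> zero_below e k.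
Proof. by move=> ee h i hi; apply: h; apply: leq_trans ee. Qed.

Lemma zero_below_upd e k j v : e <= j -> zero_below e k -> zero_below e (upd k j v).
Proof. by move=> ej h i hi; rewrite upd_other ?h //; lia. Qed.

Lemma bcomp_ext d (P Q : bexp) :
  (forall w m r, size r = d -> below (size w) r -> P w m r = Q w m r) ->
  bcomp d P -> bcomp d Q.
Proof.
move=> PQ [c [e0 [B [pB h]]]]; exists c, e0, B; split=> // D w m r k T hD sr br hk hT.
by apply: does_weaken (h _ _ _ _ _ _ hD sr br hk hT) => // T'; rewrite PQ.
Qed.

Lemma ncomp_ext d (F G : nexp) :
  (forall w m r, size r = d -> below (size w) r -> F w m r = G w m r) ->
  ncomp d F -> ncomp d G.
Proof.
move=> FG [c [e0 [B [pB h]]]]; exists c, e0, B; split=> // w m r sr br.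
by rewrite -FG //; apply: h.
Qed.

Lemma scomp_ext d (S S' : stmt) :
  (forall w m r, size r = d -> below (size w) r -> S w m r = S' w m r) ->
  scomp d S -> scomp d S'.
Proof.
move=> PQ [c [e0 [B [pB h]]]]; exists c, e0, B; split=> // D w m r k T hD sr br hk hT.
by apply: does_weaken (h _ _ _ _ _ _ hD sr br hk hT) => // T'; rewrite PQ.
Qed.

Ltac pb := repeat first [ assumption | apply: pbounded_const | apply: pbounded_id
  | apply: pbounded_add | apply: pbounded_mul ].

Lemma does_flag D w r m k T b : layout D w r m k T ->
  does (Wr 1 (Some (inl b))) T 1 (fun T' => layout D w r m k T' /\ flag T' = b).
Proof.
move=> [fl h]; apply: does_weaken (ginv_wr_flag (Some (inl b)) h) => // T' h'.
split; first by exists (Some (inl b)).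
by rewrite /flag /rd; have [-> ->] := inv_flag h'; case: b {h'}.
Qed.

Lemma bcomp_const d b : bcomp d (fun _ _ _ => b).
Proof.
exists (Wr 1 (Some (inl b))), 0, (fun=> 1); split; first by pb.
by move=> D w m r k T *; apply: does_flag.
Qed.

Definition is1 (a : sym) : bool := a == Some (inl true).

Lemma is1_flag T : is1 (rd T 1) = flag T. Proof. by []. Qed.

Lemma bcomp_bit d i : i < d -> bcomp d (fun w m r => nth false w (nth 0 r i)).
Proof.
move=> id; exists (If (Vt i) is1 (Wr 1 (Some (inl true))) (Wr 1 (Some (inl false)))).
exists i.+1, (fun=> 2); split; first by pb.
move=> D w m r k T hD sr /allP br _ hT; apply: does_if.
have hr : nth 0 r i < size w by apply: br; rewrite mem_nth // sr.
have -> : is1 (rd T (Vt i)) = nth false w (nth 0 r i).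
  have [fl h] := hT; rewrite /rd (inv_var h hD) /= hr.
  by rewrite /is1; case: nth.
by case: nth; apply: does_flag.
Qed.

Lemma bcomp_if d P Q1 Q2 : bcomp d P -> bcomp d Q1 -> bcomp d Q2 ->
  bcomp d (fun w m r => if P w m r then Q1 w m r else Q2 w m r).
Proof.
move=> [c [e0 [B [pB h]]]] [c1 [e1 [B1 [pB1 h1]]]] [c2 [e2 [B2 [pB2 h2]]]].
exists (Seq c (If 1 is1 c1 c2)), (maxn e0 (maxn e1 e2)).
exists (fun n => B n + (B1 n + B2 n + 1)); split; first by pb.
move=> D w m r k T; rewrite !geq_max => /and3P[hD hD1 hD2] sr br hk hT.
apply: (does_seq (h _ _ _ _ _ _ hD sr br _ hT)).
  by apply: zero_below_leq hk; rewrite leq_maxl.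
move=> T1 [hT1 fT1]; rewrite addn1; apply: does_if; rewrite is1_flag fT1.
case: (P w m r).
  apply: does_weaken (h1 _ _ _ _ _ _ hD1 sr br _ hT1) => //; first by lia.
  by apply: zero_below_leq hk; lia.
apply: does_weaken (h2 _ _ _ _ _ _ hD2 sr br _ hT1) => //; first by lia.
by apply: zero_below_leq hk; lia.
Qed.

Lemma ncomp_if d P F1 F2 : bcomp d P -> ncomp d F1 -> ncomp d F2 ->
  ncomp d (fun w m r => if P w m r then F1 w m r else F2 w m r).
Proof.
move=> [c [e0 [B [pB h]]]] [c1 [e1 [B1 [pB1 h1]]]] [c2 [e2 [B2 [pB2 h2]]]].
exists (fun j => Seq c (If 1 is1 (c1 j) (c2 j))), (maxn e0 (maxn e1 e2)).
exists (fun n => B n + (B1 n + B2 n + 1)); split; first by pb.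
move=> w m r sr br; have [b1 {}h1] := h1 w m r sr br; have [b2 {}h2] := h2 w m r sr br.
split; first by case: (P w m r); lia.
move=> D k T j; rewrite !geq_max => /and3P[hj hj1 hj2] jD hk hT.
apply: (does_seq (h _ _ _ _ _ _ _ sr br _ hT)); first by lia.
  by apply: zero_below_leq hk; rewrite leq_maxl.
move=> T1 [hT1 fT1]; rewrite addn1; apply: does_if; rewrite is1_flag fT1.
case: (P w m r).
  apply: does_weaken (h1 _ _ _ _ _ _ _ hT1) => //; first by lia.
  by apply: zero_below_leq hk; lia.
apply: does_weaken (h2 _ _ _ _ _ _ _ hT1) => //; first by lia.
by apply: zero_below_leq hk; lia.
Qed.

Lemma upd_id_addn0 (k : nat -> nat) j : upd k j (k j + 0) = k.
Proof. by rewrite addn0 upd_id. Qed.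

Lemma ncomp0 d : ncomp d (fun _ _ _ => 0).
Proof.
exists (fun=> Wr 1 (Some (inl true))), 0, (fun=> 1); split; first by pb.
move=> w m r sr br; split=> // D k T j _ jD _ hT; rewrite upd_id_addn0.
by apply: does_weaken (does_flag true hT) => // T' [].
Qed.

Lemma ncomp1 d : ncomp d (fun _ _ _ => 1).
Proof.
exists (fun j => Mv (Ct j) true), 0, (fun=> 1); split; first by pb.
move=> w m r sr br; split=> // D k T j _ jD _ [fl hT]; rewrite addn1.
by apply: does_weaken (ginv_right_ctr jD hT) => // T' h'; exists fl.
Qed.

Lemma ncomp_add d F1 F2 : ncomp d F1 -> ncomp d F2 ->
  ncomp d (fun w m r => F1 w m r + F2 w m r).
Proof.
move=> [c1 [e1 [B1 [pB1 h1]]]] [c2 [e2 [B2 [pB2 h2]]]].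
exists (fun j => Seq (c1 j) (c2 j)), (maxn e1 e2), (fun n => B1 n + B2 n).
split; first by pb.
move=> w m r sr br; have [b1 {}h1] := h1 w m r sr br; have [b2 {}h2] := h2 w m r sr br.
split; first exact: leq_add.
move=> D k T j; rewrite !geq_max => /andP[hj1 hj2] jD hk hT.
apply: (does_seq (h1 _ _ _ _ hj1 jD _ hT)).
  by apply: zero_below_leq hk; rewrite leq_maxl.
move=> T1 hT1; apply: does_weaken (h2 _ _ _ _ hj2 jD _ hT1) => // [T'|].
  by rewrite upd_upd upd_same addnA.
by apply: zero_below_upd => //; apply: zero_below_leq hk; rewrite leq_maxr.
Qed.

(** A head position can only be read by walking to the blank in cell 0. Each step is counted twice,
    in the target counter and in the scratch counter, and the latter brings the head back. *)
Lemma ncomp_var d i : i < d -> ncomp d (fun w m r => nth 0 r i).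
Proof.
move=> id.
exists (fun j => Seq (Mv (Vt i) false) (Seq
  (While (Vt i) nonblank (Seq (Mv (Vt i) false) (Seq (Mv 2 true) (Mv (Ct j) true))))
  (Seq (Mv (Vt i) true)
     (While 2 nomark (Seq (Mv 2 false) (Mv (Vt i) true)))))).
exists i.+1, (fun n => n * 7 + 4); split; first by pb.
move=> w m r sr br; have hr : nth 0 r i < size w.
  by apply: (allP br); rewrite mem_nth // sr.
split; first by lia.
move=> D k T j ij jD _ [fl hT]; have iD : i < D by lia.
set a := nth 0 r i in hr *; have va : vpos r i = a.+1 by [].
apply: (@does_weaken _ _ (1 + ((a * 4).+1 + (1 + (a * 3).+1)))
  _ (layout D w r m (upd k j (k j + a)))) => //; first by lia.
apply: (does_seq (ginv_left_var iD va hT)) => T1 h1.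
pose J n T' := n <= a /\
  ginv D w fl (a - n) m 0 (upd (vpos r) i n) (upd k j (k j + (a - n))) T'.
apply: (does_seq (Q1 := J 0)).
  apply: (@does_while _ _ _ _ J a).
  - move=> n T2 [na h2]; split.
      by rewrite (nonblank_var iD h2) upd_same; lia.
    rewrite -[3]/(1 + (1 + 1)).
    apply: (does_seq (ginv_left_var (p := n) iD _ h2)); first by rewrite upd_same.
    move=> T3 h3; apply: (does_seq (ginv_right_scratch h3)) => T4 h4.
    apply: does_weaken (ginv_right_ctr jD h4) => // T5.
    rewrite !upd_upd upd_same => h5; split; first exact: ltnW.
    by move: h5; rewrite -addnS subnSK.
  - by move=> T2 [_ h2]; rewrite (nonblank_var iD h2) upd_same.
  - by split=> //; rewrite subnn upd_id_addn0.
move=> T2 [_ h2]; apply: (does_seq (ginv_right_var iD h2)) => T3.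
rewrite subn0 upd_upd upd_same => h3.
pose I n T' := n <= a /\
  ginv D w fl n m 0 (upd (vpos r) i (a - n).+1) (upd k j (k j + a)) T'.
apply: (@does_weaken _ _ (a * 3).+1 _ (I 0)) => //.
  by move=> T4 [_]; rewrite subn0 -va upd_id => h4; exists fl.
apply: (@does_while _ _ _ _ I a).
- move=> n T4 [na h4]; split; first by rewrite (nomark_scratch h4).
  rewrite -[2]/(1 + 1); apply: (does_seq (ginv_left_scratch h4)) => T5 h5.
  apply: does_weaken (ginv_right_var iD h5) => // T6.
  rewrite upd_upd upd_same => h6; split; first exact: ltnW.
  by move: h6; rewrite subnSK.
- by move=> T4 [_ h4]; rewrite (nomark_scratch h4).
- by split=> //; rewrite subnn.
Qed.

Lemma below_rcons n r a : below n (rcons r a) = (a < n) && below n r.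
Proof. by rewrite /below all_rcons. Qed.

Lemma ncomp_sum d F : ncomp d.+1 F ->
  ncomp d (fun w m r => \sum_(a < size w) F w m (rcons r a)).
Proof.
move=> [c [e0 [B [pB h]]]].
exists (fun j => For d (c j)), (maxn e0 d.+1).
exists (fun n => n * (B n + 2) + (2 * n + 4)); split; first by pb.
move=> w m r sr br.
have hF a : a < size w -> size (rcons r a) = d.+1 /\ below (size w) (rcons r a).
  by move=> ha; rewrite size_rcons sr below_rcons ha br.
split.
  apply: leq_trans (leq_addr _ _).
  apply: leq_trans (_ : \sum_(a < size w) (B (size w) + 2) <= _); last first.
    by rewrite sum_nat_const card_ord.
  apply: leq_sum => a _; have [sa ba] := hF a (ltn_ord a).
  by have [ha _] := h w m _ sa ba; lia.
move=> D k T j; rewrite geq_max => /andP[hj dj] jD hk hT.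
rewrite -(big_mkord xpredT (fun a => F w m (rcons r a))).
pose K a := upd k j (k j + \sum_(0 <= i < a) F w m (rcons r i)).
have {1}<- := sr; rewrite addn2; apply: (@does_for D w r (fun=> m) K).
- by lia.
- move=> a T1 ha hT1; have [sa ba] := hF a ha; have [_ h1] := h w m _ sa ba.
  have zK : zero_below e0 (K a).
    by apply: zero_below_upd => //; apply: zero_below_leq hk; rewrite leq_maxl.
  apply: does_weaken (h1 _ _ _ _ hj jD zK hT1) => // T2.
  by rewrite /K upd_upd upd_same big_nat_recr //= addnA.
- by rewrite /K big_geq // upd_id_addn0.
Qed.

(** Both values are counted down in parallel, and the flag falls when the second counter is empty
    before the first. The last loop drains what is left of the second, since counters must be
    returned as they were found. *)
Lemma bcomp_le d F1 F2 : ncomp d F1 -> ncomp d F2 ->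
  bcomp d (fun w m r => F1 w m r <= F2 w m r).
Proof.
move=> [c1 [e1 [B1 [pB1 h1]]]] [c2 [e2 [B2 [pB2 h2]]]].
pose e := maxn e1 e2.
exists (Seq (c1 e) (Seq (c2 e.+1) (Seq (Wr 1 (Some (inl true))) (Seq
  (While (Ct e) nomark (Seq (Mv (Ct e) false)
     (If (Ct e.+1) nomark (Mv (Ct e.+1) false) (Wr 1 (Some (inl false))))))
  (While (Ct e.+1) nomark (Mv (Ct e.+1) false)))))), e.+2.
exists (fun n => B1 n + (B2 n + (1 + ((B1 n * 4 + 1) + (B2 n * 2 + 1))))).
split; first by pb.
move=> D w m r k T eD sr br hk hT.
have [b1 {}h1] := h1 w m r sr br; have [b2 {}h2] := h2 w m r sr br.
set x := F1 w m r in b1 h1 *; set y := F2 w m r in b2 h2 *.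
have k0 : k e = 0 by apply: hk.
have k1 : k e.+1 = 0 by apply: hk.
have ee : e.+1 != e by lia.
have ee' : e != e.+1 by lia.
have eD1 : e < D by lia.
apply: (does_seq (h1 _ _ _ e (leq_maxl _ _) eD1 _ hT)).
  by apply: zero_below_leq hk; lia.
move=> T1 hT1; rewrite k0 add0n in hT1.
have ze2 : zero_below e2 (upd k e x).
  by apply: zero_below_upd; [lia|apply: zero_below_leq hk; lia].
apply: (does_seq (h2 _ _ _ e.+1 _ eD ze2 hT1)); first by lia.
move=> T2; rewrite upd_other // k1 add0n => hT2.
apply: (does_seq (does_flag true hT2)) => T3 [[fl3 h3] f3].
pose K a b := upd (upd k e a) e.+1 b.
have K0 : K 0 0 = k.
  apply/funext => i; rewrite /K /upd; have [->|_] := eqVneq i e.+1; first by rewrite k1.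
  by have [->|_] := eqVneq i e; rewrite ?k0.
have Ke a b : K a b e = a by rewrite /K upd_other // upd_same.
have Ke1 a b : K a b e.+1 = b by rewrite /K upd_same.
have Ku a b a' : upd (K a b) e a' = K a' b.
  apply/funext => i; rewrite /K /upd.
  by have [->|_] := eqVneq i e; rewrite ?(negPf ee').
have Ku1 a b b' : upd (K a b) e.+1 b' = K a b' by rewrite /K upd_upd.
pose J n T' := n <= x /\
  ginv D w (Some (inl (x - n <= y))) 0 m 0 (vpos r) (K n (y - (x - n))) T'.
have fl3E : fl3 = Some (inl true).
  by move: f3; rewrite /flag /rd; have [-> ->] := inv_flag h3 => /eqP.
apply: (does_seq (Q1 := J 0)).
  apply: (@does_weaken _ _ (x * 4).+1 _ (J 0)) => //; first by lia.
  apply: (@does_while _ _ _ _ J x).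
  - move=> n T4 [nx h4]; split; first by rewrite (nomark_ctr eD1 h4) Ke.
    rewrite -[3]/(1 + 2).
    apply: (does_seq (ginv_left_ctr eD1 (Ke n.+1 _) h4)).
    rewrite Ku => T5 h5; apply: does_if; rewrite (nomark_ctr eD h5) Ke1.
    case: ifPn => hy.
      apply: does_weaken (ginv_left_ctr (p := y - (x - n)) eD _ h5) => //.
        move=> T6; rewrite Ku1 => h6; split; first exact: ltnW.
        by move: h6; rewrite (_ : x - n.+1 <= y = (x - n <= y)) //; lia.
      by rewrite Ke1; lia.
    apply: does_weaken (ginv_wr_flag (Some (inl false)) h5) => // T6 h6.
    split; first exact: ltnW.
    have -> : (x - n <= y) = false by lia.
    by have -> : y - (x - n) = y - (x - n.+1) by lia.
  - by move=> T4 [_ h4]; rewrite (nomark_ctr eD1 h4) Ke.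
  - by split=> //; rewrite subnn subn0 -fl3E.
move=> T4 [_]; rewrite subn0 => h4.
pose I n T' := ginv D w (Some (inl (x <= y))) 0 m 0 (vpos r) (K 0 n) T'.
apply: (@does_weaken _ _ ((y - x) * 2).+1 _ (I 0)) => //; first by lia.
  move=> T5; rewrite /I K0 => h5; split; first by eexists; apply: h5.
  by rewrite /flag /rd; have [-> ->] := inv_flag h5; case: (x <= y).
apply: (@does_while _ _ _ _ I (y - x)) => //.
- move=> n T5 h5; split; first by rewrite (nomark_ctr eD h5) Ke1.
  apply: does_weaken (ginv_left_ctr eD (Ke1 0 n.+1) h5) => //.
  by move=> T6; rewrite Ku1.
- by move=> T5 h5; rewrite (nomark_ctr eD h5) Ke1.
Qed.

(** Turns a counter into an address: the counter is emptied while the memory head advances, and the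
    last move accounts for the mark in cell 0. *)
Definition seek (j : nat) : cmd :=
  Seq (While (Ct j) nomark (Seq (Mv (Ct j) false) (Mv 3 true))) (Mv 3 true).

Lemma does_seek D w fl m v k j a T : j < D -> k j = 0 ->
  ginv D w fl 0 m 0 v (upd k j a) T ->
  does (seek j) T (a * 3 + 2) (ginv D w fl 0 m a.+1 v k).
Proof.
move=> jD kj hT; rewrite (_ : a * 3 + 2 = (a * 3).+1 + 1); last by lia.
pose J n T' := n <= a /\ ginv D w fl 0 m (a - n) v (upd k j n) T'.
apply: (does_seq (Q1 := J 0)).
  apply: (@does_while _ _ _ _ J a).
  - move=> n T1 [na h1]; split; first by rewrite (nomark_ctr jD h1) upd_same.
    rewrite -[2]/(1 + 1).
    apply: (does_seq (ginv_left_ctr (p := n) jD _ h1)); first by rewrite upd_same.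
    move=> T2 h2; apply: does_weaken (ginv_right_mem h2) => // T3.
    rewrite upd_upd => h3; split; first exact: ltnW.
    by move: h3; rewrite subnSK.
  - by move=> T1 [_ h1]; rewrite (nomark_ctr jD h1) upd_same.
  - by split=> //; rewrite subnn.
move=> T1 [_]; rewrite subn0 (_ : upd k j 0 = k) => [h1|]; last first.
  by apply/funext => i; rewrite /upd; case: eqP => [->|]; rewrite ?kj.
exact: ginv_right_mem h1.
Qed.

Lemma does_unseek D w fl m v k a T : ginv D w fl 0 m a v k T ->
  does (While 3 nomark (Mv 3 false)) T (a * 2 + 1) (ginv D w fl 0 m 0 v k).
Proof.
move=> hT; rewrite addn1.
apply: (@does_while _ _ _ _ (fun n => ginv D w fl 0 m n v k) a) => //.
  move=> n T1 h1; split; first by rewrite (nomark_mem h1).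
  exact: ginv_left_mem.
by move=> T1 h1; rewrite (nomark_mem h1).
Qed.

Lemma bcomp_mem d F : ncomp d F -> bcomp d (fun w m r => m (F w m r)).
Proof.
move=> [c [e [B [pB h]]]].
exists (Seq (c e) (Seq (seek e) (Seq
  (If 3 is1 (Wr 1 (Some (inl true))) (Wr 1 (Some (inl false))))
  (While 3 nomark (Mv 3 false))))), e.+1.
exists (fun n => B n + (B n * 3 + 2 + (2 + (B n * 2 + 3)))); split; first by pb.
move=> D w m r k T eD sr br hk hT; have [b {}h] := h w m r sr br.
have ke : k e = 0 by apply: hk.
apply: (does_seq (h _ _ _ e (leqnn _) eD _ hT)).
  by apply: zero_below_leq hk.
move=> T1 [fl]; rewrite ke add0n; set a := F w m r in b * => h1.
apply: (@does_weaken _ _ (a * 3 + 2 + (2 + (a.+1 * 2 + 1))) _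
  (fun T' => layout D w r m k T' /\ flag T' = m a)) => //; first by lia.
apply: (does_seq (does_seek eD ke h1)) => T2 h2.
apply: (does_seq (Q1 := ginv D w (Some (inl (m a))) 0 m a.+1 (vpos r) k)).
  apply: does_if; rewrite {1}/rd (inv_mem h2) /=.
  by case: (m a) => /=; apply: ginv_wr_flag h2.
move=> T3 h3; apply: does_weaken (does_unseek h3) => // T4 h4.
split; first by eexists; apply: h4.
by rewrite /flag /rd; have [-> ->] := inv_flag h4; case: (m a).
Qed.

Lemma scomp_asg d F P : ncomp d F -> bcomp d P ->
  scomp d (fun w m r => upd m (F w m r) (P w m r)).
Proof.
move=> [c [e [B [pB h]]]] [c' [e' [B' [pB' h']]]]; pose j := maxn e e'.
exists (Seq (c j) (Seq c' (Seq (seek j) (Seq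
  (If 1 is1 (Wr 3 (Some (inl true))) (Wr 3 None))
  (While 3 nomark (Mv 3 false)))))), j.+1.
exists (fun n => B n + (B' n + (B n * 3 + 2 + (2 + (B n * 2 + 3))))).
split; first by pb.
move=> D w m r k T jD sr br hk hT; have [b {}h] := h w m r sr br.
have kj : k j = 0 by apply: hk.
apply: (does_seq (h _ _ _ j (leq_maxl _ _) jD _ hT)).
  by apply: zero_below_leq hk; lia.
move=> T1; rewrite kj add0n; set a := F w m r in b * => h1.
apply: (does_seq (h' _ _ _ _ _ _ _ sr br _ h1)); first by lia.
  by apply: zero_below_upd; [lia|apply: zero_below_leq hk; lia].
move=> T2 [[fl h2] f2].
apply: (@does_weaken _ _ (a * 3 + 2 + (2 + (a.+1 * 2 + 1))) _
  (layout D w r (upd m a (P w m r)) k)) => //; first by lia.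
apply: (does_seq (does_seek jD kj h2)) => T3 h3.
have f3 : is1 (rd T3 1) = P w m r.
  rewrite -f2 /flag /is1 /rd; have [-> ->] := inv_flag h3.
  by have [-> ->] := inv_flag h2.
apply: (does_seq (Q1 := ginv D w fl 0 (upd m a (P w m r)) a.+1 (vpos r) k)).
  apply: does_if; rewrite f3; have := ginv_wr_mem (P w m r) h3.
  by case: (P w m r).
move=> T4 h4; apply: does_weaken (does_unseek h4) => // T5 h5.
by exists fl.
Qed.

Lemma scomp_seq d (S1 S2 : stmt) : scomp d S1 -> scomp d S2 ->
  scomp d (fun w m r => S2 w (S1 w m r) r).
Proof.
move=> [c1 [e1 [B1 [pB1 h1]]]] [c2 [e2 [B2 [pB2 h2]]]].
exists (Seq c1 c2), (maxn e1 e2), (fun n => B1 n + B2 n); split; first by pb.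
move=> D w m r k T; rewrite geq_max => /andP[hD1 hD2] sr br hk hT.
apply: (does_seq (h1 _ _ _ _ _ _ hD1 sr br _ hT)).
  by apply: zero_below_leq hk; lia.
move=> T1 hT1; apply: h2 => //.
by apply: zero_below_leq hk; lia.
Qed.

Lemma scomp_for d (S : stmt) : scomp d.+1 S ->
  scomp d (fun w m r => foldl (fun m' a => S w m' (rcons r a)) m (iota 0 (size w))).
Proof.
move=> [c [e0 [B [pB h]]]].
exists (For d c), (maxn e0 d.+1), (fun n => n * (B n + 2) + (2 * n + 4)).
split; first by pb.
move=> D w m r k T; rewrite geq_max => /andP[hD dD] sr br hk hT.
pose M a := foldl (fun m' a => S w m' (rcons r a)) m (iota 0 a).
have {1}<- := sr; rewrite addn2; apply: (@does_for D w r M (fun=> k)) => //.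
  by rewrite sr.
move=> a T1 ha hT1; rewrite /M -addn1 iotaD foldl_cat add0n /=.
apply: h => //; first by rewrite size_rcons sr.
  by rewrite below_rcons ha.
by apply: zero_below_leq hk; lia.
Qed.

Definition copy (i : nat) : cmd :=
  Seq (Mv i true) (Seq
    (While 0 nonblank (Seq
       (If 0 is1 (Wr i (Some (inl true))) (Wr i (Some (inl false))))
       (Seq (Mv i true) (Mv 0 true))))
    (Seq (rewind 0) (rewind i))).

Lemma does_copy i w T : i != 0 -> T 0 = (input_tape w, 1) ->
  T i = (fun=> None, 0) ->
  does (copy i) T (9 * size w + 8) (eq (upd T i (input_tape w, 1))).
Proof.
move=> i0 T0 Ti; have i0' : 0 != i by rewrite eq_sym.
pose part p := (fun q => if q <= p then input_tape w q else None) : nat -> sym.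
pose St p := upd (upd T i (part p, p.+1)) 0 (input_tape w, p.+1).
rewrite (_ : _ + _ = 1 + ((size w * 5).+1 + ((2 * size w + 3) + (2 * size w + 3)))); last by lia.
have StE p : St p i = (part p, p.+1) by rewrite /St upd_other ?upd_same.
have St0 p : St p 0 = (input_tape w, p.+1) by rewrite /St upd_same.
apply: (does_seq (does_right _ _)) => _ <-.
pose J k T' := k <= size w /\ T' = St (size w - k).
apply: (does_seq (Q1 := J 0)).
  apply: (@does_while _ _ _ _ J (size w)).
  - move=> k _ [hk ->]; set a := size w - k.+1.
    have aw : a < size w by rewrite /a; lia.
    have hr : rd (St a) 0 = Some (inl (nth false w a)).
      by rewrite /rd St0 /= aw.
    split; first by rewrite hr.
    rewrite -[4]/(2 + (1 + 1)).
    apply: (does_seq (Q1 := eq (upd (St a) i (part a.+1, a.+1)))).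
      apply: does_if; rewrite hr.
      have : does (Wr i (Some (inl (nth false w a)))) (St a) 1
          (eq (upd (St a) i (part a.+1, a.+1))).
        apply: does_weaken (does_wr _ _ _) => // _ <-.
        rewrite StE /=; congr (upd _ _ (_, _)); apply/funext => q.
        rewrite /part /upd leq_eqVlt ltnS; case: eqP => //= ->.
        by rewrite /= aw.
      by case: (nth false w a).
    move=> _ <-; apply: (does_seq (does_right _ _)) => _ <-.
    apply: does_weaken (does_right _ _) => // _ <-.
    split; first exact: ltnW.
    rewrite (_ : size w - k = a.+1); last by rewrite /a; lia.
    rewrite !upd_same upd_upd (upd_other _ _ i0') St0 /=.
    apply/funext => j; rewrite /St /upd; case: eqP => // j0.
    by case: eqP => // ji.
  - by move=> _ [_ ->]; rewrite /rd St0 /= subn0 ltnn.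
  - split=> //; rewrite subnn Ti /=; apply/funext => j; rewrite /St /upd.
    have [->|_] := eqVneq j i; last by case: eqP => [->|].
    rewrite (negPf i0); congr (_, _); apply/funext => q; rewrite /part.
    by case: q.
move=> _ [_ ->]; rewrite subn0.
apply: (does_seq (does_rewind (St0 _))) => _ <-.
have SiE : upd (St (size w)) 0 (input_tape w, 1) i = (input_tape w, (size w).+1).
  rewrite upd_other // StE; congr (_, _); apply/funext => q; rewrite /part.
  by case: leqP => //; case: q => //= q; rewrite ltnS => h; rewrite ltnNge h.
apply: does_weaken (does_rewind SiE) => // _ <-.
apply/funext => j; rewrite /St /upd; case: eqP => // ji.
by case: eqP => // ->.
Qed.

Fixpoint setup (D : nat) : cmd :=
  if D is D'.+1 then
    Seq (setup D') (Seq (copy (Vt D')) (Wr (Ct D') mark))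
  else Seq (Wr 2 mark) (Wr 3 mark).

Lemma does_setup D w : does (setup D) (init_store w) (D * (9 * size w + 9) + 2)
  (fun T => [/\ layout D w [::] (fun=> false) (fun=> 0) T, T 0 = (input_tape w, 1) &
     forall i, D <= i -> T (Vt i) = (fun=> None, 0) /\ T (Ct i) = (fun=> None, 0)]).
Proof.
have markE : upd (fun=> None) 0 mark = counter_tape by apply/funext => -[].
elim: D => [|D IH] /=.
  apply: (does_seq (does_wr _ _ _)) => _ <-.
  apply: does_weaken (does_wr _ _ _) => // _ <-; rewrite /init_store.
  split=> //; exists None; split=> //.
    by rewrite upd_other // upd_same markE.
  by rewrite upd_same upd_other // markE; congr (_, _); apply/funext => -[].
rewrite (_ : D.+1 * _ + 2 = D * (9 * size w + 9) + 2 + (9 * size w + 8 + 1)); last first.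
  by rewrite mulSn; lia.
apply: (does_seq IH) => T [[fl h] T0 hD].
have [hV hC] := hD D (leqnn D).
have VD0 : Vt D != 0 by [].
apply: (does_seq (does_copy VD0 T0 hV)) => _ <-.
apply: does_weaken (does_wr _ _ _) => // _ <-.
have VC i j : Vt i != Ct j by rewrite /Vt /Ct; lia.
have CV i j : Ct i != Vt j by rewrite /Vt /Ct; lia.
have VV i j : i != j -> Vt i != Vt j by rewrite /Vt; lia.
have CC i j : i != j -> Ct i != Ct j by rewrite /Ct; lia.
rewrite (upd_other _ _ (CV _ _)) hC /= markE.
have [h1 h2 h3 h4 h5] := h.
split.
- exists fl; split=> //.
  + move=> i; rewrite ltnS leq_eqVlt => /orP[/eqP->|iD].
      by rewrite upd_other // upd_same /vpos nth_nil.
    by rewrite !upd_other ?h4 ?VV // neq_ltn iD.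
  + move=> i; rewrite ltnS leq_eqVlt => /orP[/eqP->|iD].
      by rewrite upd_same.
    by rewrite !upd_other ?h5 ?CC // neq_ltn iD.
- by [].
- move=> i Di; have [hi1 hi2] := hD i (ltnW Di).
  by rewrite !upd_other ?VV ?CC // neq_ltn Di orbT.
Qed.

Theorem comp_decides (S : stmt) (P : bexp) : scomp 0 S -> bcomp 0 P ->
  exists (M : machine) (p : {poly nat}), forall w,
    decides_within M w (p.[size w])%R (P w (S w (fun=> false) [::]) [::]).
Proof.
move=> [c1 [e1 [B1 [pB1 h1]]]] [c2 [e2 [B2 [pB2 h2]]]].
pose D := maxn e1 e2; pose c := Seq (setup D) (Seq c1 c2).
have hc w : does c (init_store w) (D * (9 * size w + 9) + 2 + (B1 (size w) + B2 (size w)))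
    (fun T => flag T = P w (S w (fun=> false) [::]) [::]).
  apply: (does_seq (does_setup D w)) => T1 [hT1 _ _].
  apply: (does_seq (h1 _ _ _ _ _ _ _ _ _ _ hT1)) => // [|T2 hT2].
    exact: leq_maxl.
  apply: does_weaken (h2 _ _ _ _ _ _ _ _ _ _ hT2) => // [T' []//|].
  exact: leq_maxr.
have [e he] : pbounded (fun n => D * (9 * n + 9) + 2 + (B1 n + B2 n) + 1) by pb.
exists (compile c (maxn (maxt c) 1)), (('X + 2%:P) ^+ e)%R => w.
have [n [T' [en ln <-]]] := hc w.
apply: decides_within_leq (compile_decides _ _ en); last first.
- exact: leq_maxr.
- exact: leq_maxl.
have -> : ((('X + 2%:P) ^+ e).[size w])%R = (size w + 2) ^ e.
  by rewrite horner_exp hornerD hornerX hornerC natrXE natrDE.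
by apply: leq_trans (he (size w)); rewrite addn1 ltnS.
Qed.

(** * A language of expressions closed under substitution and bounded quantification *)

Definition pick_vars (s r : seq nat) : seq nat := [seq nth 0 r i | i <- s].

(* Quantifying over the variables that are substituted for the arguments makes
   the notion closed under substitution and under binding a variable. *)
Definition bfun (k : nat) (P : bexp) : Prop :=
  forall d s, size s = k -> below d s ->
    bcomp d (fun w m r => P w m (pick_vars s r)).

Definition nfun (k : nat) (F : nexp) : Prop :=
  forall d s, size s = k -> below d s ->
    ncomp d (fun w m r => F w m (pick_vars s r)).

Lemma size_pick_vars s r : size (pick_vars s r) = size s.
Proof. exact: size_map. Qed.

Lemma below_pick_vars n d s r : size r = d -> below d s -> below n r ->
  below n (pick_vars s r).
Proof.
move=> sr /allP sd /allP br; apply/allP => _ /mapP[i /sd isr ->].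
by apply: br; rewrite mem_nth // sr.
Qed.

Lemma pick_varsA s s' r : below (size s') s ->
  pick_vars s (pick_vars s' r) = pick_vars (pick_vars s s') r.
Proof.
move=> /allP ss; rewrite /pick_vars -map_comp; apply/eq_in_map => i /ss hi /=.
by rewrite (nth_map 0).
Qed.

Lemma pick_vars_iota n r : n = size r -> pick_vars (iota 0 n) r = r.
Proof. by move=> ->; rewrite /pick_vars map_nth_iota0 ?take_size. Qed.

Lemma pick_vars_rcons s r a : below (size r) s ->
  pick_vars s (rcons r a) = pick_vars s r.
Proof.
move=> /allP h; apply/eq_in_map => i /h hi.
by rewrite nth_rcons hi.
Qed.

Lemma below_iota i n d : i + n <= d -> below d (iota i n).
Proof. by move=> h; apply/allP => j; rewrite mem_iota; lia. Qed.

Lemma below_leq n n' s : n <= n' -> below n s -> below n' s.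
Proof. by move=> h /allP b; apply/allP => i /b /leq_trans; apply. Qed.

Section Kary.
Variable k : nat.

Lemma bfun_ext (P Q : bexp) :
  (forall w m x, size x = k -> below (size w) x -> P w m x = Q w m x) ->
  bfun k P -> bfun k Q.
Proof.
move=> PQ hP d s sk sd; apply: bcomp_ext (hP d s sk sd) => w m r sr br.
by apply: PQ; rewrite ?size_pick_vars //; apply: below_pick_vars sr sd br.
Qed.

Lemma nfun_ext (F G : nexp) :
  (forall w m x, size x = k -> below (size w) x -> F w m x = G w m x) ->
  nfun k F -> nfun k G.
Proof.
move=> PQ hP d s sk sd; apply: ncomp_ext (hP d s sk sd) => w m r sr br.
by apply: PQ; rewrite ?size_pick_vars //; apply: below_pick_vars sr sd br.
Qed.

Lemma bfun_bcomp P : bfun k P -> bcomp k P.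
Proof.
move=> h; apply: bcomp_ext (h k (iota 0 k) (size_iota _ _) (below_iota (leqnn _))).
by move=> w m r sr _ /=; rewrite pick_vars_iota.
Qed.

Lemma bfun_sub l P s : bfun l P -> size s = l -> below k s ->
  bfun k (fun w m x => P w m (pick_vars s x)).
Proof.
move=> hP sl sk d s' s'k s'd.
apply: bcomp_ext (hP d (pick_vars s s') _ _).
- by move=> w m r _ _ /=; rewrite pick_varsA // s'k.
- by rewrite size_pick_vars.
- exact: below_pick_vars s'k sk s'd.
Qed.

Lemma nfun_sub l F s : nfun l F -> size s = l -> below k s ->
  nfun k (fun w m x => F w m (pick_vars s x)).
Proof.
move=> hP sl sk d s' s'k s'd.
apply: ncomp_ext (hP d (pick_vars s s') _ _).
- by move=> w m r _ _ /=; rewrite pick_varsA // s'k.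
- by rewrite size_pick_vars.
- exact: below_pick_vars s'k sk s'd.
Qed.

Lemma bfun_const b : bfun k (fun _ _ _ => b).
Proof. by move=> *; apply: bcomp_const. Qed.

Lemma bfun_if P Q1 Q2 : bfun k P -> bfun k Q1 -> bfun k Q2 ->
  bfun k (fun w m x => if P w m x then Q1 w m x else Q2 w m x).
Proof. by move=> h h1 h2 d s sk sd; apply: bcomp_if; [apply: h|apply: h1|apply: h2]. Qed.

Lemma bfun_not P : bfun k P -> bfun k (fun w m x => ~~ P w m x).
Proof. by move=> h; apply: (bfun_if h (bfun_const false) (bfun_const true)). Qed.

Lemma bfun_and P Q : bfun k P -> bfun k Q -> bfun k (fun w m x => P w m x && Q w m x).
Proof. by move=> h h'; apply: (bfun_if h h' (bfun_const false)). Qed.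

Lemma bfun_or P Q : bfun k P -> bfun k Q -> bfun k (fun w m x => P w m x || Q w m x).
Proof. by move=> h h'; apply: (bfun_if h (bfun_const true) h'). Qed.

Lemma bfun_eqb P Q : bfun k P -> bfun k Q -> bfun k (fun w m x => P w m x == Q w m x).
Proof.
move=> h h'; apply: bfun_ext (bfun_if h h' (bfun_not h')) => w m x _ _.
by case: (P w m x); case: (Q w m x).
Qed.

Lemma bfun_le F G : nfun k F -> nfun k G -> bfun k (fun w m x => F w m x <= G w m x).
Proof. by move=> h h' d s sk sd; apply: bcomp_le; [apply: h|apply: h']. Qed.

Lemma bfun_mem F : nfun k F -> bfun k (fun w m x => m (F w m x)).
Proof. by move=> h d s sk sd; apply: bcomp_mem; apply: h. Qed.

Lemma nfun_if P F G : bfun k P -> nfun k F -> nfun k G ->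
  nfun k (fun w m x => if P w m x then F w m x else G w m x).
Proof. by move=> h h1 h2 d s sk sd; apply: ncomp_if; [apply: h|apply: h1|apply: h2]. Qed.

Lemma nfun_const c : nfun k (fun _ _ _ => c).
Proof.
elim: c => [|c IH] d s sk sd; first exact: ncomp0.
apply: ncomp_ext (ncomp_add (ncomp1 d) (IH d s sk sd)) => w m r _ _.
exact: add1n.
Qed.

Lemma nfun_add F G : nfun k F -> nfun k G -> nfun k (fun w m x => F w m x + G w m x).
Proof. by move=> h h' d s sk sd; apply: ncomp_add; [apply: h|apply: h']. Qed.

Lemma nfun_of_bool P : bfun k P -> nfun k (fun w m x => P w m x : nat).
Proof.
move=> h; apply: nfun_ext (nfun_if h (nfun_const 1) (nfun_const 0)) => w m x _ _.
by case: (P w m x).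
Qed.

Lemma nfun_var i : i < k -> nfun k (fun w m x => nth 0 x i).
Proof.
move=> ik d s sk sd.
have hi : nth 0 s i < d by apply: (allP sd); rewrite mem_nth // sk.
by apply: ncomp_ext (ncomp_var hi) => w m r _ _; rewrite (nth_map 0) // sk.
Qed.

Lemma bfun_bit i : i < k -> bfun k (fun w m x => nth false w (nth 0 x i)).
Proof.
move=> ik d s sk sd.
have hi : nth 0 s i < d by apply: (allP sd); rewrite mem_nth // sk.
by apply: bcomp_ext (bcomp_bit hi) => w m r _ _; rewrite (nth_map 0) // sk.
Qed.

Lemma bfun_eq F G : nfun k F -> nfun k G -> bfun k (fun w m x => F w m x == G w m x).
Proof.
move=> h h'; apply: bfun_ext (bfun_and (bfun_le h h') (bfun_le h' h)) => w m x _ _.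
by rewrite eqn_leq.
Qed.

Lemma bfun_all (I : Type) (s : seq I) (P : I -> bexp) : (forall i, bfun k (P i)) ->
  bfun k (fun w m x => all (fun i => P i w m x) s).
Proof.
by move=> h; elim: s => [|i s IH]; [apply: bfun_const|apply: bfun_and].
Qed.

Lemma bfun_all_in (I : eqType) (s : seq I) (P : I -> bexp) :
  (forall i, i \in s -> bfun k (P i)) ->
  bfun k (fun w m x => all (fun i => P i w m x) s).
Proof.
elim: s => [|i s IH] h; first exact: bfun_const.
apply: bfun_and; first by apply: h; rewrite mem_head.
by apply: IH => j js; apply: h; rewrite inE js orbT.
Qed.

End Kary.
Arguments nfun_const k c : clear implicits.
Arguments bfun_const k b : clear implicits.

Lemma nfun_sum k F : nfun k.+1 F ->
  nfun k (fun w m x => \sum_(a < size w) F w m (rcons x a)).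
Proof.
move=> h d s sk sd; have := h d.+1 (rcons s d).
rewrite size_rcons sk below_rcons ltnSn (below_leq _ sd) // => /(_ erefl isT)/ncomp_sum.
apply: ncomp_ext => w m r sr br /=; apply: eq_bigr => a _; congr (F w m _).
rewrite /pick_vars map_rcons nth_rcons sr ltnn eqxx; congr rcons.
by apply: pick_vars_rcons; rewrite sr.
Qed.

Lemma nfun_lift k F : nfun k F -> nfun k.+1 (fun w m x => F w m (take k x)).
Proof.
move=> h; apply: nfun_ext (nfun_sub (k := k.+1) (s := iota 0 k) h _ _).
- move=> w m x sx _; congr (F w m _).
  rewrite /pick_vars -[in RHS](@pick_vars_iota k (take k x)).
    apply/eq_in_map => i; rewrite mem_iota => /andP[_ ik].
    by rewrite nth_take.
  by rewrite size_takel // sx.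
- by rewrite size_iota.
- exact: below_iota.
Qed.

Lemma take_rcons k (x : seq nat) a : size x = k -> take k (rcons x a) = x.
Proof. by move=> <-; rewrite -cats1 take_size_cat. Qed.

Lemma nfun_mulN k F : nfun k F -> nfun k (fun w m x => F w m x * size w).
Proof.
move=> h; apply: nfun_ext (nfun_sum (nfun_lift h)) => w m x sx _.
under eq_bigr => a _ do rewrite take_rcons //.
by rewrite sum_nat_const card_ord mulnC.
Qed.

(* Loops run up to the length of the input, hence the truncation. *)
Lemma nfun_mul k F G : nfun k F -> nfun k G ->
  nfun k (fun w m x => minn (F w m x) (size w) * G w m x).
Proof.
move=> hF hG.
have last_lt : bfun k.+1 (fun w m x => nth 0 x k < F w m (take k x)).
  apply: bfun_ext (bfun_not (bfun_le (nfun_lift hF) (nfun_var (ltnSn k)))).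
  by move=> w m x _ _; rewrite -ltnNge.
have := nfun_sum (nfun_if last_lt (nfun_lift hG) (nfun_const _ 0)).
apply: nfun_ext => w m x sx _ /=.
under eq_bigr => a _ do rewrite take_rcons // nth_rcons sx ltnn eqxx /=.
elim: (size w) => [|n IH]; first by rewrite big_ord0 minn0.
rewrite big_ord_recr /= IH (_ : minn _ n.+1 = minn (F w m x) n + (n < F w m x)).
  by rewrite mulnDl; case: ltnP; rewrite ?mul1n.
by case: ltnP; lia.
Qed.

(** A search is a sum of truth values compared with 0, so quantifiers need no program of their
    own. *)
Lemma bfun_has_nat k P : bfun k.+1 P ->
  bfun k (fun w m x => has (fun a => P w m (rcons x a)) (iota 0 (size w))).
Proof.
move=> h; apply: bfun_ext (bfun_not (bfun_le (nfun_sum (nfun_of_bool h)) (nfun_const k 0))).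
move=> w m x _ _; rewrite leqn0 sum_nat_eq0; apply/negP/hasP => [h0|[a]].
  case: (boolP (has (fun a => P w m (rcons x a)) (iota 0 (size w)))) => [/hasP//|/hasPn h1].
  case: h0; apply/forallP => a; apply/implyP => _; rewrite eqb0.
  by apply: h1; rewrite mem_iota /= add0n.
rewrite mem_iota /= add0n => aw Pa /forallP/(_ (Ordinal aw))/implyP/(_ isT) /=.
by rewrite Pa.
Qed.

Lemma bfun_all_nat k P : bfun k.+1 P ->
  bfun k (fun w m x => all (fun a => P w m (rcons x a)) (iota 0 (size w))).
Proof.
move=> h; apply: bfun_ext (bfun_not (bfun_has_nat (bfun_not h))) => w m x _ _.
by rewrite -all_predC; apply: eq_all => a /=; rewrite negbK.
Qed.

(** Only variables give direct access to the input. A computed position is reached by searching for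
    a variable equal to it; beyond the end the search fails, in agreement with the default
    [false]. *)
Lemma bfun_nth k F : nfun k F -> bfun k (fun w m x => nth false w (F w m x)).
Proof.
move=> h; apply: bfun_ext (bfun_has_nat (bfun_and
  (bfun_eq (nfun_lift h) (nfun_var (ltnSn k))) (bfun_bit (ltnSn k)))).
move=> w m x sx _; rewrite (@eq_has _ _ (fun a => (F w m x == a) && nth false w a)).
  apply/hasP/idP => [[a _ /andP[/eqP-> //]]|hF].
  exists (F w m x); last by rewrite eqxx.
  rewrite mem_iota add0n /=; case: ltnP => // hw.
  by rewrite nth_default in hF.
by move=> a /=; rewrite take_rcons // nth_rcons sx ltnn eqxx.
Qed.

Fixpoint tups (n j : nat) : seq (seq nat) :=
  if j is j'.+1 then [seq a :: s | a <- iota 0 n, s <- tups n j'] else [:: [::]].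

Lemma mem_tups n j s : (s \in tups n j) = (size s == j) && below n s.
Proof.
elim: j s => [|j IH] [|a s] //=.
  by apply/allpairsP => -[[a s] [_ _]].
rewrite eqSS; apply/allpairsP/idP => [[[b u] /= [+ + [-> ->]]]|].
  by rewrite IH mem_iota add0n => /= -> /andP[-> ->].
case/and3P=> sj an sn; exists (a, s); split=> //=; first by rewrite mem_iota.
by rewrite IH sj.
Qed.

Lemma uniq_tups n j : uniq (tups n j).
Proof.
elim: j => //= j IH; apply: allpairs_uniq => //; first exact: iota_uniq.
by move=> [a s] [b u] _ _ [-> ->].
Qed.

Lemma nfun_sum_tups j k F : nfun (k + j) F ->
  nfun k (fun w m x => \sum_(z <- tups (size w) j) F w m (x ++ z)).
Proof.
elim: j k F => [|j IH] k F h.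
  rewrite addn0 in h; apply: nfun_ext h => w m x _ _.
  by rewrite /= big_seq1 cats0.
rewrite addnS -addSn in h; apply: nfun_ext (nfun_sum (IH _ _ h)) => w m x _ _ /=.
rewrite big_allpairs_dep /= -(big_mkord xpredT (fun a =>
  \sum_(z <- tups (size w) j) F w m (rcons x a ++ z))) /index_iota subn0.
by apply: eq_bigr => a _; apply: eq_bigr => z _; rewrite cat_rcons.
Qed.

Lemma bfun_all_tups j k P : bfun (k + j) P ->
  bfun k (fun w m x => all (fun z => P w m (x ++ z)) (tups (size w) j)).
Proof.
elim: j k P => [|j IH] k P h.
  rewrite addn0 in h; apply: bfun_ext h => w m x _ _.
  by rewrite /= cats0 andbT.
rewrite addnS -addSn in h; apply: bfun_ext (bfun_all_nat (IH _ _ h)) => w m x _ _ /=.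
elim: (iota _ _) => //= a s ->; rewrite all_cat all_map; congr (_ && _).
by apply: eq_all => z /=; rewrite cat_rcons.
Qed.

Lemma bfun_has_tups j k P : bfun (k + j) P ->
  bfun k (fun w m x => has (fun z => P w m (x ++ z)) (tups (size w) j)).
Proof.
move=> h; apply: bfun_ext (bfun_not (bfun_all_tups (bfun_not h))) => w m x _ _.
by rewrite -has_predC; apply: eq_has => a /=; rewrite negbK.
Qed.

Lemma scomp_for_tups j d (S : stmt) : scomp (d + j) S ->
  scomp d (fun w m r => foldl (fun m' z => S w m' (r ++ z)) m (tups (size w) j)).
Proof.
elim: j d S => [|j IH] d S h.
  rewrite addn0 in h; apply: scomp_ext h => w m r _ _.
  by rewrite /= cats0.
rewrite addnS -addSn in h; apply: scomp_ext (scomp_for (IH _ _ h)) => w m r _ _ /=.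
elim: (iota _ _) m => //= a s IHs m.
rewrite foldl_cat -IHs; congr (foldl _ _ _).
by elim: (tups _ _) m => //= z u IHu m; rewrite -IHu cat_rcons.
Qed.

(** The numeral in base [n] with digits [x] after a leading part [b], which selects a bank of the
    memory. *)
Definition addr (n b : nat) (x : seq nat) : nat := foldl (fun c a => c * n + a) b x.

Lemma addr_inj n b b' x x' : size x = size x' -> below n x -> below n x' ->
  addr n b x = addr n b' x' -> b = b' /\ x = x'.
Proof.
elim/last_ind: x x' => [|x a IH] x'; first by case: x'.
case/lastP: x' => [|x' a']; rewrite ?size_rcons // => -[sx].
rewrite !below_rcons => /andP[an xn] /andP[an' xn'].
rewrite /addr -!cats1 !foldl_cat /= => e.
have ea : a = a'.
  by have := congr1 (modn^~ n) e; rewrite !modnMDl !modn_small.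
have n0 : 0 < n by lia.
have := congr1 (divn^~ n) e; rewrite !divnMDl // !divn_small // !addn0.
by move=> /(IH _ sx xn xn') [-> ->]; rewrite ea.
Qed.

Lemma nfun_addr b k : nfun k (fun w m x => addr (size w) b x).
Proof.
suff h i : i <= k -> nfun k (fun w m x => addr (size w) b (take i x)).
  by apply: nfun_ext (h k (leqnn k)) => w m x sx _; rewrite -sx take_size.
elim: i => [|i IH] ik.
  by apply: nfun_ext (nfun_const k b) => w m x _ _; rewrite take0.
apply: nfun_ext (nfun_add (nfun_mulN (IH (ltnW ik))) (nfun_var ik)) => w m x sx _.
by rewrite (take_nth 0) ?sx // /addr -cats1 foldl_cat.
Qed.

Arguments nfun_addr b k : clear implicits.

Section Update.
Variables (k : nat) (Phi : bexp).

(* The new values go to a second bank of the memory first, so that all of them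
   are computed from the old ones. *)
Definition update (w : seq bool) (m : nat -> bool) : nat -> bool :=
  let n := size w in
  let m1 := foldl (fun m' z => upd m' (addr n 1 z) (Phi w m' z)) m (tups n k) in
  foldl (fun m' z => upd m' (addr n 0 z) (m' (addr n 1 z))) m1 (tups n k).

Hypothesis Phi_comp : bfun k Phi.

Lemma scomp_update d : scomp d (fun w m _ => update w m).
Proof.
have dk : below (d + k) (iota d k) by apply: below_iota.
have sk : size (iota d k) = k by rewrite size_iota.
pose pv := pick_vars (iota d k).
have h1 : scomp (d + k)
    (fun w m r => upd m (addr (size w) 1 (pv r)) (Phi w m (pv r))).
  by apply: scomp_asg; [apply: nfun_addr|apply: Phi_comp].
have h2 : scomp (d + k)
    (fun w m r => upd m (addr (size w) 0 (pv r)) (m (addr (size w) 1 (pv r)))).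
  apply: scomp_asg; first exact: nfun_addr.
  by have := bfun_mem (nfun_addr 1 k); apply.
apply: scomp_ext (scomp_seq (scomp_for_tups h1) (scomp_for_tups h2)).
move=> w m r sr _; rewrite /update.
have pvE z : z \in tups (size w) k -> pv (r ++ z) = z.
  rewrite mem_tups => /andP[/eqP sz _]; apply: (@eq_from_nth _ 0).
    by rewrite size_pick_vars sk sz.
  move=> i; rewrite size_pick_vars sk => ik; rewrite (nth_map 0) ?sk //.
  by rewrite nth_iota // nth_cat sr ltnNge leq_addr /= addKn.
have foldl_in (f g : (nat -> bool) -> seq nat -> nat -> bool) s m' :
    {in s, forall z m', f m' z = g m' z} -> foldl f m' s = foldl g m' s.
  elim: s m' => //= z s IH m' fg; rewrite fg ?mem_head // IH // => u us.
  by apply: fg; rewrite inE us orbT.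
rewrite (foldl_in _ (fun m' z => upd m' (addr (size w) 0 z) (m' (addr (size w) 1 z)))).
  by congr foldl; apply: foldl_in => z /pvE ->.
by move=> z /pvE ->.
Qed.

Hypothesis Phi_ext : forall w m m' z, z \in tups (size w) k ->
  (forall u, u \in tups (size w) k ->
     m (addr (size w) 0 u) = m' (addr (size w) 0 u)) ->
  Phi w m z = Phi w m' z.

(** The first pass writes to bank 1 only and [Phi] depends on bank 0 only, so the sequential writes
    do not disturb the values still to be computed. *)
Lemma updateE w m z : z \in tups (size w) k ->
  update w m (addr (size w) 0 z) = Phi w m z.
Proof.
set n := size w; rewrite /update -/n => hz; set m1 := foldl _ m _.
have inj b b' u u' : u \in tups n k -> u' \in tups n k ->
    (addr n b u == addr n b' u') = (b == b') && (u == u').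
  rewrite !mem_tups => /andP[/eqP su bu] /andP[/eqP su' bu'].
  apply/eqP/andP => [/addr_inj|[/eqP-> /eqP->] //].
  by rewrite su su' => /(_ erefl bu bu') [-> ->].
have bank0 s m' : {subset s <= tups n k} -> forall u, u \in tups n k ->
    foldl (fun m' z => upd m' (addr n 1 z) (Phi w m' z)) m' s (addr n 0 u) =
    m' (addr n 0 u).
  elim: s m' => //= v s IH m' hs u hu.
  have vk : v \in tups n k by apply: hs; rewrite mem_head.
  rewrite IH // => [|v' v's]; last by apply: hs; rewrite inE v's orbT.
  by rewrite /upd inj.
have bank1 s m' : {subset s <= tups n k} -> forall u, u \in tups n k ->
    (forall v, v \in tups n k -> m' (addr n 0 v) = m (addr n 0 v)) ->
    foldl (fun m' z => upd m' (addr n 1 z) (Phi w m' z)) m' s (addr n 1 u) =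
    if u \in s then Phi w m u else m' (addr n 1 u).
  elim: s m' => //= v s IH m' hs u hu hm.
  have vk : v \in tups n k by apply: hs; rewrite mem_head.
  have sk : {subset s <= tups n k} by move=> v' v's; apply: hs; rewrite inE v's orbT.
  rewrite IH // => [|v' v'k]; last by rewrite /upd inj //= hm.
  rewrite inE; case: (u \in s); rewrite ?orbT // orbF /upd inj //=.
  by case: eqP => // ->; apply: Phi_ext.
have copied s (m' : nat -> bool) : {subset s <= tups n k} -> forall u, u \in tups n k ->
    foldl (fun m' z => upd m' (addr n 0 z) (m' (addr n 1 z))) m' s (addr n 0 u) =
    if u \in s then m' (addr n 1 u) else m' (addr n 0 u).
  elim: s m' => //= v s IH m' hs u hu.
  have vk : v \in tups n k by apply: hs; rewrite mem_head.
  have sk : {subset s <= tups n k} by move=> v' v's; apply: hs; rewrite inE v's orbT.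
  rewrite IH // inE /upd !inj //=; case: (u \in s); rewrite ?orbT // orbF.
  by case: eqP => // ->.
by rewrite copied // hz /m1 bank1 // hz.
Qed.

End Update.

(** The power is the number of rounds of [e] nested loops whose variables the body ignores. *)
Lemma scomp_iter (f : seq bool -> (nat -> bool) -> nat -> bool) e :
  (forall d, scomp d (fun w m _ => f w m)) ->
  forall d, scomp d (fun w m _ => iter (size w ^ e) (f w) m).
Proof.
move=> hf; elim: e => [|e IH] d; first exact: hf.
apply: scomp_ext (scomp_for (IH d.+1)) => w m r _ _.
rewrite expnS; elim: {2 3}(size w) => // n IHn.
by rewrite -addn1 iotaD foldl_cat /= IHn addn1 mulSn iterD.
Qed.

(** * Soundness: colours are preserved by every solution *)

Import Order.TTheory GRing.Theory Num.Theory.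

(** * Tuples, their halves and their images under coordinate maps *)

Section Tuples.

Definition tsub (T : Type) (k l : nat) (x : k.-tuple T) (f : 'I_l -> 'I_k) :
    l.-tuple T := [tuple tnth x (f i) | i < l].

Definition tcat (T : Type) (k l : nat) (x : k.-tuple T) (y : l.-tuple T) :
    (k + l).-tuple T := [tuple of x ++ y].

Definition lhalf (T : Type) (t : nat) (x : (t + t).-tuple T) : t.-tuple T :=
  tsub x (lshift t).

Definition rhalf (T : Type) (t : nat) (x : (t + t).-tuple T) : t.-tuple T :=
  tsub x (@rshift t t).

Lemma tnth_tsub (T : Type) (k l : nat) (x : k.-tuple T) (f : 'I_l -> 'I_k) i :
  tnth (tsub x f) i = tnth x (f i).
Proof. by rewrite tnth_mktuple. Qed.

Lemma eq_tsub (T : Type) (k l : nat) (x : k.-tuple T) (f g : 'I_l -> 'I_k) :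
  f =1 g -> tsub x f = tsub x g.
Proof. by move=> fg; apply: eq_from_tnth => i; rewrite !tnth_tsub fg. Qed.

Lemma tnth_tcatl (T : Type) (k l : nat) (x : k.-tuple T) (y : l.-tuple T) i :
  tnth (tcat x y) (lshift l i) = tnth x i.
Proof. exact: tnth_lshift. Qed.

Lemma tnth_tcatr (T : Type) (k l : nat) (x : k.-tuple T) (y : l.-tuple T) i :
  tnth (tcat x y) (rshift k i) = tnth y i.
Proof. exact: tnth_rshift. Qed.

Lemma lhalf_tcat (T : Type) (t : nat) (x y : t.-tuple T) :
  lhalf (tcat x y) = x.
Proof. by apply: eq_from_tnth => i; rewrite tnth_tsub tnth_tcatl. Qed.

Lemma rhalf_tcat (T : Type) (t : nat) (x y : t.-tuple T) :
  rhalf (tcat x y) = y.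
Proof. by apply: eq_from_tnth => i; rewrite tnth_tsub tnth_tcatr. Qed.

Lemma tcat_half (T : Type) (t : nat) (x : (t + t).-tuple T) :
  tcat (lhalf x) (rhalf x) = x.
Proof.
apply: eq_from_tnth => i; rewrite -(splitK i); case: (split i) => j /=.
  by rewrite tnth_tcatl tnth_tsub.
by rewrite tnth_tcatr tnth_tsub.
Qed.

Definition half_swap (t : nat) (i : 'I_(t + t)) : 'I_(t + t) :=
  unsplit (match split i with inl k => inr k | inr k => inl k end).

Lemma tsub_half_swap (T : Type) (t : nat) (x y : t.-tuple T) :
  tsub (tcat x y) (@half_swap t) = tcat y x.
Proof.
apply: eq_from_tnth => i; rewrite -(splitK i) tnth_tsub /half_swap unsplitK.
by case: (split i) => k /=; rewrite ?tnth_tcatl ?tnth_tcatr.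
Qed.

Lemma big_tcat (R : Type) (idx : R) (op : Monoid.com_law idx) (T : finType)
    (t : nat) (F : (t + t).-tuple T -> R) :
  \big[op/idx]_(x : (t + t).-tuple T) F x =
  \big[op/idx]_(y : t.-tuple T) \big[op/idx]_(z : t.-tuple T) F (tcat y z).
Proof.
rewrite pair_big /=.
rewrite (reindex (fun p : t.-tuple T * t.-tuple T => tcat p.1 p.2)) //=.
exists (fun x => (lhalf x, rhalf x)) => [[y z]|x] _ /=.
  by rewrite lhalf_tcat rhalf_tcat.
exact: tcat_half.
Qed.

Lemma big_tuple_cons (R : Type) (idx : R) (op : Monoid.com_law idx)
    (T : finType) (k : nat) (F : k.+1.-tuple T -> R) :
  \big[op/idx]_(x : k.+1.-tuple T) F x =
  \big[op/idx]_(a : T) \big[op/idx]_(y : k.-tuple T) F [tuple of a :: y].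
Proof.
rewrite pair_big /=.
rewrite (reindex (fun p : T * k.-tuple T => [tuple of p.1 :: p.2])) //=.
exists (fun x => (thead x, [tuple of behead x])) => [[a y]|x] _ /=.
  by rewrite theadE; congr (_, _); apply: val_inj.
by rewrite -tuple_eta.
Qed.

End Tuples.

(** * The refinement step and its acceptance condition *)

Definition atomeq (A B : sgraph) (k : nat) (x : k.-tuple A) (y : k.-tuple B) :
    bool :=
  [forall i, forall j,
     ((tnth x i == tnth x j) == (tnth y i == tnth y j)) &&
     (edge (tnth x i) (tnth x j) == edge (tnth y i) (tnth y j))].

Lemma atomeqP (A B : sgraph) (k : nat) (x : k.-tuple A) (y : k.-tuple B) :
  reflect (forall i j,
     (tnth x i == tnth x j) = (tnth y i == tnth y j) /\
     edge (tnth x i) (tnth x j) = edge (tnth y i) (tnth y j))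
    (atomeq x y).
Proof.
apply: (iffP forallP) => [h i j|h i].
  by have /forallP/(_ j)/andP[/eqP-> /eqP->] := h i.
by apply/forallP => j; have [-> ->] := h i j; rewrite !eqxx.
Qed.

Definition gr (G H : sgraph) (b : bool) : sgraph := if b then H else G.

Section Refinement.
Variables (G H : sgraph) (t : nat).

(* [E b x r]: the tuple [x] of [G] ([b = false]) or [H] ([b = true]) has the
   same colour as the tuple [r] of [G]. *)
Definition trel := forall b, (t + t).-tuple (gr G H b) -> (t + t).-tuple G -> bool.

(** If the tuples of a fixed colour are read as a 0/1 matrix indexed by pairs of [t]-tuples, this is
    the entry at the two halves of [x] of the product of the matrices of [r] and [s]. *)
Definition tcount (E : trel) b (x : (t + t).-tuple (gr G H b))
    (r s : (t + t).-tuple G) : nat :=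
  #|[set z : t.-tuple (gr G H b) |
      E b (tcat (lhalf x) z) r && E b (tcat z (rhalf x)) s]|.

Definition refine (E : trel) : trel := fun b x r =>
  [&& E b x r, atomeq x r,
      [forall f : {ffun 'I_(t + t) -> 'I_(t + t)}, E b (tsub x f) (tsub r f)] &
      [forall r', forall s', tcount E x r' s' == tcount E (b := false) r r' s']].

(** Colours are named by tuples of [G]; the last clause provides every tuple of [H] with such a
    name. *)
Definition accepting (E : trel) : bool :=
  [&& #|G| == #|H|,
      [forall r, #|[set x | E false x r]| == #|[set x | E true x r]|] &
      [forall w, exists r, E true w r]].

Definition trel0 : trel := fun _ _ _ => true.

End Refinement.

Definition pset (A B : finType) (k : nat) (x : k.-tuple A) (w : k.-tuple B) :
    {set A * B} := [set (tnth x i, tnth w i) | i : 'I_k].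

Section Pset.
Variables (A B : finType).

Lemma card_pset k (x : k.-tuple A) (w : k.-tuple B) : #|pset x w| <= k.
Proof. by rewrite (leq_trans (leq_imset_card _ _)) // card_ord. Qed.

Lemma pset_cat k l (x : k.-tuple A) (w : k.-tuple B) (x' : l.-tuple A)
    (w' : l.-tuple B) : pset (tcat x x') (tcat w w') = pset x w :|: pset x' w'.
Proof.
apply/setP => p; rewrite inE; apply/imsetP/orP.
  move=> [i _ ->]; rewrite -(splitK i); case: (split i) => j /=.
    by rewrite !tnth_tcatl; left; apply/imsetP; exists j.
  by rewrite !tnth_tcatr; right; apply/imsetP; exists j.
case=> /imsetP[j _ ->].
  by exists (lshift l j); rewrite // !tnth_tcatl.
by exists (rshift k j); rewrite // !tnth_tcatr.
Qed.

Lemma pset_cons k a b (x : k.-tuple A) (w : k.-tuple B) :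
  pset [tuple of a :: x] [tuple of b :: w] = (a, b) |: pset x w.
Proof.
apply/setP => p; rewrite !inE; apply/imsetP/orP.
  move=> [i _ ->]; case: (unliftP ord0 i) => [j|] ->.
    by rewrite !tnthS; right; apply/imsetP; exists j.
  by rewrite !tnth0; left.
case=> [/eqP->|/imsetP[j _ ->]].
  by exists ord0; rewrite // !tnth0.
by exists (lift ord0 j); rewrite // !tnthS.
Qed.

Lemma pset_tsub k l (x : k.-tuple A) (w : k.-tuple B) (f : 'I_l -> 'I_k) :
  pset (tsub x f) (tsub w f) \subset pset x w.
Proof.
apply/subsetP => p /imsetP[i _ ->]; rewrite !tnth_tsub.
by apply/imsetP; exists (f i).
Qed.

End Pset.

Lemma partial_iso_pset (G H : sgraph) k (x : k.-tuple G) (w : k.-tuple H) :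
  partial_iso (pset x w) = atomeq x w.
Proof.
apply/idP/atomeqP => [/forall_inP h i j|h].
  have /h/forall_inP hi : (tnth x i, tnth w i) \in pset x w.
    by apply/imsetP; exists i.
  have /hi/andP[] : (tnth x j, tnth w j) \in pset x w.
    by apply/imsetP; exists j.
  by move=> /eqP-> /eqP->.
apply/forall_inP => _ /imsetP[i _ ->]; apply/forall_inP => _ /imsetP[j _ ->] /=.
by have [-> ->] := h i j; rewrite !eqxx.
Qed.

Local Open Scope ring_scope.

(** * Semidefinite kernels *)

Section Kernel.
Variables (R : realType) (P : finType) (k : P -> P -> R).
Hypothesis k_sym : forall p q, k p q = k q p.
Hypothesis k_psd : forall a : P -> R, 0 <= \sum_p \sum_q a p * a q * k p q.

(** Moving from [a] by [s] in the direction [q0] gives the form the value [2 * s * S + s ^+ 2 * c],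
    which is negative for small [s] of the sign opposite to [S] unless [S = 0]. *)
Lemma psd_kernel (a : P -> R) :
  \sum_p \sum_q a p * a q * k p q = 0 -> forall q, \sum_p a p * k p q = 0.
Proof.
move=> a0 q0; set S := \sum_p _; set c := k q0 q0.
have h s : 0 <= 2 * s * S + s ^+ 2 * c.
  have := k_psd (fun p => a p + s * (p == q0)%:R).
  congr (0 <= _).
  have -> : \sum_p \sum_q (a p + s * (p == q0)%:R) * (a q + s * (q == q0)%:R) * k p q
     = \sum_p \sum_q a p * a q * k p q
       + s * (\sum_p \sum_q a p * (q == q0)%:R * k p q)
       + s * (\sum_p \sum_q (p == q0)%:R * a q * k p q)
       + s ^+ 2 * (\sum_p \sum_q (p == q0)%:R * (q == q0)%:R * k p q).
    rewrite !mulr_sumr -!big_split; apply: eq_bigr => p _.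
    rewrite !mulr_sumr -!big_split; apply: eq_bigr => q _ /=; ring.
  have e1 : \sum_p \sum_q a p * (q == q0)%:R * k p q = S.
    apply: eq_bigr => p _; rewrite (bigD1 q0) //= eqxx mulr1 big1 ?addr0 // => q.
    by move=> /negPf->; rewrite mulr0 mul0r.
  have e2 : \sum_p \sum_q (p == q0)%:R * a q * k p q = S.
    rewrite (bigD1 q0) //= [X in _ + X]big1 ?addr0; last first.
      by move=> p /negPf->; rewrite big1 // => q _; rewrite !mul0r.
    by apply: eq_bigr => q _; rewrite eqxx mul1r k_sym.
  have e3 : \sum_p \sum_q (p == q0)%:R * (q == q0)%:R * k p q = c.
    rewrite (bigD1 q0) //= [X in _ + X]big1 ?addr0; last first.
      by move=> p /negPf->; rewrite big1 // => q _; rewrite !mul0r.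
    rewrite (bigD1 q0) //= [X in _ + X]big1 ?addr0; last first.
      by move=> q /negPf->; rewrite mulr0 mul0r.
    by rewrite eqxx !mul1r.
  rewrite a0 e1 e2 e3; ring.
have c0 : 0 <= c by have := h 1; have := h (-1); lra.
apply/eqP/negP => /negP S0.
have : 0 < S ^+ 2 by rewrite exprn_even_gt0.
(* The denominator [c + 1] is positive even for [c = 0], which spares a case distinction. *)
have := h (- S / (c + 1)).
have -> : 2 * (- S / (c + 1)) * S + (- S / (c + 1)) ^+ 2 * c =
  - (S ^+ 2 * ((c + 2) / (c + 1) ^+ 2)) by field; lra.
have c2 : 0 < (c + 2) / (c + 1) ^+ 2.
  by rewrite divr_gt0 ?exprn_gt0; lra.
by rewrite oppr_ge0 => /[swap] /mulr_gt0 /(_ c2); lra.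
Qed.

End Kernel.

(** * Consequences of the constraints of the relaxation *)

Section Solution.
Variables (R : realType) (t : nat) (G H : sgraph) (y : {set G * H} -> R).
Hypotheses (ht : (0 < t)%N) (sol : lasserre_solution t y).

(** The family [s] may repeat sets; the coefficients of equal sets are added up to a vector for the
    moment matrix. *)
Lemma las_kernel_psd (P : finType) (s : P -> {set G * H}) (a : P -> R) :
  (forall p, #|s p| <= t)%N ->
  0 <= \sum_p \sum_q a p * a q * y (s p :|: s q).
Proof.
move=> hs; have [_] := las_psd sol.
set S := [set I : {set G * H} | (#|I| <= t)%N].
move=> /(_ (\row_(i < #|S|) \sum_(p | s p == enum_val i) a p)).
congr (0 <= _); rewrite mxE.
have mem p : s p \in S by rewrite inE.
have inv (F : P -> R) :
    \sum_(i < #|S|) \sum_(p | s p == enum_val i) F p = \sum_p F p.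
  under eq_bigr do rewrite big_mkcond.
  rewrite exchange_big; apply: eq_bigr => p _.
  rewrite (bigD1 (enum_rank_in (mem p) (s p))) //= enum_rankK_in // eqxx.
  rewrite big1 ?addr0 // => i /eqP ne; case: eqP => // e; case: ne.
  by apply: enum_val_inj; rewrite enum_rankK_in.
transitivity (\sum_(i < #|S|) \sum_(j < #|S|)
   (\sum_(p | s p == enum_val i) a p) * (\sum_(q | s q == enum_val j) a q)
      * moment_matrix t y i j).
  rewrite exchange_big; apply: eq_bigr => j _; rewrite !mxE mulr_suml.
  by apply: eq_bigr => i _; rewrite !mxE mulrAC.
transitivity (\sum_(i < #|S|) \sum_(p | s p == enum_val i) \sum_(j < #|S|)
   \sum_(q | s q == enum_val j) a p * a q * y (s p :|: s q)).
  apply: eq_bigr => i _; rewrite exchange_big; apply: eq_bigr => j _.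
  rewrite mulr_suml mulr_suml; apply: eq_bigr => p /eqP->.
  by rewrite mulr_sumr mulr_suml; apply: eq_bigr => q /eqP->; rewrite mxE.
rewrite inv; apply: eq_bigr => p _; exact: inv.
Qed.

Lemma las_kernel (P : finType) (s : P -> {set G * H}) (a : P -> R) :
  (forall p, #|s p| <= t)%N ->
  \sum_p \sum_q a p * a q * y (s p :|: s q) = 0 ->
  forall q, \sum_p a p * y (s p :|: s q) = 0.
Proof.
move=> hs; apply: psd_kernel => [p q|b]; first by rewrite setUC.
exact: las_kernel_psd.
Qed.

Lemma big_option (T : finType) (F : option T -> R) :
  \sum_p F p = F None + \sum_x F (Some x).
Proof.
rewrite (bigD1 None) //= (reindex_omap Some id) => [|[]//].
by congr (_ + _); apply: eq_bigl => x; rewrite eqxx.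
Qed.

Lemma set_split (T : finType) (I : {set T}) (a b : nat) : (#|I| <= a + b)%N ->
  exists A B : {set T}, [/\ I = A :|: B, (#|A| <= a)%N & (#|B| <= b)%N].
Proof.
move=> hI; exists [set x in take a (enum I)], [set x in drop a (enum I)].
split.
- apply/setP => x; rewrite !inE -[LHS](mem_enum I) -{1}(cat_take_drop a (enum I)).
  by rewrite mem_cat.
- by rewrite cardsE (leq_trans (card_size _)) // size_take; case: ltnP => // ?; lia.
- by rewrite cardsE (leq_trans (card_size _)) // size_drop -cardE; lia.
Qed.

Lemma not_partial_iso_suml (I : {set G * H}) g h h' :
  h' != h -> (g, h) \in I -> (g, h') \in I -> ~~ partial_iso I.
Proof.
move=> hh' h1 h2; apply/negP => /forall_inP/(_ _ h1)/forall_inP/(_ _ h2).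
by rewrite /= eqxx (eq_sym h) (negPf hh').
Qed.

Lemma not_partial_iso_sumr (I : {set G * H}) g g' h :
  g' != g -> (g, h) \in I -> (g', h) \in I -> ~~ partial_iso I.
Proof.
move=> hh' h1 h2; apply/negP => /forall_inP/(_ _ h1)/forall_inP/(_ _ h2).
by rewrite /= eqxx (eq_sym g) (negPf hh').
Qed.

(* The difference of both sides is the product of a row of the moment matrix
   with a vector at which the quadratic form vanishes. *)
Lemma las_sum_ext (T : finType) (e : T -> G * H) (I : {set G * H}) :
  (forall (J : {set G * H}) h h', h' != h -> e h \in J -> e h' \in J ->
     ~~ partial_iso J) ->
  (forall J : {set G * H}, (#|J| <= 2 * t - 2)%N ->
     \sum_h y (J :|: [set e h]) = y J) ->
  (#|I| < 2 * t)%N -> \sum_h y (I :|: [set e h]) = y I.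
Proof.
move=> he hsum hI.
(* [A] indexes the row. The vector is the sum of the unit vectors at the sets [B :|: [set e h]]
   minus the one at [B]; the bound [t.-1] leaves room in [B] for one more pair. *)
have [A [B [-> hA hB]]] : exists A B : {set G * H},
    [/\ I = A :|: B, (#|A| <= t)%N & (#|B| <= t.-1)%N].
  by apply: set_split; lia.
(* The outer [None] stands for [A] with coefficient 0: it leaves the form unchanged and makes the
   row of [A] available to [las_kernel]. *)
pose s (p : option (option T)) := match p with
  | Some (Some h) => B :|: [set e h] | Some None => B | None => A end.
pose a (p : option (option T)) : R := match p with
  | Some (Some h) => 1 | Some None => -1 | None => 0 end.
have bigo (F : option (option T) -> R) :
    \sum_p F p = F None + (F (Some None) + \sum_h F (Some (Some h))).
  by rewrite 2!big_option.
have cs p : (#|s p| <= t)%N.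
  rewrite {}/s; case: p => [[h|]|] //=; last exact: leq_trans hB (leq_pred t).
  by rewrite setUC cardsU1 (leq_trans (leq_add (leq_b1 _) hB)) //; lia.
have B2 : (#|B| <= 2 * t - 2)%N by rewrite (leq_trans hB) //; lia.
have z0 : \sum_p \sum_q a p * a q * y (s p :|: s q) = 0.
  (* By [he], sets that contain both [e h] and [e h'] with [h' != h] are no partial isomorphisms, so
     only the diagonal survives. *)
  have inner h : \sum_h' y (s (Some (Some h)) :|: s (Some (Some h'))) =
      y (B :|: [set e h]).
    rewrite (bigD1 h) //= setUid big1 ?addr0 // => h' hh'.
    apply: (las_niso sol).
      by rewrite (leq_trans (leq_card_setU _ _)) //; have := cs (Some (Some h));
         have := cs (Some (Some h')); rewrite /=; lia.
    by apply: (he _ _ _ hh'); rewrite !inE eqxx !orbT.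
  rewrite bigo bigo !bigo /= !(mul0r, mulr0, add0r, mulrN1, opprK, mulr1, mul1r).
  rewrite big1 ?addr0 ?add0r => [|h _]; last by rewrite !(mul0r,mulr0).
  have -> : \sum_h -1 * y (B :|: (B :|: [set e h])) = - y B.
    rewrite -(hsum _ B2) -sumrN; apply: eq_bigr => h _.
    by rewrite setUA setUid mulN1r.
  transitivity (y B - y B - (y B - y B)); last by ring.
  rewrite -!addrA; congr (_ + (_ + _)); first by rewrite setUid.
  rewrite opprB; transitivity (\sum_h (- y (B :|: [set e h]) +  y (B :|: [set e h]))).
    apply: eq_bigr => h _; rewrite bigo /= !(mul0r, mulr0, add0r).
    rewrite !(mulrN1, mulr1, mul1r) -setUA (setUC _ B) setUA setUid mulN1r.
    congr (_ + _); rewrite -inner; apply: eq_bigr => h' _; rewrite !mul1r //.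
  rewrite big_split /= sumrN (hsum _ B2); ring.
have := las_kernel cs z0 None; rewrite bigo /= mul0r add0r mulN1r => /eqP.
rewrite addrC subr_eq0 (setUC B) => /eqP <-.
by apply: eq_bigr => h _; rewrite mul1r [in RHS]setUC setUA.
Qed.

Lemma las_suml_ext (I : {set G * H}) (g : G) : (#|I| < 2 * t)%N ->
  \sum_(h : H) y (I :|: [set (g, h)]) = y I.
Proof.
apply: las_sum_ext => [J h h'|J hJ]; first exact: not_partial_iso_suml.
exact: (las_suml sol).
Qed.

Lemma las_sumr_ext (I : {set G * H}) (h : H) : (#|I| < 2 * t)%N ->
  \sum_(g : G) y (I :|: [set (g, h)]) = y I.
Proof.
apply: (las_sum_ext (e := fun g => (g, h))) => [J g g'|J hJ].
  exact: not_partial_iso_sumr.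
exact: (las_sumr sol).
Qed.

(** The left side is one of the non-negative summands of [y I]. Here [I] may have [2 * t - 1]
    elements, which calls for the extended form of the sum constraint. *)
Lemma las_add_le (I : {set G * H}) p : (#|p |: I| <= 2 * t)%N ->
  y (p |: I) <= y I.
Proof.
have [pI|pI] := boolP (p \in I); first by rewrite (setUidPr _) // sub1set.
rewrite cardsU1 pI add1n => hI; rewrite -(las_suml_ext p.1 hI) (bigD1 p.2) //=.
rewrite -surjective_pairing setUC lerDl sumr_ge0 // => h _.
by apply: (las_ge0 sol); rewrite setUC cardsU1; case: (_ \notin _); lia.
Qed.

Lemma las_mono (I J : {set G * H}) : J \subset I -> (#|I| <= 2 * t)%N ->
  y I <= y J.
Proof.
move=> JI; have [n] := ubnP #|I :\: J|; elim: n => // n IH in I JI *.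
case: (set_0Vmem (I :\: J)) => [e0|[p /setDP[pI pJ]]] hn hI.
  by move/eqP: e0; rewrite setD_eq0 => IJ; rewrite (_ : I = J) //; apply/eqP; rewrite eqEsubset IJ.
have hp : p |: (I :\ p) = I by rewrite setD1K.
apply: le_trans (_ : y (I :\ p) <= _).
  by rewrite -{1}hp las_add_le // hp.
apply: IH; first by rewrite subsetD1 JI.
  rewrite (_ : _ :\: J = (I :\: J) :\ p); last by rewrite setDDl setUC -setDDl.
  by move: hn; rewrite (cardsD1 p (I :\: J)) !inE pI pJ.
by move: hI; rewrite (cardsD1 p I) pI; apply: leq_trans.
Qed.

Lemma las_marginall k (I : {set G * H}) (x : k.-tuple G) :
  (#|I| + k <= 2 * t)%N -> \sum_(w : k.-tuple H) y (I :|: pset x w) = y I.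
Proof.
elim: k I x => [|k IH] I x hI.
  rewrite (big_pred1 [tuple]) => [|w]; last by rewrite (tuple0 w) /= eqxx.
  congr (y _); apply/setUidPl/subsetP => p /imsetP[[]] //.
case/tupleP: x => g x; rewrite big_tuple_cons -(las_suml_ext g) //; last by lia.
apply: eq_bigr => h _; rewrite -(IH _ x); last first.
  by rewrite setUC cardsU1; case: (_ \notin _); lia.
by apply: eq_bigr => w _; rewrite pset_cons setUA.
Qed.

Lemma las_marginalr k (I : {set G * H}) (w : k.-tuple H) :
  (#|I| + k <= 2 * t)%N -> \sum_(x : k.-tuple G) y (I :|: pset x w) = y I.
Proof.
elim: k I w => [|k IH] I w hI.
  rewrite (big_pred1 [tuple]) => [|x]; last by rewrite (tuple0 x) /= eqxx.
  congr (y _); apply/setUidPl/subsetP => p /imsetP[[]] //.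
case/tupleP: w => h w; rewrite big_tuple_cons -(las_sumr_ext h) //; last by lia.
apply: eq_bigr => g _; rewrite -(IH _ w); last first.
  by rewrite setUC cardsU1; case: (_ \notin _); lia.
by apply: eq_bigr => x _; rewrite pset_cons setUA.
Qed.

End Solution.

(** What the counting argument uses of a solution, with [M x w x' w'] the value of [y] at the pairs
    of [(x, w)] and [(x', w')]. Both graphs play the same part, so a statement proved for one side
    transfers by [coupling_swap]. *)
Record coupling (R : realType) (X Z : finType) (M : X -> Z -> X -> Z -> R) :
    Prop := Coupling {
  coupling_sym : forall x w x' w', M x w x' w' = M x' w' x w;
  coupling_ge0 : forall x w x' w', 0 <= M x w x' w';
  coupling_psd : forall (P : finType) (s : P -> X * Z) (a : P -> R),
    0 <= \sum_p \sum_q a p * a q * M (s p).1 (s p).2 (s q).1 (s q).2;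
  coupling_funl : forall x w w', w != w' -> M x w x w' = 0;
  coupling_funr : forall x x' w, x != x' -> M x w x' w = 0;
  coupling_suml : forall x w z, \sum_v M x w z v = M x w x w;
  coupling_sumr : forall x w v, \sum_z M x w z v = M x w x w;
  coupling_unitl : forall z, \sum_v M z v z v = 1;
  coupling_unitr : forall v, \sum_z M z v z v = 1 }.

Lemma coupling_swap (R : realType) (X Z : finType) (M : X -> Z -> X -> Z -> R) :
  coupling M -> coupling (fun w x w' x' => M x w x' w').
Proof.
case=> c1 c2 c3 c4 c5 c6 c7 c8 c9; split=> //.
- by move=> P s a; exact: (c3 P (fun p => ((s p).2, (s p).1))).
- by move=> w x x'; apply: c5.
- by move=> w w' x; apply: c4.
Qed.

(** * Transfer of counts through a coupling *)

Section Coupling.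
Variable R : realType.

(* The quadratic form of the coupling vanishes at the difference of the
   indicator vectors of [{(x, w) | A x}] and [{(z, v) | B v}]. *)
Lemma coupling_exchange (X Z : finType) (M : X -> Z -> X -> Z -> R)
    (A : pred X) (B : pred Z) z w x' w' : coupling M ->
  (forall x v, M x w z v != 0 -> A x = B v) ->
  \sum_(x | A x) M x w x' w' = \sum_(v | B v) M z v x' w'.
Proof.
move=> cM AB.
pose s (p : option (X + Z)) := match p with
  | Some (inl x) => (x, w) | Some (inr v) => (z, v) | None => (x', w') end.
pose a (p : option (X + Z)) : R := match p with
  | Some (inl x) => (A x)%:R | Some (inr v) => - (B v)%:R | None => 0 end.
pose k p q := M (s p).1 (s p).2 (s q).1 (s q).2.
have bigo (F : option (X + Z) -> R) :
    \sum_p F p = F None + (\sum_x F (Some (inl x)) + \sum_v F (Some (inr v))).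
  by rewrite big_option big_sumType.
have ksym p q : k p q = k q p by apply: coupling_sym.
have kpsd b : 0 <= \sum_p \sum_q b p * b q * k p q by apply: coupling_psd.
suff z0 : \sum_p \sum_q a p * a q * k p q = 0.
  have := psd_kernel ksym kpsd z0 None; rewrite bigo mul0r add0r => /eqP.
  rewrite -[X in _ + X]opprK subr_eq0 => /eqP.
  rewrite -sumrN /k /= => h; rewrite [LHS]big_mkcond [RHS]big_mkcond.
  apply: etrans (etrans _ h) _; apply: eq_bigr => u _; rewrite /=.
    by case: ifP => _; rewrite ?mul1r ?mul0r.
  by case: ifP => _; rewrite mulNr opprK ?mul1r ?mul0r.
(* The cross term of the form. As [A x = B v] wherever [M x w z v] does not vanish, it agrees with
   both square terms, and all of them cancel. *)
pose c := \sum_x \sum_v (A x)%:R * (B v)%:R * M x w z v.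
have cA : c = \sum_x (A x)%:R * M x w x w.
  apply: eq_bigr => x _; rewrite -(coupling_suml cM x w z) mulr_sumr.
  apply: eq_bigr => v _; have [->|/AB ->] := eqVneq (M x w z v) 0.
    by rewrite !mulr0.
  by case: (B v); rewrite ?mul1r ?mul0r.
have cB : c = \sum_v (B v)%:R * M z v z v.
  rewrite /c exchange_big /=; apply: eq_bigr => v _.
  rewrite -(coupling_sumr cM z v w) mulr_sumr.
  apply: eq_bigr => x _; rewrite (coupling_sym cM z).
  have [->|/AB ->] := eqVneq (M x w z v) 0; first by rewrite !mulr0.
  by case: (B v); rewrite ?mul1r ?mul0r.
rewrite bigo big1 ?add0r => [|q _]; last by rewrite !mul0r.
transitivity ((c - c) + (- c + c)); last by ring.
congr (_ + _).
  rewrite {1}cA -sumrB; apply: eq_bigr => x _.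
  rewrite bigo mulr0 mul0r add0r /k /=; congr (_ + _).
    rewrite (bigD1 x) //= big1 ?addr0 => [|x1 xx1]; last first.
      by rewrite (coupling_funr cM) ?mulr0 // eq_sym.
    by case: (A x); rewrite ?mul1r ?mul0r.
  by rewrite -sumrN; apply: eq_bigr => v _; rewrite mulrN mulNr.
rewrite {1}/c cB [X in - X]exchange_big -sumrN -big_split /=; apply: eq_bigr => v _.
rewrite bigo mulr0 mul0r add0r /k /=; congr (_ + _).
  rewrite -sumrN; apply: eq_bigr => x _.
  by rewrite (coupling_sym cM z) mulNr mulNr (mulrC (B v)%:R).
rewrite (bigD1 v) //= big1 ?addr0 => [|v1 vv1]; last first.
  by rewrite (coupling_funl cM) ?mulr0 // eq_sym.
by case: (B v); rewrite ?mulrNN ?mulrN ?mulNr ?mul1r ?mul0r ?opprK ?oppr0 ?mul0r.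
Qed.

(** The sum is sorted by the middle element [z]. Two uses of [coupling_exchange] at [z] replace [x]
    by [v] and [x'] by [v']; entries with [v != v'] vanish, and the diagonal sums to 1 over [z]. *)
Lemma coupling_sum_count (X Z : finType) (M : X -> Z -> X -> Z -> R)
    (A A' : rel X) (B B' : rel Z) : coupling M ->
  (forall x w x' w', M x w x' w' != 0 -> A x x' = B w w') ->
  (forall x w x' w', M x w x' w' != 0 -> A' x x' = B' w w') ->
  forall w w',
  \sum_x \sum_x' M x w x' w' * #|[set z | A x z && A' z x']|%:R =
  #|[set v | B w v && B' v w']|%:R.
Proof.
move=> cM AB AB' w w'.
have natcard (T : finType) (p : pred T) : #|[set x | p x]|%:R = \sum_x (p x)%:R :> R.
  by rewrite cardsE -sum1_card natr_sum big_mkcond; apply: eq_bigr => x _; rewrite unfold_in; case: (p x).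
transitivity (\sum_z \sum_(x' | A' z x') \sum_(x | A x z) M x w x' w').
  under eq_bigr => x _ do under eq_bigr => x' _ do rewrite natcard mulr_sumr.
  rewrite exchange_big /=.
  under eq_bigr => x' _ do rewrite exchange_big /=.
  rewrite exchange_big /=; apply: eq_bigr => z _.
  rewrite [RHS]big_mkcond; apply: eq_bigr => x' _.
  case: (A' z x'); last by rewrite big1 // => x _; rewrite andbF mulr0.
  rewrite [RHS]big_mkcond; apply: eq_bigr => x _; rewrite andbT.
  by case: (A x z); rewrite ?mulr1 ?mulr0.
transitivity (\sum_z \sum_(v | B w v) \sum_(x' | A' z x') M x' w' z v).
  apply: eq_bigr => z _; rewrite [RHS]exchange_big /=; apply: eq_bigr => x' _.
  rewrite (coupling_exchange (B := B w) (z := z) _ _ cM) => [|x v /AB] //.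
  by apply: eq_bigr => v _; rewrite (coupling_sym cM).
transitivity (\sum_z \sum_(v | B w v) \sum_(v' | B' v' w') M z v' z v).
  apply: eq_bigr => z _; apply: eq_bigr => v _.
  apply: coupling_exchange => // x v'; rewrite (coupling_sym cM); exact: AB'.
transitivity (\sum_z \sum_(v | B w v && B' v w') M z v z v).
  apply: eq_bigr => z _; rewrite big_mkcondr; apply: eq_bigr => v _.
  rewrite big_mkcond (bigD1 v) //= big1 ?addr0 // => v' vv'.
  by case: ifP => // _; rewrite (coupling_funl cM).
rewrite exchange_big natcard big_mkcond /=; apply: eq_bigr => v _.
by case: ifP => // _; rewrite (coupling_unitr cM).
Qed.

(** [M] is doubly stochastic between the pairs [(x, x')] and [(w, w')], and averaging by [M] turns
    either count into the other. So both squares and the mixed term have the same total, the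
    weighted sum of [(F - F') ^+ 2] is 0, and the counts agree where [M] is positive. *)
Lemma coupling_count (X Z : finType) (M : X -> Z -> X -> Z -> R)
    (A A' : rel X) (B B' : rel Z) : coupling M ->
  (forall x w x' w', M x w x' w' != 0 -> A x x' = B w w') ->
  (forall x w x' w', M x w x' w' != 0 -> A' x x' = B' w w') ->
  forall x w x' w', M x w x' w' != 0 ->
  #|[set z | A x z && A' z x']| = #|[set v | B w v && B' v w']|.
Proof.
move=> cM AB AB'.
pose F x x' : R := #|[set z | A x z && A' z x']|%:R.
pose F' w w' : R := #|[set v | B w v && B' v w']|%:R.
have h w w' : \sum_x \sum_x' M x w x' w' * F x x' = F' w w'.
  exact: coupling_sum_count.
have h' x x' : \sum_w \sum_w' M x w x' w' * F' w w' = F x x'.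
  have := coupling_sum_count (M := fun w x w' x' => M x w x' w') (A := B)
    (A' := B') (B := A) (B' := A') (coupling_swap cM).
  by apply=> w1 x1 w2 x2 hM; apply/esym; [apply: AB hM|apply: AB' hM].
have one x x' : \sum_w \sum_w' M x w x' w' = 1.
  under eq_bigr do rewrite (coupling_suml cM).
  exact: coupling_unitl.
have one' w w' : \sum_x \sum_x' M x w x' w' = 1.
  under eq_bigr do rewrite (coupling_sumr cM).
  exact: coupling_unitr.
have perm (f : X -> Z -> X -> Z -> R) : \sum_x \sum_w \sum_x' \sum_w' f x w x' w'
   = \sum_x \sum_x' \sum_w \sum_w' f x w x' w'.
  by apply: eq_bigr => x _; rewrite exchange_big.
have perm' (f : X -> Z -> X -> Z -> R) : \sum_x \sum_w \sum_x' \sum_w' f x w x' w'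
   = \sum_w \sum_w' \sum_x \sum_x' f x w x' w'.
  rewrite exchange_big; apply: eq_bigr => w _.
  under eq_bigr do rewrite exchange_big.
  by rewrite exchange_big.
pose S := \sum_x \sum_w \sum_x' \sum_w' M x w x' w' * (F x x' - F' w w') ^+ 2.
have S0 : S = 0.
  have -> : S = \sum_x \sum_w \sum_x' \sum_w' M x w x' w' * F x x' ^+ 2
     - \sum_x \sum_w \sum_x' \sum_w' M x w x' w' * F x x' * F' w w'
     - \sum_x \sum_w \sum_x' \sum_w' M x w x' w' * F x x' * F' w w'
     + \sum_x \sum_w \sum_x' \sum_w' M x w x' w' * F' w w' ^+ 2.
    rewrite -!sumrB -big_split; apply: eq_bigr => x _ /=.
    rewrite -!sumrB -big_split; apply: eq_bigr => w _ /=.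
    rewrite -!sumrB -big_split; apply: eq_bigr => x' _ /=.
    rewrite -!sumrB -big_split; apply: eq_bigr => w' _ /=; ring.
  set T1 := \sum_x _; set T2 := \sum_x _; set T3 := \sum_x _.
  have e1 : T1 = T2.
    rewrite /T1 /T2 !perm; apply: eq_bigr => x _; apply: eq_bigr => x' _.
    transitivity (F x x' ^+ 2).
      rewrite -[RHS]mul1r -(one x x') mulr_suml; apply: eq_bigr => w _.
      by rewrite mulr_suml.
    rewrite expr2 -{2}(h' x x') mulr_sumr; apply: eq_bigr => w _.
    by rewrite mulr_sumr; apply: eq_bigr => w' _; rewrite mulrCA mulrA.
  have e2 : T3 = T2.
    rewrite /T3 /T2 !perm'; apply: eq_bigr => w _; apply: eq_bigr => w' _.
    transitivity (F' w w' ^+ 2).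
      rewrite -[RHS]mul1r -(one' w w') mulr_suml; apply: eq_bigr => x _.
      by rewrite mulr_suml.
    rewrite expr2 -{1}(h w w') mulr_suml; apply: eq_bigr => x _.
    by rewrite mulr_suml.
  by rewrite e1 e2; ring.
have pos x w x' w' : 0 <= M x w x' w' * (F x x' - F' w w') ^+ 2.
  by rewrite mulr_ge0 ?(coupling_ge0 cM) // sqr_ge0.
move=> x w x' w' Mx; apply/eqP; rewrite -(eqr_nat R) -subr_eq0 -sqrf_eq0.
move/eqP: S0; rewrite psumr_eq0 => [/allP/(_ x (mem_index_enum _))|]; last first.
  by move=> ? _; do 3 (apply: sumr_ge0 => ? _).
rewrite /= psumr_eq0 => [/allP/(_ w (mem_index_enum _))|]; last first.
  by move=> ? _; do 2 (apply: sumr_ge0 => ? _).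
rewrite /= psumr_eq0 => [/allP/(_ x' (mem_index_enum _))|]; last first.
  by move=> ? _; apply: sumr_ge0 => ? _.
rewrite /= psumr_eq0 => [/allP/(_ w' (mem_index_enum _))|]; last first.
  by move=> ? _.
by rewrite /= mulf_eq0 (negPf Mx).
Qed.

End Coupling.

(** * Solutions respect the refinement *)

Section Soundness.
Variables (R : realType) (t : nat) (G H : sgraph) (y : {set G * H} -> R).
Hypotheses (ht : (0 < t)%N) (sol : lasserre_solution t y).

Local Notation Y x w := (y (pset x w)).

Let M (x : t.-tuple G) (w : t.-tuple H) (x' : t.-tuple G) (w' : t.-tuple H) : R :=
  Y (tcat x x') (tcat w w').

Lemma card_pset2t (x : (t + t).-tuple G) (w : (t + t).-tuple H) :
  (#|pset x w| <= 2 * t)%N.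
Proof. by rewrite (leq_trans (card_pset _ _)) // addnn mul2n. Qed.

Lemma las_niso_pset (x : (t + t).-tuple G) (w : (t + t).-tuple H) :
  ~~ atomeq x w -> Y x w = 0.
Proof.
by rewrite -partial_iso_pset; apply: (las_niso sol); apply: card_pset2t.
Qed.

Lemma las_coupling : coupling M.
Proof.
have d x w : M x w x w = Y x w by rewrite /M pset_cat setUid.
split.
- by move=> x w x' w'; rewrite /M !pset_cat setUC.
- by move=> x w x' w'; apply: (las_ge0 sol); apply: card_pset2t.
- move=> P s a; have := las_kernel_psd sol (s := fun p => pset (s p).1 (s p).2) a.
  move=> /(_ (fun p => card_pset _ _)); congr (0 <= _).
  by apply: eq_bigr => p _; apply: eq_bigr => q _; rewrite /M pset_cat.
- move=> x w w' ww'; apply: las_niso_pset; apply: contraNN ww' => /atomeqP h.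
  apply/eqP/eq_from_tnth => i; have [+ _] := h (lshift t i) (rshift t i).
  by rewrite !tnth_tcatl !tnth_tcatr eqxx => /esym/eqP.
- move=> x x' w ww'; apply: las_niso_pset; apply: contraNN ww' => /atomeqP h.
  apply/eqP/eq_from_tnth => i; have [+ _] := h (lshift t i) (rshift t i).
  by rewrite !tnth_tcatl !tnth_tcatr eqxx => /eqP.
- move=> x w z; rewrite d -(las_marginall ht sol (k := t) z).
    by apply: eq_bigr => v _; rewrite /M pset_cat.
  by have := card_pset x w; lia.
- move=> x w z; rewrite d -(las_marginalr ht sol (k := t) z).
    by apply: eq_bigr => v _; rewrite /M pset_cat.
  by have := card_pset x w; lia.
- move=> z; rewrite -(las_unit sol) -(las_marginall ht sol (k := t) (I := set0) z).
    by apply: eq_bigr => v _; rewrite d set0U.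
  by rewrite cards0; lia.
- move=> z; rewrite -(las_unit sol) -(las_marginalr ht sol (k := t) (I := set0) z).
    by apply: eq_bigr => v _; rewrite d set0U.
  by rewrite cards0; lia.
Qed.

Definition respects (E : trel G H t) :=
  forall x w, Y x w != 0 -> forall r, E false x r = E true w r.

(** Taking images of tuples shrinks the set of pairs, so [y] stays positive by [las_mono]; the
    product counts are transferred by [coupling_count]. *)
Lemma refine_respects (E : trel G H t) : respects E -> respects (refine E).
Proof.
move=> hE x w hY r; rewrite /refine (hE x w hY).
have /atomeqP hat : atomeq x w.
  by apply: contraNT hY => /las_niso_pset ->.
have -> : atomeq x r = atomeq w r.
  apply/atomeqP/atomeqP => h i j; have [h1 h2] := h i j; have [h3 h4] := hat i j.
    by rewrite -h1 -h3 -h2 -h4.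
  by rewrite h3 h1 h4 h2.
have -> : [forall f : {ffun _ -> _}, E false (tsub x f) (tsub r f)] =
    [forall f : {ffun _ -> _}, E true (tsub w f) (tsub r f)].
  apply: eq_forallb => f; apply: hE; rewrite gt_eqF //.
  apply: lt_le_trans (las_mono ht sol (pset_tsub x w f) (card_pset2t x w)).
  by rewrite lt_neqAle eq_sym hY (las_ge0 sol) // card_pset2t.
suff -> : [forall r', forall s', tcount E (b := false) x r' s' == tcount E (b := false) r r' s'] =
   [forall r', forall s', tcount E (b := true) w r' s' == tcount E (b := false) r r' s'] by [].
apply: eq_forallb => r'; apply: eq_forallb => s'; congr (_ == _).
rewrite /tcount; apply: (coupling_count las_coupling
  (A := fun x z => E false (tcat x z) r')
  (B := fun x z => E true (tcat x z) r')
  (A' := fun x z => E false (tcat x z) s')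
  (B' := fun x z => E true (tcat x z) s') _ _ (x := lhalf x) (x' := rhalf x)
  (w := lhalf w) (w' := rhalf w)); rewrite /M ?tcat_half //.
  by move=> *; apply: hE.
by move=> *; apply: hE.
Qed.

Lemma iter_refine_respects n : respects (iter n (@refine G H t) (@trel0 G H t)).
Proof. by elim: n => [|n IH] //=; apply: refine_respects. Qed.

(** The sum of [y] over all singletons counts the vertices of either graph. *)
Lemma las_card_vertex : #|G| = #|H|.
Proof.
apply/eqP; rewrite -(eqr_nat R); apply/eqP.
have h0 : (#|set0 : {set G * H}| <= 2 * t - 2)%N by rewrite cards0.
transitivity (\sum_(g : G) \sum_(h : H) y (set0 :|: [set (g, h)])).
  under eq_bigr do rewrite (las_suml sol _ h0) (las_unit sol).
  by rewrite sumr_const cardE.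
rewrite exchange_big /=.
under eq_bigr do rewrite (las_sumr sol _ h0) (las_unit sol).
by rewrite sumr_const.
Qed.

(** [Y] is doubly stochastic between the tuples of both graphs and supported on pairs of equal
    colour, so the classes of a colour carry the same total weight on both sides. *)
Lemma las_accepting n : accepting (iter n (@refine G H t) (@trel0 G H t)).
Proof.
set E := iter _ _ _; have hE : respects E := @iter_refine_respects n.
have oner w : \sum_(x : (t + t).-tuple G) Y x w = 1.
  rewrite -(las_unit sol) -(las_marginalr ht sol (k := t + t) (I := set0) w).
    by apply: eq_bigr => v _; rewrite set0U.
  by rewrite cards0; lia.
have onel x : \sum_(w : (t + t).-tuple H) Y x w = 1.
  rewrite -(las_unit sol) -(las_marginall ht sol (k := t + t) (I := set0) x).
    by apply: eq_bigr => v _; rewrite set0U.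
  by rewrite cards0; lia.
apply/and3P; split; first by apply/eqP/las_card_vertex.
  apply/forallP => r; rewrite -(eqr_nat R); apply/eqP.
  rewrite !cardsE -!sum1_card !natr_sum.
  transitivity (\sum_(x | E false x r) \sum_w Y x w).
    by apply: eq_bigr => x _; rewrite onel.
  rewrite exchange_big /= [RHS]big_mkcond; apply: eq_bigr => w _.
  rewrite big_mkcond unfold_in; case: ifPn => hw.
    rewrite -[RHS](oner w); apply: eq_bigr => x _.
    by case: ifPn => // hx; apply/esym/eqP; apply: contraNT hx => /hE ->.
  rewrite big1 // => x _; case: ifPn => // hx.
  by apply/eqP; apply: contraNT hw => /hE/(_ r) h; apply: etrans (esym h) hx.
apply/forallP => w; apply/existsP.
have [x hx|no] := pickP [pred x : (t + t).-tuple G | Y x w != 0]; last first.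
  have := oner w; rewrite big1 => [/eqP|x _]; first by rewrite eq_sym oner_eq0.
  by have /negbFE/eqP := no x.
(* A partner of [w] in the support serves as its reference; what remains is reflexivity on [G]. *)
exists x; rewrite -(hE x w hx).
rewrite /E; elim: (n) x {hx} => //= m IH x; rewrite /refine IH /=.
apply/and3P; split.
- by apply/atomeqP.
- by apply/forallP => f.
- by apply/forallP => r'; apply/forallP => s'.
Qed.

End Soundness.

Local Close Scope ring_scope.

(** * Completeness: a solution from a stable colouring *)

(** Tuples of [H] are only ever compared with references in [G], so the laws of an equivalence
    relation take the forms of the first three clauses. *)
Record stable (G H : sgraph) (t : nat) (E : trel G H t) : Prop := Stable {
  stable_refl : forall r, E false r r;
  stable_trans : forall b x r r', E b x r -> E false r r' -> E b x r';
  stable_eucl : forall b x r r', E b x r -> E b x r' -> E false r r';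
  stable_atom : forall b x r, E b x r -> atomeq x r;
  stable_sub : forall b x r (f : 'I_(t + t) -> 'I_(t + t)),
    E b x r -> E b (tsub x f) (tsub r f);
  stable_count : forall b x r r' s', E b x r ->
    tcount E x r' s' = tcount E (b := false) r r' s' }.

(** * Class sizes of a stable colouring *)

Section Completeness.
Variables (G H : sgraph) (t : nat) (E : trel G H t).
Arguments E : clear implicits.
Hypotheses (ht : 0 < t) (sE : stable E) (aE : accepting E).

Let tG := (t + t).-tuple G.
Let tH := (t + t).-tuple H.

Definition csize (r : tG) : nat := #|[set z | E false z r]|.

Lemma stable_sym r r' : E false r r' -> E false r' r.
Proof. by move=> h; apply: (stable_eucl sE h); apply: stable_refl. Qed.

Lemma stableEr b x r r' : E false r r' -> E b x r = E b x r'.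
Proof.
move=> h; apply/idP/idP => h'; first exact: (stable_trans sE h').
by apply: (stable_trans sE h'); apply: stable_sym.
Qed.

Lemma stableEl b x r r' : E b x r -> E b x r' = E false r r'.
Proof.
move=> h; apply/idP/idP => h'; first exact: (stable_eucl sE h h').
exact: (stable_trans sE h h').
Qed.

Lemma csize_gt0 r : 0 < csize r.
Proof. by apply/card_gt0P; exists r; rewrite inE (stable_refl sE). Qed.

Lemma eq_csize r r' : E false r r' -> csize r = csize r'.
Proof.
by move=> h; apply: eq_card => z; rewrite !inE; apply: stableEr.
Qed.

Lemma csizeT r : csize r = #|[set w | E true w r]|.
Proof. by have /and3P[_ /forallP/(_ r)/eqP] := aE. Qed.

Lemma stable_rep (w : tH) : exists r, E true w r.
Proof. by have /and3P[_ _ /forallP/(_ w)/existsP] := aE. Qed.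

Lemma stable_tnth b x r i j :
  E b x r -> (tnth x i == tnth x j) = (tnth r i == tnth r j).
Proof. by move=> /(stable_atom sE)/atomeqP/(_ i j)[]. Qed.

(** Tuples of the colour of [x] have the same equalities among their coordinates. Thus [g] undoes
    [f] on the whole class, which is embedded into the class of the image. *)
Lemma csize_sub_le (x : tG) f g : tsub (tsub x f) g = x ->
  csize x <= csize (tsub x f).
Proof.
move=> xfg.
have inj : {in [set z | E false z x] &, injective (fun z : tG => tsub z f)}.
  suff h z : z \in [set z | E false z x] -> tsub (tsub z f) g = z.
    by move=> u v /h {2}<- /h {2}<- ->.
  rewrite inE => zx; apply: eq_from_tnth => i; rewrite !tnth_tsub; apply/eqP.
  by rewrite (stable_tnth _ _ zx) -{2}xfg !tnth_tsub.
rewrite /csize -(card_in_imset inj) subset_leq_card //.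
by apply/subsetP => _ /imsetP[z + ->]; rewrite !inE; apply: stable_sub.
Qed.

Lemma csize_sub (x : tG) f g : tsub (tsub x f) g = x ->
  csize (tsub x f) = csize x.
Proof.
move=> xfg; apply/eqP; rewrite eqn_leq (csize_sub_le xfg) andbT.
by rewrite -{2}xfg (@csize_sub_le _ g f) // xfg.
Qed.

Section Last.
Variables (l0 : 'I_t) (j : 'I_(t + t)).
Let l := rshift t l0.
Hypothesis jl : j != l.

(** It is applied to tuples whose coordinate [l] repeats coordinate [j]: then [l] is a spare place
    for one more vertex, and [fdup] restores the tuple. *)
Definition tupd (T : Type) (z : (t + t).-tuple T) (g : T) : (t + t).-tuple T :=
  [tuple if i == l then g else tnth z i | i < t + t].

Definition fdup (i : 'I_(t + t)) := if i == l then j else i.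

Lemma tsub_tupd (T : Type) (z : (t + t).-tuple T) g :
  tnth z l = tnth z j -> tsub (tupd z g) fdup = z.
Proof.
move=> zl; apply: eq_from_tnth => i; rewrite tnth_tsub tnth_mktuple /fdup.
by case: (eqVneq i l) => [->|/negPf->//]; rewrite (negPf jl).
Qed.

Lemma tupd_tsub (T : Type) (z : (t + t).-tuple T) :
  tupd (tsub z fdup) (tnth z l) = z.
Proof.
apply: eq_from_tnth => i; rewrite tnth_mktuple tnth_tsub /fdup.
by case: (eqVneq i l) => [->|].
Qed.

Lemma tnth_tsub_fdup (T : Type) (z : (t + t).-tuple T) :
  tnth (tsub z fdup) l = tnth (tsub z fdup) j.
Proof. by rewrite !tnth_tsub /fdup eqxx (negPf jl). Qed.

Lemma tnth_tupd (T : Type) (z : (t + t).-tuple T) g : tnth (tupd z g) l = g.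
Proof. by rewrite tnth_mktuple eqxx. Qed.

Definition nextend b (z : (t + t).-tuple (gr G H b)) (r : tG) : nat :=
  #|[set g | E b (tupd z g) r]|.

(** Sends [(x1, u)] to [(u, x2)], where [x2] is [u] with coordinate [l] reset to coordinate [j]; so
    the colour of the first pair fixes that of the second. *)
Definition fext (i : 'I_(t + t)) :=
  match split i with inl k => rshift t k | inr k => fdup (rshift t k) end.

(* The count of the composition with a pair of colours determines the number of
   extensions by one vertex: the colour of [(x1, z)] forces [z] to agree with
   [x2] except at [l]. *)
Lemma nextend_count b (z : (t + t).-tuple (gr G H b)) r :
  tnth z l = tnth z j -> nextend z r = tcount E z r (tsub r fext).
Proof.
move=> zl; rewrite /nextend /tcount.
have inj : injective (fun g => rhalf (tupd z g)).
  by move=> g g' /(congr1 (fun u => tnth u l0)); rewrite !tnth_tsub !tnth_tupd.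
rewrite -(card_imset _ inj); apply: eq_card => u; rewrite inE.
have cat g : tcat (lhalf z) (rhalf (tupd z g)) = tupd z g.
  rewrite -[RHS]tcat_half; congr tcat; apply: eq_from_tnth => i.
  by rewrite !tnth_tsub tnth_mktuple eq_lrshift.
apply/imsetP/andP => [[g]|[h1 h2]].
  rewrite inE => hg ->; rewrite cat; split=> //.
  rewrite (_ : tcat _ _ = tsub (tupd z g) fext); first exact: stable_sub.
  apply: eq_from_tnth => i; rewrite -(splitK i) tnth_tsub /fext unsplitK.
  case: (split i) => k /=; first by rewrite tnth_tcatl tnth_tsub.
  rewrite tnth_tcatr tnth_tsub tnth_mktuple /fdup.
  by case: (eqVneq (rshift t k) l) => [->|/negPf->//]; rewrite (negPf jl).
have uE : u = rhalf (tupd z (tnth u l0)).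
  apply: eq_from_tnth => k; rewrite tnth_tsub tnth_mktuple.
  have [/rshift_inj-> //|kl] := eqVneq (rshift t k) l.
  have := stable_tnth (lshift t k) (rshift t k) h2.
  rewrite !tnth_tsub /fext -[lshift t k]/(unsplit (inl k)) unsplitK.
  rewrite -[rshift t k]/(unsplit (inr k)) unsplitK /fdup /= (negPf kl) eqxx.
  by rewrite tnth_tcatl tnth_tcatr tnth_tsub => /eqP.
exists (tnth u l0) => //.
by rewrite inE -cat -uE.
Qed.

Lemma eq_nextend b (z : (t + t).-tuple (gr G H b)) (x r : tG) :
  tnth z l = tnth z j -> E b z x -> nextend z r = nextend (b := false) x r.
Proof.
move=> zl zx; rewrite !nextend_count //; first exact: stable_count.
by apply/eqP; rewrite -(stable_tnth _ _ zx) zl.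
Qed.

(** Resetting coordinate [l] maps the class of [r] onto that of [tsub r fdup], and by stability all
    fibres have the same size. *)
Lemma csize_extend (r : tG) :
  csize r = csize (tsub r fdup) * nextend (b := false) (tsub r fdup) r.
Proof.
pose h (z : tG) := (tsub z fdup, tnth z l).
have inj : injective h.
  move=> z z' e; have e1 : tsub z fdup = tsub z' fdup := congr1 fst e.
  have e2 : tnth z l = tnth z' l := congr1 snd e.
  by rewrite -(tupd_tsub z) e1 e2 tupd_tsub.
transitivity #|[set p : tG * G |
    E false p.1 (tsub r fdup) && E false (tupd p.1 p.2) r]|.
  rewrite /csize -(card_imset _ inj); apply: eq_card => -[u g]; rewrite inE /=.
  apply/imsetP/andP => [[z]|[h1 h2]].
    rewrite inE => zr e; have -> : u = tsub z fdup := congr1 fst e.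
    have -> : g = tnth z l := congr1 snd e.
    by rewrite tupd_tsub; split=> //; apply: (stable_sub sE).
  exists (tupd u g); rewrite ?inE // /h tnth_tupd tsub_tupd //.
  by apply/eqP; rewrite (stable_tnth _ _ h1) tnth_tsub_fdup.
rewrite -sum1_card.
rewrite (eq_bigl (fun p : tG * G => (p.1 \in [set u | E false u (tsub r fdup)])
   && (p.2 \in [set g | E false (tupd p.1 g) r]))); last first.
  by move=> p; rewrite !inE.
rewrite -(pair_big_dep (fun u => u \in [set u | E false u (tsub r fdup)])
  (fun u g => g \in [set g | E false (tupd u g) r]) (fun _ _ => 1)) /=.
rewrite -sum_nat_const; apply: eq_bigr => u; rewrite inE => hu.
rewrite sum1_card -(eq_nextend _ _ hu) //.
by apply/eqP; rewrite (stable_tnth _ _ hu) tnth_tsub_fdup.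
Qed.

Lemma nextend_gt0 (r : tG) : 0 < nextend (b := false) (tsub r fdup) r.
Proof.
by apply/card_gt0P; exists (tnth r l); rewrite inE tupd_tsub (stable_refl sE).
Qed.

End Last.
End Completeness.

Local Open Scope ring_scope.

(* [K] is invertible and commutes with [M], so [v M v^T = (u M) K (u M)^T] for
   [v = u K]. *)
Lemma psd_of_square (R : realType) (n : nat) (M K : 'M[R]_n) :
  M^T = M -> K^T = K -> M *m M = K *m M ->
  (forall v : 'rV_n, 0 <= (v *m K *m v^T) ord0 ord0) ->
  (forall v : 'rV_n, (v *m K *m v^T) ord0 ord0 = 0 -> v = 0) ->
  forall v : 'rV_n, 0 <= (v *m M *m v^T) ord0 ord0.
Proof.
move=> Mt Kt MM Kpsd K0 v.
have Ku : K \in unitmx.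
  rewrite -row_free_unit -kermx_eq0; apply/eqP/row_matrixP => i.
  rewrite row0; apply: K0; rewrite -row_mul mulmx_ker row0 mul0mx mxE //.
have MM' : M *m M = M *m K by have := congr1 trmx MM; rewrite !trmx_mul Mt Kt.
have [u ->] : exists u, v = u *m K by exists (v *m invmx K); rewrite mulmxKV.
have := Kpsd (u *m M); rewrite !trmx_mul Mt Kt.
suff -> : u *m M *m K *m (M *m u^T) = u *m K *m M *m (K *m u^T) by [].
by rewrite !mulmxA -(mulmxA u) -MM' -[in RHS](mulmxA u) -MM !mulmxA
  -[in LHS](mulmxA (u *m M)) MM' mulmxA.
Qed.

Lemma quad_enum (R : realType) (P : finType) (k : P -> P -> R) (v : 'rV[R]_#|P|) :
  (v *m (\matrix_(i, j) k (enum_val i) (enum_val j)) *m v^T) ord0 ord0 =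
  \sum_p \sum_q v ord0 (enum_rank p) * v ord0 (enum_rank q) * k p q.
Proof.
rewrite mxE exchange_big (reindex _ (onW_bij _ (@enum_val_bij P))) /=.
apply: eq_bigr => j _; rewrite !mxE mulr_suml.
rewrite (reindex _ (onW_bij _ (@enum_val_bij P))) /=.
by apply: eq_bigr => i _; rewrite !mxE !enum_valK mulrAC.
Qed.

Lemma psd_kernel_of_square (R : realType) (P : finType) (M K : P -> P -> R) :
  (forall p q, M p q = M q p) -> (forall p q, K p q = K q p) ->
  (forall p r, \sum_q M p q * M q r = \sum_q K p q * M q r) ->
  (forall v : P -> R, 0 <= \sum_p \sum_q v p * v q * K p q) ->
  (forall v : P -> R, \sum_p \sum_q v p * v q * K p q = 0 -> forall p, v p = 0) ->
  forall v : P -> R, 0 <= \sum_p \sum_q v p * v q * M p q.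
Proof.
move=> Ms Ks MM Kpsd K0 v.
pose mx (k : P -> P -> R) : 'M[R]_#|P| := \matrix_(i, j) k (enum_val i) (enum_val j).
have := psd_of_square (M := mx M) (K := mx K).
have mulE k k' i j : (mx k *m mx k') i j =
    \sum_q k (enum_val i) q * k' q (enum_val j).
  rewrite mxE [RHS](reindex _ (onW_bij _ (@enum_val_bij P))) /=.
  by apply: eq_bigr => l _; rewrite !mxE.
move=> /(_ _ _ _ _ _ (\row_i v (enum_val i))).
have -> : ((\row_i v (enum_val i)) *m mx M *m (\row_i v (enum_val i))^T) ord0 ord0
    = \sum_p \sum_q v p * v q * M p q.
  by rewrite quad_enum; do 2!(apply: eq_bigr => ? _); rewrite !mxE !enum_rankK.
apply.
- by apply/matrixP => i j; rewrite !mxE.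
- by apply/matrixP => i j; rewrite !mxE.
- by apply/matrixP => i j; rewrite !mulE.
- by move=> w; rewrite quad_enum; apply: (Kpsd (fun p => w ord0 (enum_rank p))).
move=> w; rewrite quad_enum => /(K0 (fun p => w ord0 (enum_rank p))) h.
by apply/rowP => i; rewrite mxE -(enum_valK i) h.
Qed.

(** * The weights of a stable colouring and their semidefiniteness *)

Section Completeness.
Variables (R : realType) (G H : sgraph) (t : nat) (E : trel G H t).
Arguments E : clear implicits.
Hypotheses (ht : (0 < t)%N) (sE : stable E) (aE : accepting E).

Let tG := (t + t).-tuple G.
Let tH := (t + t).-tuple H.

Let N (r : tG) : R := (csize E r)%:R.

Let N0 r : N r != 0. Proof. by rewrite pnatr_eq0 -lt0n (csize_gt0 sE). Qed.

Definition cweight (w : tH) (x : tG) : R :=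
  if E true w x then (csize E x)%:R^-1 else 0.

Let natsum (T : finType) (p : pred T) : \sum_x (p x)%:R = #|[set x | p x]|%:R :> R.
Proof.
rewrite cardsE -sum1_card natr_sum [RHS]big_mkcond; apply: eq_bigr => x _.
by rewrite unfold_in; case: (p x).
Qed.

(** By [csize_extend] the class of the extended tuple is larger than that of [x] by the factor
    [nextend], and this factor is also the number of nonzero summands, since [w] and [x] have
    equally many extensions. *)
Lemma sum_cweight w x (l0 : 'I_t) (j : 'I_(t + t)) : j != rshift t l0 ->
  tnth w (rshift t l0) = tnth w j -> tnth x (rshift t l0) = tnth x j ->
  forall g, \sum_h cweight (tupd l0 w h) (tupd l0 x g) = cweight w x.
Proof.
move=> jl wl xl g; rewrite {2}/cweight; case: ifPn => wx; last first.
  rewrite big1 // => h _; rewrite /cweight; case: ifPn => // wx'.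
  case/negP: wx; rewrite -(tsub_tupd jl g xl) -(tsub_tupd jl h wl).
  exact: (stable_sub sE).
transitivity (\sum_h (E true (tupd l0 w h) (tupd l0 x g))%:R / N (tupd l0 x g)).
  by apply: eq_bigr => h _; rewrite /cweight; case: ifP; rewrite ?mul0r ?mul1r.
rewrite -mulr_suml natsum -[#|_|]/(nextend E (b := true) l0 w (tupd l0 x g)).
rewrite (eq_nextend (b := true) sE jl _ wl wx) /N (csize_extend sE jl) natrM invfM.
have := nextend_gt0 sE l0 j (tupd l0 x g).
rewrite !(tsub_tupd jl g xl) => c0.
by rewrite mulrCA mulfV ?mulr1 // pnatr_eq0 -lt0n.
Qed.

Lemma sum_cweightr w x (l0 : 'I_t) (j : 'I_(t + t)) : j != rshift t l0 ->
  tnth w (rshift t l0) = tnth w j -> tnth x (rshift t l0) = tnth x j ->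
  forall h, \sum_g cweight (tupd l0 w h) (tupd l0 x g) = cweight w x.
Proof.
move=> jl wl xl h; rewrite {2}/cweight; case: ifPn => wx; last first.
  rewrite big1 // => g _; rewrite /cweight; case: ifPn => // wx'.
  case/negP: wx; rewrite -(tsub_tupd jl g xl) -(tsub_tupd jl h wl).
  exact: (stable_sub sE).
(* Now the extension of [w] is fixed and that of [x] varies; a reference [r] for the fixed one
   reduces the sum to a count inside [G]. *)
have [r hr] := stable_rep aE (tupd l0 w h).
have wr : E true w (tsub r (fdup l0 j)).
  by rewrite -(tsub_tupd jl h wl); apply: (stable_sub sE).
have xr := stable_eucl sE wx wr.
transitivity (\sum_g (E false (tupd l0 x g) r)%:R / N r).
  apply: eq_bigr => g _; rewrite /cweight (stableEl sE _ hr).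
  case: ifPn => [h1|/negPf h1].
    rewrite (stable_sym sE h1) mul1r /N.
    by rewrite (eq_csize sE (stable_sym sE h1)).
  rewrite (_ : E false _ r = false) ?mul0r //; apply: contraFF h1.
  exact: stable_sym.
rewrite -mulr_suml natsum -[#|_|]/(nextend E (b := false) l0 x r).
rewrite (eq_nextend (b := false) sE jl _ xl xr) /N (csize_extend sE jl) natrM invfM.
rewrite mulrCA mulfV ?mulr1 ?(eq_csize sE xr) //.
by rewrite pnatr_eq0 -lt0n (nextend_gt0 sE).
Qed.

Let cst (T : Type) (g : T) : (t + t).-tuple T := [tuple g | i < t + t].

Lemma stable_const b (x : (t + t).-tuple (gr G H b)) g :
  E b x (cst g) -> exists h, x = cst h.
Proof.
move=> xg; have tt : (0 < t + t)%N by rewrite addn_gt0 ht.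
exists (tnth x (Ordinal tt)); apply: eq_from_tnth => i; rewrite tnth_mktuple.
by apply/eqP; rewrite (stable_tnth sE _ _ xg) !tnth_mktuple.
Qed.

Lemma card_const b g :
  #|[set x | E b x (cst g)]| = #|[set h | E b (cst h) (cst g)]|.
Proof.
have tt : (0 < t + t)%N by rewrite addn_gt0 ht.
have inj T : injective (@cst T).
  by move=> h h' /(congr1 (fun x => tnth x (Ordinal tt))); rewrite !tnth_mktuple.
rewrite -[RHS](card_imset _ (@inj _)); apply: eq_card => x; rewrite inE.
apply/idP/imsetP => [xg|[h]]; last by rewrite inE => ? ->.
by have [h xh] := stable_const xg; exists h => //; rewrite inE -xh.
Qed.

(** Constant tuples enumerate the singletons, so this will be the sum constraint at the empty
    set. *)
Lemma sum_cweight_const g : \sum_h cweight (cst h) (cst g) = 1.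
Proof.
transitivity (\sum_h (E true (cst h) (cst g))%:R / N (cst g)).
  by apply: eq_bigr => h _; rewrite /cweight; case: ifP; rewrite ?mul0r ?mul1r.
by rewrite -mulr_suml natsum -(card_const true) -(csizeT aE) (mulfV (N0 _)).
Qed.

Lemma sum_cweight_constr h : \sum_g cweight (cst h) (cst g) = 1.
Proof.
have [r hr] := stable_rep aE (cst h).
have [g0 rg] : exists g0, r = cst g0.
  have tt : (0 < t + t)%N by rewrite addn_gt0 ht.
  exists (tnth r (Ordinal tt)); apply: eq_from_tnth => i; rewrite tnth_mktuple.
  by apply/eqP; rewrite -(stable_tnth sE _ _ hr) !tnth_mktuple.
transitivity (\sum_g (E false (cst g) r)%:R / N r).
  apply: eq_bigr => g _; rewrite /cweight (stableEl sE _ hr).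
  case: ifPn => [h1|/negPf h1].
    rewrite (stable_sym sE h1) mul1r /N.
    by rewrite (eq_csize sE (stable_sym sE h1)).
  rewrite (_ : E false _ r = false) ?mul0r //; apply: contraFF h1.
  exact: stable_sym.
by rewrite -mulr_suml natsum rg -(card_const false) (mulfV (N0 _)).
Qed.

Lemma cweight_sub w x f g :
  tsub (tsub w f) g = w -> tsub (tsub x f) g = x ->
  cweight (tsub w f) (tsub x f) = cweight w x.
Proof.
move=> wfg xfg; rewrite /cweight (csize_sub sE xfg).
rewrite (_ : E true (tsub w f) _ = E true w x) //.
by apply/idP/idP => [|]; [rewrite -{2}wfg -{2}xfg|]; apply: (stable_sub sE).
Qed.

Let X := t.-tuple G.
Let Z := t.-tuple H.

Let M (p q : X * Z) : R := cweight (tcat p.2 q.2) (tcat p.1 q.1).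

(** The factor in front of [M] when its square is computed in [MM]; on the coordinate of [H] it is
    completed to [K] by the identity. *)
Let K0 (x x' : X) : R :=
  \sum_(z : X) (E false (tcat x z) (tcat x' z))%:R / N (tcat x z).

Let K (p q : X * Z) : R := (p.2 == q.2)%:R * K0 p.1 q.1.

(** Vectors that exhibit [K0] as a Gram matrix: the nonzero products over [s] fill one colour class
    of size [N s], which cancels one of the two factors [1 / N s]. *)
Let phi (z : X) (s : tG) (x : X) : R := (E false (tcat x z) s)%:R / N s.

Let K0E x x' : K0 x x' = \sum_z \sum_s phi z s x * phi z s x'.
Proof.
apply: eq_bigr => z _.
case: (boolP (E false (tcat x z) (tcat x' z))) => h; last first.
  rewrite mul0r big1 // => s _; rewrite /phi.
  have [h1|] := boolP (E false (tcat x z) s); last by rewrite !mul0r.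
  have [h2|] := boolP (E false (tcat x' z) s); last by rewrite mul0r mulr0.
  by case/negP: h; apply: (stable_trans sE h1 (stable_sym sE h2)).
transitivity (\sum_s (E false (tcat x z) s)%:R / N (tcat x z) ^+ 2).
  rewrite -mulr_suml natsum (_ : #|_| = csize E (tcat x z)).
    by rewrite expr2 invfM mulrA (mulfV (N0 _)) mul1r.
  by apply: eq_card => s; rewrite !inE; apply/idP/idP; apply: stable_sym.
apply: eq_bigr => s _; rewrite /phi -(stableEl sE s h).
case: (boolP (E false _ s)) => h1; last by rewrite !mul0r.
by rewrite /N (eq_csize sE h1) !mul1r expr2 invfM.
Qed.

Let quadK (v : X * Z -> R) : \sum_p \sum_q v p * v q * K p q =
  \sum_w \sum_z \sum_s (\sum_x v (x, w) * phi z s x) ^+ 2.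
Proof.
transitivity (\sum_w \sum_x \sum_x' v (x, w) * v (x', w) * K0 x x').
  rewrite [RHS]exchange_big [RHS]pair_big /=; apply: eq_bigr => -[x w] _ /=.
  rewrite (eq_bigr (fun q : X * Z => v (x, w) * v (q.1, q.2) * K (x, w) (q.1, q.2))); last by move=> [].
  rewrite -(pair_bigA _ (fun x' w' => v (x, w) * v (x', w') * K (x, w) (x', w'))) /=.
  apply: eq_bigr => x' _; rewrite (bigD1 w) //= big1 ?addr0 => [|w' ww'].
    by rewrite /K /= eqxx mul1r.
  by rewrite /K /= eq_sym (negPf ww') mul0r mulr0.
apply: eq_bigr => w _.
transitivity (\sum_x \sum_x' \sum_z \sum_s
    (v (x, w) * phi z s x) * (v (x', w) * phi z s x')).
  apply: eq_bigr => x _; apply: eq_bigr => x' _; rewrite K0E mulr_sumr.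
  by apply: eq_bigr => z _; rewrite mulr_sumr; apply: eq_bigr => s _; ring.
under eq_bigr do rewrite exchange_big.
rewrite exchange_big; apply: eq_bigr => z _ /=.
under eq_bigr do rewrite exchange_big.
rewrite exchange_big; apply: eq_bigr => s _ /=.
rewrite expr2 mulr_suml; apply: eq_bigr => x _.
by rewrite mulr_sumr.
Qed.

(* Both sides count the triangles [(a, b, e)] with [(a, b)] of colour [c],
   [(b, e)] of the colour of [(x', x'')] and [(a, e)] of colour [r]. *)
Lemma triangle_count (c r : tG) (x' x'' : X) :
  (csize E r * tcount E (b := false) r c (tcat x' x'') =
   csize E (tcat x' x'') *
     #|[set a | E false (tcat a x') c && E false (tcat a x'') r]|)%N.
Proof.
set d := tcat x' x''.
pose f := @half_swap t; have tcatf := tsub_half_swap.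
have Ef (a b : X) (s : tG) : E false (tcat a b) s = E false (tcat b a) (tsub s f).
  have sff : tsub (tsub s f) f = s by rewrite -[s]tcat_half !tcatf.
  apply/idP/idP => /(stable_sub sE f); first by rewrite tcatf.
  by rewrite sff tcatf.
have cntE (p : pred tG) (q : tG -> nat) : (\sum_(x | p x) q x =
    \sum_(a : X) \sum_(e : X) p (tcat a e) * q (tcat a e))%N.
  rewrite -[RHS](big_tcat _ (fun x : tG => p x * q x)%N) big_mkcond.
  by apply: eq_bigr => x _; case: (p x); rewrite ?mul1n ?mul0n.
have cardE (p : pred X) : #|[set x | p x]| = (\sum_x p x)%N.
  rewrite cardsE -sum1_card big_mkcond; apply: eq_bigr => x _.
  by rewrite unfold_in; case: (p x).
transitivity (\sum_(a : X) \sum_(b : X) \sum_(e : X)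
   E false (tcat a e) r * (E false (tcat a b) c && E false (tcat b e) d))%N.
  transitivity (\sum_(x | E false x r) tcount E (b := false) x c d)%N.
    rewrite /csize -sum_nat_const; apply: eq_big => x; first by rewrite inE.
    by rewrite inE => xr; rewrite (stable_count sE _ _ xr).
  rewrite cntE; apply: eq_bigr => a _; rewrite exchange_big /=.
  apply: eq_bigr => e _; rewrite /tcount lhalf_tcat rhalf_tcat cardE.
  by rewrite big_distrr.
(* The triangles are regrouped by the edge [(b, e)] with [a] in the middle; [f] reverses [(a, b)] to
   fit the order of a composition. *)
transitivity (\sum_(x | E false x d) tcount E (b := false) x (tsub c f) r)%N.
  rewrite cntE exchange_big /=; apply: eq_bigr => b _; rewrite exchange_big /=.
  apply: eq_bigr => e _; rewrite /tcount lhalf_tcat rhalf_tcat cardE big_distrr /=.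
  apply: eq_bigr => a _; rewrite -Ef.
  by case: (E false _ r); case: (E false _ c); case: (E false _ d).
transitivity (csize E d * tcount E (b := false) d (tsub c f) r)%N.
  rewrite /csize -sum_nat_const; apply: eq_big => x; first by rewrite inE.
  by move=> xr; rewrite (stable_count sE _ _ xr).
congr (_ * _)%N; apply: eq_card => a; rewrite !inE lhalf_tcat rhalf_tcat.
by rewrite -Ef.
Qed.

(** Stability moves the count of middle tuples of [H] to the reference [r] of [(w, w'')]. Then
    [triangle_count] trades it for a count of tuples [a] of [G] in which [r] is an outer colour, and
    the sum over [a] is a product with [K]. *)
Let MM p r : \sum_q M p q * M q r = \sum_q K p q * M q r.
Proof.
case: p r => [x w] [x'' w''].
have [r hr] := stable_rep aE (tcat w w'').
transitivity (\sum_(x' : X) \sum_(a : X) (E false (tcat x x') (tcat a x'))%:R /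
    N (tcat x x') * ((E false (tcat a x'') r)%:R / N r)).
  rewrite (eq_bigr (fun q : X * Z => M (x, w) (q.1, q.2) * M (q.1, q.2) (x'', w''))); last by move=> [].
  rewrite -(pair_bigA _ (fun x' w' => M (x, w) (x', w') * M (x', w') (x'', w''))) /=.
  apply: eq_bigr => x' _.
  transitivity ((tcount E (b := true) (tcat w w'') (tcat x x') (tcat x' x''))%:R
      / (N (tcat x x') * N (tcat x' x''))).
    rewrite /tcount -natsum mulr_suml; apply: eq_bigr => w' _.
    rewrite /M /cweight /= lhalf_tcat rhalf_tcat.
    by do 2 case: (E true _ _); rewrite ?mul0r ?mulr0 // invfM mul1r.
  rewrite (stable_count sE _ _ hr).
  transitivity (#|[set a | E false (tcat a x') (tcat x x') && E false (tcat a x'') r]|%:R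
    / (N (tcat x x') * N r)).
    have /(congr1 (fun n => n%:R : R)) := triangle_count (tcat x x') r x' x''.
    rewrite !natrM -/(N r) -/(N (tcat x' x'')) => h.
    apply: (mulfI (N0 r)); rewrite mulrA h; field.
    by rewrite !N0.
  rewrite -natsum mulr_suml; apply: eq_bigr => a _.
  rewrite (_ : E false (tcat a x') _ = E false (tcat x x') (tcat a x')); last first.
    by apply/idP/idP; apply: stable_sym.
  by do 2 case: (E false _ _); rewrite ?mul0r ?mulr0 ?invfM ?mul1r.
rewrite exchange_big /=.
rewrite (eq_bigr (fun q : X * Z => K (x, w) (q.1, q.2) * M (q.1, q.2) (x'', w''))); last by move=> [].
rewrite -(pair_bigA _ (fun x' w' => K (x, w) (x', w') * M (x', w') (x'', w''))) /=.
apply: eq_bigr => a _; rewrite (bigD1 w) //= [X in _ + X]big1 ?addr0; last first.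
  by move=> w' ww'; rewrite /K /= (eq_sym w) (negPf ww') !mul0r.
rewrite (_ : K (x, w) (a, w) = (w == w)%:R * K0 x a) // eqxx mul1r -mulr_suml; congr (_ * _).
rewrite /M /cweight /= (stableEl sE _ hr).
case: (boolP (E false r _)) => h.
  by rewrite (stable_sym sE h) mul1r /N (eq_csize sE h).
rewrite (_ : E false _ r = false) ?mul0r //; apply: contraNF h.
exact: stable_sym.
Qed.

Lemma cweight_psd (v : X * Z -> R) :
  0 <= \sum_p \sum_q v p * v q * cweight (tcat p.2 q.2) (tcat p.1 q.1).
Proof.
have Ks p q : K p q = K q p.
  rewrite /K eq_sym !K0E; congr (_ * _).
  by do 2!(apply: eq_bigr => ? _); rewrite mulrC.
apply: (psd_kernel_of_square (M := M) (K := K)) => //.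
- move=> p q; rewrite /M -(tsub_half_swap p.2) -(tsub_half_swap p.1).
  by apply/esym/(cweight_sub (g := @half_swap t)); rewrite !tsub_half_swap.
- move=> u; rewrite quadK; do 3 (apply: sumr_ge0 => ? _); exact: sqr_ge0.
move=> u; rewrite quadK => /eqP.
rewrite psumr_eq0 => [/allP h [x w]|w _]; last first.
  by do 2 (apply: sumr_ge0 => ? _); exact: sqr_ge0.
have := h w (mem_index_enum _); rewrite /= psumr_eq0 => [/allP|z _]; last first.
  by apply: sumr_ge0 => ? _; exact: sqr_ge0.
move=> /(_ x (mem_index_enum _)); rewrite /= psumr_eq0 => [/allP|s _]; last first.
  exact: sqr_ge0.
(* The square at [z = x] and [s = (x, x)] isolates [u (x, w)]: only tuples with equal halves have
   the colour of [(x, x)]. *)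
move=> /(_ (tcat x x) (mem_index_enum _)); rewrite /= sqrf_eq0.
rewrite (bigD1 x) //= big1 ?addr0 => [|x' xx']; last first.
  rewrite /phi (_ : E false _ _ = false) ?mul0r ?mulr0 //.
  apply: contraNF xx' => h1; apply/eqP/eq_from_tnth => i; apply/eqP.
  have := stable_tnth sE (lshift t i) (rshift t i) h1.
  by rewrite !tnth_tcatl !tnth_tcatr eqxx.
by rewrite /phi (stable_refl sE) mul1r mulf_eq0 invr_eq0 (negPf (N0 _)) orbF => /eqP.
Qed.

End Completeness.

Lemma pset_inP (A B : finType) k (x : k.-tuple A) (w : k.-tuple B) a b :
  reflect (exists i, tnth x i = a /\ tnth w i = b) ((a, b) \in pset x w).
Proof.
by apply: (iffP imsetP) => [[i _ [-> ->]]|[i [<- <-]]]; exists i.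
Qed.

(* The enumeration repeats the first element of [I] after the last one. *)
Lemma pset_enum (A B : finType) (I : {set A * B}) (k : nat) :
  I != set0 -> (#|I| <= k)%N ->
  exists (x : k.-tuple A) (w : k.-tuple B), pset x w = I /\
    forall i j : 'I_k, i = 0%N :> nat -> (#|I| <= j)%N ->
      tnth x j = tnth x i /\ tnth w j = tnth w i.
Proof.
move=> /set0Pn[p0 p0I] hk; set s := enum I; pose q i := nth (head p0 s) s i.
have s0 : (0 < size s)%N by rewrite -cardE; apply/card_gt0P; exists p0.
exists [tuple (q i).1 | i < k], [tuple (q i).2 | i < k]; split.
  apply/setP => -[a b]; apply/pset_inP/idP => [[i]|abI].
    rewrite !tnth_mktuple => -[<- <-]; rewrite -surjective_pairing -mem_enum /q.
    by case: (ltnP i (size s)) => hi; [rewrite mem_nth|rewrite nth_default // -nth0 mem_nth].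
  have hi : (index (a, b) s < k)%N.
    by rewrite (leq_trans _ hk) // cardE index_mem mem_enum.
  by exists (Ordinal hi); rewrite !tnth_mktuple /q nth_index ?mem_enum.
move=> i j i0; rewrite cardE -/s => hj; rewrite !tnth_mktuple /q i0.
by rewrite (nth_default _ hj) nth0 //; case: (s) s0.
Qed.

Lemma pset_factor (A B : finType) k l (x : k.-tuple A) (w : k.-tuple B)
    (x' : l.-tuple A) (w' : l.-tuple B) : pset x' w' \subset pset x w ->
  exists f, x' = tsub x f /\ w' = tsub w f.
Proof.
move=> /subsetP sub.
have h i : exists j, (tnth x j == tnth x' i) && (tnth w j == tnth w' i).
  have /sub/pset_inP[j [<- <-]] : (tnth x' i, tnth w' i) \in pset x' w'.
    by apply/pset_inP; exists i.
  by exists j; rewrite !eqxx.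
exists (fun i => xchoose (h i)); split; apply: eq_from_tnth => i;
  by rewrite tnth_tsub; have /andP[/eqP e1 /eqP e2] := xchooseP (h i); rewrite ?e1 ?e2.
Qed.

(** * The solution as a function of sets of pairs *)

Section Solution.
Variables (R : realType) (G H : sgraph) (t : nat) (E : trel G H t).
Arguments E : clear implicits.
Hypotheses (ht : (0 < t)%N) (sE : stable E) (aE : accepting E).

(** A set is read through an arbitrary enumeration by [2t]-tuples, and [yvalE] shows that the choice
    is immaterial. The empty set has no enumeration because [0 < t]. *)
Definition yval (I : {set G * H}) : R :=
  if I == set0 then 1 else
  if [pick p : (t + t).-tuple G * (t + t).-tuple H | pset p.1 p.2 == I] is Some p
  then cweight R E p.2 p.1 else 0.

(** Two enumerations of one set are images of each other, and [cweight_sub] gives them equal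
    weight. *)
Lemma yvalE x w : yval (pset x w) = cweight R E w x.
Proof.
rewrite /yval ifN; last first.
  have tt : (0 < t + t)%N by rewrite addn_gt0 ht.
  by apply/set0Pn; exists (tnth x (Ordinal tt), tnth w (Ordinal tt));
     apply/pset_inP; exists (Ordinal tt).
case: pickP => [[x' w'] /eqP /= e|/(_ (x, w))]; last by rewrite /= eqxx.
have [f [xf wf]] : exists f, x' = tsub x f /\ w' = tsub w f.
  by apply: pset_factor; rewrite e.
have [g [xg wg]] : exists g, x = tsub x' g /\ w = tsub w' g.
  by apply: pset_factor; rewrite e.
by rewrite /= xf wf (cweight_sub R sE (g := g)) -?wf -?xf.
Qed.

Let t1t : (t.-1 < t)%N. Proof. by rewrite prednK. Qed.
Let tt0 : (0 < t + t)%N. Proof. by rewrite addn_gt0 ht. Qed.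

Let l0 : 'I_t := Ordinal t1t.
Let o0 : 'I_(t + t) := Ordinal tt0.

Let jl : o0 != rshift t l0.
Proof. by rewrite -val_eqE /=; lia. Qed.

Let pset_tupd (x : (t + t).-tuple G) (w : (t + t).-tuple H) g h :
  tnth x (rshift t l0) = tnth x o0 -> tnth w (rshift t l0) = tnth w o0 ->
  pset (tupd l0 x g) (tupd l0 w h) = pset x w :|: [set (g, h)].
Proof.
move=> xl wl; apply/setP => -[a b]; rewrite !inE; apply/pset_inP/orP.
  case=> i; rewrite !tnth_mktuple; case: eqP => [_ [-> ->]|_ [<- <-]].
    by right.
  by left; apply/pset_inP; exists i.
case=> [/pset_inP[i]|/eqP[-> ->]]; last first.
  by exists (rshift t l0); rewrite !tnth_mktuple eqxx.
have [->|il] := eqVneq i (rshift t l0).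
  by rewrite xl wl; exists o0; rewrite !tnth_mktuple (negPf jl).
by exists i; rewrite !tnth_mktuple (negPf il).
Qed.

Let pset1 g h :
  pset [tuple g | i < t + t] [tuple h | i < t + t] = [set (g, h)] :> {set G * H}.
Proof.
apply/setP => -[a b]; rewrite inE; apply/pset_inP/eqP => [[i]|[-> ->]].
  by rewrite !tnth_mktuple => -[-> ->].
by exists o0; rewrite !tnth_mktuple.
Qed.

Lemma yval_suml (I : {set G * H}) g : (#|I| < 2 * t)%N ->
  \sum_h yval (I :|: [set (g, h)]) = yval I.
Proof.
have [->|I0] := eqVneq I set0 => hI.
  rewrite {2}/yval eqxx -[RHS](sum_cweight_const R ht sE aE g).
  by apply: eq_bigr => h _; rewrite set0U -pset1 yvalE.
have hI' : (#|I| <= t + t)%N by lia.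
have [x [w [xwI hj]]] := pset_enum I0 hI'.
(* With fewer than [2 * t] pairs the last coordinate repeats the first and is free to take the new
   pair. *)
have [xl wl] : tnth x (rshift t l0) = tnth x o0 /\ tnth w (rshift t l0) = tnth w o0.
  by apply: hj => //=; rewrite -ltnS (leq_trans hI) //; lia.
rewrite -xwI yvalE -(sum_cweight R sE jl wl xl g).
by apply: eq_bigr => h _; rewrite -pset_tupd // yvalE.
Qed.

Lemma yval_sumr (I : {set G * H}) h : (#|I| < 2 * t)%N ->
  \sum_g yval (I :|: [set (g, h)]) = yval I.
Proof.
have [->|I0] := eqVneq I set0 => hI.
  rewrite {2}/yval eqxx -[RHS](sum_cweight_constr R ht sE aE h).
  by apply: eq_bigr => g _; rewrite set0U -pset1 yvalE.
have hI' : (#|I| <= t + t)%N by lia.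
have [x [w [xwI hj]]] := pset_enum I0 hI'.
have [xl wl] : tnth x (rshift t l0) = tnth x o0 /\ tnth w (rshift t l0) = tnth w o0.
  by apply: hj => //=; rewrite -ltnS (leq_trans hI) //; lia.
rewrite -xwI yvalE -(sum_cweightr R sE aE jl wl xl h).
by apply: eq_bigr => g _; rewrite -pset_tupd // yvalE.
Qed.

Lemma yval_psd : psd (moment_matrix t yval).
Proof.
split.
  by apply/matrixP => i j; rewrite !mxE setUC.
move=> v; set S := [set I : {set G * H} | (#|I| <= t)%N] in v *.
have card_i (i : 'I_#|S|) : (#|enum_val i| <= t)%N.
  by have := enum_valP i; rewrite inE.
have -> : (v *m moment_matrix t yval *m v^T) ord0 ord0 =
   \sum_i \sum_j v ord0 i * v ord0 j * yval (enum_val i :|: enum_val j).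
  rewrite mxE exchange_big; apply: eq_bigr => j _; rewrite !mxE mulr_suml.
  by apply: eq_bigr => i _; rewrite !mxE mulrAC.
(* If [G] has no vertices, every index set is empty and the form is a square. *)
have [g0 _|G0] := pickP (@predT G); last first.
  have e0 (I : {set G * H}) : yval I = 1.
    rewrite /yval ifT //; apply/eqP/setP => -[a b]; have := G0 a; by [].
  rewrite (_ : \sum_i _ = (\sum_i v ord0 i) ^+ 2) ?sqr_ge0 //.
  rewrite expr2 mulr_suml; apply: eq_bigr => i _; rewrite mulr_sumr.
  by apply: eq_bigr => j _; rewrite e0 mulr1.
pose X := t.-tuple G; pose Z := t.-tuple H.
(* Rows of the moment matrix as combinations of rows of the matrix of [cweight]: a nonempty set is a
   single row, while the empty set, which is no [pset], is the sum over [h] of the rows of the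
   singletons [(g0, h)]. *)
pose lam (I : {set G * H}) (p : X * Z) : R :=
  if I == set0 then \sum_h (p == ([tuple g0 | i < t], [tuple h | i < t]))%:R
  else (Some p == [pick p : X * Z | pset p.1 p.2 == I])%:R.
have lamE (I J : {set G * H}) : (#|I| <= t)%N -> (#|J| <= t)%N ->
    \sum_p lam J p * yval (I :|: pset p.1 p.2) = yval (I :|: J).
  move=> hI hJ; rewrite /lam; have [->|J0] := eqVneq J set0.
    under eq_bigr do rewrite mulr_suml.
    rewrite exchange_big /= setU0 -(@yval_suml I g0); last by lia.
    apply: eq_bigr => h _.
    rewrite (bigD1 ([tuple g0 | i < t], [tuple h | i < t])) //= eqxx mul1r.
    rewrite big1 ?addr0 => [|p /negPf->]; last by rewrite mul0r.
    congr (yval (_ :|: _)).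
    apply/setP => -[a b]; rewrite inE; apply/pset_inP/eqP => [[i]|[-> ->]].
      by rewrite !tnth_mktuple => -[-> ->].
    by exists l0; rewrite !tnth_mktuple.
  have [x [w [xwJ _]]] := pset_enum J0 hJ.
  case: pickP => [p /eqP pJ|/(_ (x, w))]; last by rewrite /= xwJ eqxx.
  rewrite (bigD1 p) //= eqxx mul1r pJ big1 ?addr0 // => q /negPf qp.
  by rewrite (_ : (Some q == Some p) = (q == p)) // qp mul0r.
pose c p := \sum_i v ord0 i * lam (enum_val i) p.
have := cweight_psd sE aE c; congr (0 <= _).
transitivity (\sum_(p : X * Z) \sum_(q : X * Z) \sum_i \sum_j
   v ord0 i * v ord0 j * (lam (enum_val i) p * (lam (enum_val j) q *
     yval (pset p.1 p.2 :|: pset q.1 q.2)))).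
  apply: eq_bigr => p _; apply: eq_bigr => q _.
  rewrite -pset_cat yvalE mulr_suml mulr_suml; apply: eq_bigr => i _.
  by rewrite mulr_sumr mulr_suml; apply: eq_bigr => j _; ring.
under eq_bigr do rewrite exchange_big /=.
rewrite exchange_big /=; apply: eq_bigr => i _.
under eq_bigr do rewrite exchange_big /=.
rewrite exchange_big /=; apply: eq_bigr => j _.
under eq_bigr do rewrite -mulr_sumr -mulr_sumr lamE ?card_pset //.
rewrite -mulr_sumr; congr (_ * _); rewrite setUC -lamE //.
by apply: eq_bigr => p _; rewrite setUC.
Qed.

Lemma lasserre_of_stable : lasserre_equiv R t G H.
Proof.
exists yval; split.
- exact: yval_psd.
- by move=> I g hI; apply: yval_suml; lia.
- by move=> I g hI; apply: yval_sumr; lia.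
- move=> I hI nI; have [I0|I0] := eqVneq I set0.
    by case/negP: nI; apply/forall_inP => p; rewrite I0 inE.
  have hI' : (#|I| <= t + t)%N by lia.
  have [x [w [xwI _]]] := pset_enum I0 hI'.
  rewrite -xwI yvalE /cweight; case: ifP => // /(stable_atom sE) /atomeqP h.
  case/negP: nI; rewrite -xwI partial_iso_pset; apply/atomeqP => i j.
  by have [-> ->] := h i j.
- by rewrite /yval eqxx.
- move=> I _; rewrite /yval; case: ifP => // _; case: pickP => // p _.
  by rewrite /cweight; case: ifP => // _; rewrite invr_ge0 ler0n.
Qed.

End Solution.

Local Close Scope ring_scope.

(** * Stabilisation of the iterated refinement *)

Section Iterate.
Variables (G H : sgraph) (t : nat).

Let E n := iter n (@refine G H t) (@trel0 G H t).
Arguments E : clear implicits.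

Lemma iter_refine_refl n r : E n false r r.
Proof.
elim: n r => //= n IH r; rewrite /refine IH /=; apply/and3P; split.
- exact/atomeqP.
- exact/forallP.
- by apply/forallP => r'; apply/forallP.
Qed.

Lemma iter_refine_trans n b x r r' : E n b x r -> E n false r r' -> E n b x r'.
Proof.
elim: n b x r r' => //= n IH b x r r'.
case/and4P=> h1 /atomeqP h2 /forallP h3 /forallP h4.
case/and4P=> k1 /atomeqP k2 /forallP k3 /forallP k4.
apply/and4P; split; first exact: IH k1.
- by apply/atomeqP => i j; have [-> ->] := h2 i j; apply: k2.
- by apply/forallP => f; apply: IH (k3 f).
- apply/forallP => r1; apply/forallP => s1.
  by rewrite (eqP (forallP (h4 r1) s1)) (eqP (forallP (k4 r1) s1)).
Qed.

Lemma iter_refine_eucl n b x r r' : E n b x r -> E n b x r' -> E n false r r'.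
Proof.
elim: n b x r r' => //= n IH b x r r'.
case/and4P=> h1 /atomeqP h2 /forallP h3 /forallP h4.
case/and4P=> k1 /atomeqP k2 /forallP k3 /forallP k4.
apply/and4P; split; first exact: IH k1.
- by apply/atomeqP => i j; have [<- <-] := h2 i j; apply: k2.
- by apply/forallP => f; apply: IH (k3 f).
- apply/forallP => r1; apply/forallP => s1.
  by rewrite -(eqP (forallP (h4 r1) s1)) (eqP (forallP (k4 r1) s1)).
Qed.

Lemma stable_fixpoint n : (forall b x r, E n b x r -> E n.+1 b x r) ->
  stable (E n).
Proof.
move=> fix_n; split.
- exact: iter_refine_refl.
- exact: iter_refine_trans.
- exact: iter_refine_eucl.
- by move=> b x r /fix_n /and4P[].
- move=> b x r f /fix_n /and4P[_ _ /forallP/(_ [ffun i => f i])].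
  have ef : [ffun i => f i] =1 f by move=> i; rewrite ffunE.
  by rewrite !(eq_tsub _ ef).
- by move=> b x r r' s' /fix_n /and4P[_ _ _ /forallP/(_ r')/forallP/(_ s')/eqP].
Qed.

(* The sets [E n] decrease and stay constant once two consecutive ones agree. *)
Lemma fixpoint_reached n :
  #|[set: (t + t).-tuple G + (t + t).-tuple H]| * #|[set: (t + t).-tuple G]| <= n ->
  forall b x r, E n b x r -> E n.+1 b x r.
Proof.
pose T := (((t + t).-tuple G + (t + t).-tuple H) * (t + t).-tuple G)%type.
pose S k := [set p : T | match p.1 with inl x => E k false x p.2
                                      | inr x => E k true x p.2 end].
have SE k k' : S k = S k' -> forall b x r, E k b x r = E k' b x r.
  move=> /setP h [] x r; first by have := h (inr x, r); rewrite !inE.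
  by have := h (inl x, r); rewrite !inE.
have sub k : S k.+1 \subset S k.
  by apply/subsetP => -[[x|x] r]; rewrite !inE /= => /and4P[].
have ES k k' : (forall b x r, E k b x r = E k' b x r) -> S k.+1 = S k'.+1.
  move=> h; apply/setP => -[x r]; rewrite !inE /=.
  have c b (u : (t + t).-tuple (gr G H b)) r' s' :
      tcount (E k) u r' s' = tcount (E k') u r' s'.
    by apply: eq_card => z; rewrite !inE !h.
  case: x => x; rewrite /refine h; congr [&& _, _, _ & _];
    (try by apply: eq_forallb => f; rewrite h);
    by apply: eq_forallb => r'; apply: eq_forallb => s'; rewrite !c.
have card k : (exists2 i, i < k & S i.+1 = S i) \/ #|S k| + k <= #|{: T}|.
  elim: k => [|k [[i ik Si]|IH]]; first by right; rewrite addn0 max_card.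
    by left; exists i => //; apply: ltnW.
  have [e|ne] := eqVneq (S k.+1) (S k); first by left; exists k.
  right; rewrite addnS -addSn (leq_trans _ IH) // leq_add2r.
  by apply: proper_card; rewrite properEneq ne sub.
rewrite !cardsT -card_prod => hn.
suff /SE h : S n.+1 = S n by move=> b x r; rewrite h.
have [[i ilt Si]|hc] := card n.+1; last by have := leq_trans (leq_trans (leq_addl _ _) hc) hn; rewrite ltnn.
have : forall m, S (m + i).+1 = S (m + i) by elim=> // m /SE /ES.
by move=> /(_ (n - i)); rewrite subnK.
Qed.

End Iterate.

(** The bound counts the pairs of a tuple of either graph and a reference. It is only needed when a
    solution is built from acceptance, which includes the equality of the orders. *)
Lemma lasserre_equivP (R : realType) (t : nat) (G H : sgraph) (n : nat) :
  0 < t -> (#|G| = #|H| -> #|G| ^ (t + t) * #|G| ^ (t + t) * 2 <= n) ->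
  lasserre_equiv R t G H <->
  accepting (iter n (@refine G H t) (@trel0 G H t)).
Proof.
move=> ht hn; split=> [[y sol]|acc]; first exact: (las_accepting ht sol).
have /and3P[/eqP GH _ _] := acc.
apply: (lasserre_of_stable R ht) acc; apply: stable_fixpoint.
apply: fixpoint_reached; rewrite !cardsT card_sum !card_tuple -GH.
by apply: leq_trans (hn GH); rewrite addnn -muln2 mulnAC.
Qed.

(** * The refinement as a program on the input word *)

Section Input.

(** The length of the run of ones that starts at [o], that is, the unary number stored there. *)
Definition lead (w : seq bool) (o : nat) : nat :=
  \sum_(q < size w) ((o <= q) &&
     all (fun p => ~~ (o <= p <= q) || nth false w p) (iota 0 (size w))).

Lemma nfun_lead k F : nfun k F -> nfun k (fun w m x => lead w (F w m x)).
Proof.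
move=> hF.
have h1 := nfun_lift hF; have h2 := nfun_lift h1.
have k2 : k < k.+2 by lia.
have := nfun_sum (nfun_of_bool (bfun_and (bfun_le h1 (nfun_var (ltnSn k)))
  (bfun_all_nat (bfun_or (bfun_not (bfun_and (bfun_le h2 (nfun_var (ltnSn k.+1)))
     (bfun_le (nfun_var (ltnSn k.+1)) (nfun_var k2)))) (bfun_bit (ltnSn k.+1)))))).
apply: nfun_ext => w m x sx _; apply: eq_bigr => q _ /=.
rewrite take_rcons // nth_rcons sx ltnn eqxx; congr (nat_of_bool (_ && _)).
apply: eq_all => p.
have s1 : size (rcons x q) = k.+1 by rewrite size_rcons sx.
by rewrite !(take_rcons _ s1) take_rcons // !nth_rcons s1 sx ltnn eqxx ltnSn ltnn eqxx.
Qed.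

Lemma sum_interval (M lo hi : nat) : lo <= hi ->
  \sum_(q < M) (lo <= q < hi : nat) = minn M hi - lo.
Proof.
move=> h; elim: M => [|M IH]; first by rewrite big_ord0 min0n.
rewrite big_ord_recr /= IH; case: leqP => h1; case: ltnP => h2 /=; lia.
Qed.

Lemma lead_spec u n v : lead (u ++ nseq n true ++ false :: v) (size u) = n.
Proof.
set w := u ++ _; rewrite /lead.
have sw : size w = size u + (n + (size v).+1) by rewrite !size_cat size_nseq.
have wt p : size u <= p < size u + n -> nth false w p.
  move=> /andP[h1 h2]; rewrite nth_cat ltnNge h1 /= nth_cat size_nseq nth_nseq.
  by have -> : p - size u < n by lia.
have wf : nth false w (size u + n) = false.
  by rewrite nth_cat ltnNge leq_addr /= addKn nth_cat size_nseq ltnn subnn.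
rewrite (eq_bigr (fun q : 'I_(size w) => (size u <= q < size u + n : nat))).
  rewrite sum_interval ?leq_addr // sw; lia.
move=> q _; case: (leqP (size u) q) => //= uq; congr nat_of_bool; apply/allP/idP => [h|qn p _].
  rewrite ltnNge; apply/negP => nq.
  have /h : size u + n \in iota 0 (size w) by rewrite mem_iota sw; lia.
  by rewrite wf leq_addr nq.
by case: (boolP (_ <= p <= q)) => //= hp; apply: wt; lia.
Qed.

Lemma leadE_le w o : lead w o <= size w.
Proof.
rewrite -[X in _ <= X]card_ord -sum1_card; apply: leq_sum => q _.
exact: leq_b1.
Qed.

(** A graph takes [n.+1 + n * n] bits, the matrix coming last. The same [n] serves for both graphs:
    inputs with different orders are rejected by [accept_vars] whatever the table contains. *)
Definition inedge (w : seq bool) (b i j : nat) : bool :=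
  let n := lead w 0 in
  nth false w (if b == 0 then n.+1 + (i * n + j)
               else n.+1 + n * n + n.+1 + (i * n + j)).

Definition nvert1 : nexp := fun w _ _ => lead w 0.
Definition nvert2 : nexp := fun w _ _ => lead w ((lead w 0).+1 + lead w 0 * lead w 0).

Lemma nfun_nvert1 k : nfun k nvert1.
Proof. exact: nfun_lead (nfun_const k 0). Qed.

Lemma nfun_sqvert k : nfun k (fun w _ _ => (lead w 0).+1 + lead w 0 * lead w 0).
Proof.
have := nfun_add (nfun_add (nfun_const k 1) (@nfun_nvert1 k))
  (nfun_mul (@nfun_nvert1 k) (@nfun_nvert1 k)).
apply: nfun_ext => w m x _ _; rewrite /nvert1 add1n.
by rewrite (minn_idPl (leadE_le _ _)).
Qed.

Lemma nfun_nvert2 k : nfun k nvert2.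
Proof. exact: nfun_lead (@nfun_sqvert k). Qed.

Lemma bfun_inedge k F0 F1 F2 : nfun k F0 -> nfun k F1 -> nfun k F2 ->
  (forall w m x, size x = k -> below (size w) x -> F1 w m x <= size w) ->
  bfun k (fun w m x => inedge w (F0 w m x) (F1 w m x) (F2 w m x)).
Proof.
move=> v0 v1 v2 F1w.
have pos : nfun k (fun w m x => F1 w m x * lead w 0 + F2 w m x).
  have := nfun_add (nfun_mul v1 (@nfun_nvert1 k)) v2.
  by apply: nfun_ext => w m x sx bx; rewrite (minn_idPl _) // F1w.
have off1 := nfun_add (nfun_const k 1) (@nfun_nvert1 k).
have off2 := nfun_add (@nfun_sqvert k) off1.
have := bfun_nth (nfun_if (bfun_eq v0 (nfun_const k 0)) (nfun_add off1 pos)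
  (nfun_add off2 pos)).
apply: bfun_ext => w m x _ _; rewrite /inedge /nvert1 !add1n.
by case: ifP.
Qed.

End Input.

Lemma bfun_below k : bfun k (fun w m x => below (lead w 0) x).
Proof.
have h i : i \in iota 0 k -> bfun k (fun w m x => nth 0 x i < lead w 0).
  rewrite mem_iota => /andP[_ ik].
  apply: bfun_ext (bfun_not (bfun_le (@nfun_nvert1 k) (nfun_var ik))) => w m x _ _.
  by rewrite -ltnNge.
apply: bfun_ext (bfun_all_in h) => w m x sx _.
by rewrite -[in RHS](@pick_vars_iota k x) // /pick_vars /below all_map.
Qed.

Lemma bfun_bad b k : bfun k (fun w m x => m (addr (size w) b x)).
Proof. exact: bfun_mem (nfun_addr b k). Qed.
Arguments bfun_bad b k : clear implicits.

Lemma pick_vars_cat s1 s2 r : pick_vars (s1 ++ s2) r = pick_vars s1 r ++ pick_vars s2 r.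
Proof. exact: map_cat. Qed.

Lemma pick_vars_block i n p u q : i = size p -> n = size u ->
  pick_vars (iota i n) (p ++ u ++ q) = u.
Proof.
move=> -> ->; apply: (@eq_from_nth _ 0); rewrite size_pick_vars size_iota // => j ju.
rewrite (nth_map 0) ?size_iota // nth_iota // nth_cat ltnNge leq_addr /= addKn.
by rewrite nth_cat ju.
Qed.

Lemma pick_vars_left n u q : n = size u -> pick_vars (iota 0 n) (u ++ q) = u.
Proof. by move=> nu; apply: (pick_vars_block (p := [::])). Qed.

Lemma pick_vars_right i n p u : i = size p -> n = size u ->
  pick_vars (iota i n) (p ++ u) = u.
Proof. by move=> ip nu; rewrite -[u in p ++ u]cats0 pick_vars_block. Qed.

(** * Refinement and acceptance on numbers *)

Section Algorithm.
Variable t : nat.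
Local Notation K := (t + t).

Definition atom_vars (w : seq bool) (a : seq nat) : bool :=
  all (fun ij : 'I_K * 'I_K =>
    ((nth 0 a (1 + ij.1) == nth 0 a (1 + ij.2)) ==
     (nth 0 a (1 + K + ij.1) == nth 0 a (1 + K + ij.2))) &&
    (inedge w (nth 0 a 0) (nth 0 a (1 + ij.1)) (nth 0 a (1 + ij.2)) ==
     inedge w 0 (nth 0 a (1 + K + ij.1)) (nth 0 a (1 + K + ij.2))))
  (enum {: 'I_K * 'I_K}).

Definition sub_vars (f : {ffun 'I_K -> 'I_K}) : seq nat :=
  0 :: [seq 1 + f i | i <- enum 'I_K] ++ [seq 1 + K + f i | i <- enum 'I_K].

(* Positions in the concatenation of [b], [x], [y], [r'], [s'] and [z]. *)
Definition vars_xz := 0 :: iota 1 t ++ iota (1 + 4 * K) t ++ iota (1 + 2 * K) K.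
Definition vars_zx := 0 :: iota (1 + 4 * K) t ++ iota (1 + t) t ++ iota (1 + 3 * K) K.
Definition vars_yz := iota (1 + K) t ++ iota (1 + 4 * K) t ++ iota (1 + 2 * K) K.
Definition vars_zy := iota (1 + 4 * K) t ++ iota (1 + K + t) t ++ iota (1 + 3 * K) K.

(** Loops run over all positions of the input, so [below] restricts [z] to numbers of vertices; a
    false bit stands for equal colours. *)
Definition count_vars (s1 s2 : seq nat) : nexp := fun w m a =>
  \sum_(z <- tups (size w) t)
    (below (lead w 0) (pick_vars (iota (1 + 4 * K) t) (a ++ z)) &&
     (~~ m (addr (size w) 0 (pick_vars s1 (a ++ z))) &&
      ~~ m (addr (size w) 0 (pick_vars s2 (a ++ z))))).

(** The negation is stored, because the blank memory then represents [trel0], in which all tuples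
    share one colour. *)
Definition refine_vars : bexp := fun w m a =>
  ~~ [&& ~~ m (addr (size w) 0 a), atom_vars w a,
    all (fun f => ~~ m (addr (size w) 0 (pick_vars (sub_vars f) a)))
      (enum {: {ffun 'I_K -> 'I_K}}) &
    all (fun r => all (fun s =>
      ~~ (below (lead w 0) (pick_vars (iota (1 + 2 * K) K) ((a ++ r) ++ s)) &&
          below (lead w 0) (pick_vars (iota (1 + 3 * K) K) ((a ++ r) ++ s))) ||
      (count_vars vars_xz vars_zx w m ((a ++ r) ++ s) ==
       count_vars vars_yz vars_zy w m ((a ++ r) ++ s)))
      (tups (size w) K)) (tups (size w) K)].

Lemma below_cat n s1 s2 : below n (s1 ++ s2) = below n s1 && below n s2.
Proof. exact: all_cat. Qed.

Lemma bfun_atom_vars : bfun (1 + 2 * K) (fun w _ a => atom_vars w a).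
Proof.
apply: bfun_all => -[i j] /=.
have vx (l : 'I_K) : nfun (1 + 2 * K) (fun _ _ a => nth 0 a (1 + l)).
  by apply: nfun_var; have := ltn_ord l; lia.
have vy (l : 'I_K) : nfun (1 + 2 * K) (fun _ _ a => nth 0 a (1 + K + l)).
  by apply: nfun_var; have := ltn_ord l; lia.
have vb : nfun (1 + 2 * K) (fun _ _ a => nth 0 a 0) by apply: nfun_var.
apply: bfun_and; first by apply: bfun_eqb; apply: bfun_eq.
apply: bfun_eqb; apply: bfun_inedge => //; try exact: nfun_const;
  by move=> w m x sx /allP bx; apply/ltnW/bx; rewrite mem_nth // sx;
     have := ltn_ord i; lia.
Qed.

Lemma nfun_count_vars s1 s2 : below (1 + 4 * K + t) s1 -> below (1 + 4 * K + t) s2 ->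
  nfun (1 + 4 * K) (count_vars s1 s2).
Proof.
move=> h1 h2.
have hb := bfun_sub (k := 1 + 4 * K + t) (@bfun_below t) (size_iota _ _)
  (below_iota (leqnn _)).
have e1 := bfun_sub (bfun_bad 0 _) (erefl (size s1)) h1.
have e2 := bfun_sub (bfun_bad 0 _) (erefl (size s2)) h2.
exact: (nfun_sum_tups (nfun_of_bool (bfun_and hb
  (bfun_and (bfun_not e1) (bfun_not e2))))).
Qed.

Lemma below_vars :
  [/\ below (1 + 4 * K + t) vars_xz, below (1 + 4 * K + t) vars_zx,
      below (1 + 4 * K + t) vars_yz & below (1 + 4 * K + t) vars_zy].
Proof.
have h0 : below (1 + 4 * K + t) [:: 0] by rewrite /below /=; lia.
split.
- by rewrite /vars_xz -cat1s !below_cat h0 !below_iota //; lia.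
- by rewrite /vars_zx -cat1s !below_cat h0 !below_iota //; lia.
- by rewrite /vars_yz !below_cat !below_iota //; lia.
- by rewrite /vars_zy !below_cat !below_iota //; lia.
Qed.

Lemma below_sub_vars f : below (1 + 2 * K) (sub_vars f).
Proof.
rewrite /sub_vars -cat1s !below_cat /below !all_map /=.
by apply/andP; split; apply/allP => i _ /=; have := ltn_ord (f i); lia.
Qed.

Lemma bfun_refine_vars : bfun (1 + 2 * K) refine_vars.
Proof.
apply: bfun_not; apply: bfun_and; first exact: bfun_not (bfun_bad 0 _).
apply: bfun_and; first exact: bfun_atom_vars.
apply: bfun_and.
  apply: bfun_all => f; apply: bfun_not.
  by apply: (bfun_sub (bfun_bad 0 _)) (below_sub_vars f).
have e4 : 1 + 4 * K = 1 + 2 * K + K + K by lia.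
have hcount : bfun (1 + 4 * K) (fun w m a =>
    count_vars vars_xz vars_zx w m a == count_vars vars_yz vars_zy w m a).
  have [h1 h2 h3 h4] := below_vars.
  by apply: bfun_eq; apply: nfun_count_vars.
have hbelow i : i <= 3 * K -> bfun (1 + 4 * K) (fun w m a =>
    below (lead w 0) (pick_vars (iota (1 + i) K) a)).
  move=> hi; apply: (bfun_sub (@bfun_below K)); rewrite ?size_iota //.
  by apply: below_iota; lia.
have hQ := bfun_or (bfun_not (bfun_and (hbelow (2 * K) _) (hbelow (3 * K) _))) hcount.
rewrite e4 in hQ; have := bfun_all_tups (bfun_all_tups (hQ _ _)).
by apply; lia.
Qed.

Lemma refine_vars_ext w m m' a : a \in tups (size w) (1 + 2 * K) ->
  (forall u, u \in tups (size w) (1 + 2 * K) ->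
     m (addr (size w) 0 u) = m' (addr (size w) 0 u)) ->
  refine_vars w m a = refine_vars w m' a.
Proof.
set N := size w => haN hm; have := haN; rewrite mem_tups => /andP[/eqP sa ba].
have key s A d : size A = d -> below N A -> size s = 1 + 2 * K -> below d s ->
    m (addr N 0 (pick_vars s A)) = m' (addr N 0 (pick_vars s A)).
  move=> sA bA ss bs; apply: hm; rewrite mem_tups size_pick_vars ss eqxx /=.
  exact: below_pick_vars sA bs bA.
have N0 : 0 < N by case: (a) sa ba => //= a0 l _ /andP[a0N _]; apply: leq_ltn_trans a0N.
(* [vars_yz] and [vars_zy] have no entry for the graph: the index of [G] is 0, and a leading digit 0
   does not change an address. *)
have key0 s A d : size A = d -> below N A -> size s = 2 * K -> below d s ->
    m (addr N 0 (pick_vars s A)) = m' (addr N 0 (pick_vars s A)).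
  move=> sA bA ss bs.
  have -> : addr N 0 (pick_vars s A) = addr N 0 (0 :: pick_vars s A).
    by rewrite /addr /= mul0n.
  apply: hm; rewrite mem_tups /= size_pick_vars ss eqxx /= N0.
  exact: below_pick_vars sA bs bA.
have [h1 h2 h3 h4] := below_vars.
rewrite /refine_vars -/N hm //; congr (~~ [&& _, _, _ & _]).
  apply: eq_all => f; rewrite (key _ _ _ sa ba) ?below_sub_vars //.
  by rewrite /= size_cat !size_map -!enumT !size_enum_ord; lia.
apply: eq_in_all => r; rewrite mem_tups => /andP[/eqP sr br].
apply: eq_in_all => s; rewrite mem_tups => /andP[/eqP ss bs].
have cnt s1 s2 : (forall z, z \in tups N t ->
      m (addr N 0 (pick_vars s1 (((a ++ r) ++ s) ++ z))) =
      m' (addr N 0 (pick_vars s1 (((a ++ r) ++ s) ++ z)))) ->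
    (forall z, z \in tups N t ->
      m (addr N 0 (pick_vars s2 (((a ++ r) ++ s) ++ z))) =
      m' (addr N 0 (pick_vars s2 (((a ++ r) ++ s) ++ z)))) ->
    count_vars s1 s2 w m ((a ++ r) ++ s) = count_vars s1 s2 w m' ((a ++ r) ++ s).
  move=> e1 e2; rewrite /count_vars !big_seq; apply: eq_bigr => z hz.
  by rewrite e1 ?e2.
have sA z : z \in tups N t -> size (((a ++ r) ++ s) ++ z) = 1 + 4 * K + t.
  by rewrite mem_tups => /andP[/eqP sz _]; rewrite !size_cat sa sr ss sz; lia.
have bA z : z \in tups N t -> below N (((a ++ r) ++ s) ++ z).
  by rewrite mem_tups => /andP[_ bz]; rewrite !below_cat ba br bs bz.
congr (_ || (_ == _)); apply: cnt => z hz.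
- by apply: (key _ _ _ (sA z hz) (bA z hz)) => //; rewrite /= !size_cat !size_iota; lia.
- by apply: (key _ _ _ (sA z hz) (bA z hz)) => //; rewrite /= !size_cat !size_iota; lia.
- by apply: (key0 _ _ _ (sA z hz) (bA z hz)) => //; rewrite /= !size_cat !size_iota; lia.
- by apply: (key0 _ _ _ (sA z hz) (bA z hz)) => //; rewrite /= !size_cat !size_iota; lia.
Qed.

(** Base 1 in [addr] has the effect of a leading digit 1, so it addresses the tuples of [H], and
    base 0 those of [G]. *)
Definition accept_vars (w : seq bool) (m : nat -> bool) : bool :=
  [&& lead w 0 == nvert2 w m [::],
    all (fun r => ~~ below (lead w 0) r ||
      (\sum_(x <- tups (size w) K) (below (lead w 0) x &&
          ~~ m (addr (size w) 0 (x ++ r))) ==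
       \sum_(x <- tups (size w) K) (below (lead w 0) x &&
          ~~ m (addr (size w) 1 (x ++ r))))) (tups (size w) K) &
    all (fun x => ~~ below (lead w 0) x ||
      has (fun r => below (lead w 0) r && ~~ m (addr (size w) 1 (x ++ r)))
        (tups (size w) K)) (tups (size w) K)].

Lemma bcomp_accept_vars : bcomp 0 (fun w m _ => accept_vars w m).
Proof.
(* The inner bound tuple [x] follows [r] among the variables but precedes it in the address. *)
pose swap := iota K K ++ iota 0 K.
have bl := @bfun_below K.
have bl1 := bfun_sub (k := K + K) bl (size_iota 0 K) (below_iota (leq_addr _ _)).
have bl2 := bfun_sub (k := K + K) bl (size_iota K K) (below_iota (leqnn _)).
have bad b := @bfun_bad b (K + K).
have swap_ok : below (K + K) swap by rewrite below_cat !below_iota // leq_addr.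
have sswap : size swap = K + K by rewrite size_cat !size_iota.
have swapE x r : size x = K -> size r = K -> pick_vars swap (r ++ x) = x ++ r.
  by move=> sx sr; rewrite pick_vars_cat pick_vars_right ?pick_vars_left.
have cnt b : nfun (0 + K) (fun w m r => \sum_(x <- tups (size w) K)
    (below (lead w 0) x && ~~ m (addr (size w) b (x ++ r)))).
  have := nfun_sum_tups (nfun_of_bool (bfun_and bl2
    (bfun_not (bfun_sub (bad b) sswap swap_ok)))).
  apply: nfun_ext => w m r sr _; rewrite !big_seq; apply: eq_bigr => x.
  by rewrite mem_tups => /andP[/eqP sx _]; rewrite swapE // pick_vars_right.
apply: bfun_bcomp; apply: bfun_and.
  by apply: bfun_eq; [apply: nfun_nvert1|apply: nfun_nvert2].
apply: bfun_and.
  have := bfun_all_tups (k := 0) (bfun_or (bfun_not bl) (bfun_eq (cnt 0) (cnt 1))).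
  by apply: bfun_ext => w m [].
have has1 : bfun (0 + K) (fun w m x => has (fun r => below (lead w 0) r &&
     ~~ m (addr (size w) 1 (x ++ r))) (tups (size w) K)).
  have := bfun_has_tups (k := K) (bfun_and bl2 (bfun_not (bad 1))).
  apply: bfun_ext => w m x sx _; apply: eq_in_has => r.
  by rewrite mem_tups => /andP[/eqP sr _]; rewrite pick_vars_right.
have := bfun_all_tups (k := 0) (bfun_or (bfun_not bl) has1).
by apply: bfun_ext => w m [].
Qed.

End Algorithm.

(** * Vertices and tuples as numbers *)

Definition code (A : finType) (s : seq A) : seq nat := [seq index v (enum A) | v <- s].

Section Code.
Variable A : finType.

Lemma size_code (s : seq A) : size (code s) = size s.
Proof. exact: size_map. Qed.

Lemma index_enum_lt (v : A) : index v (enum A) < #|A|.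
Proof. by rewrite cardE index_mem mem_enum. Qed.

Lemma index_enum_inj : injective (fun v : A => index v (enum A)).
Proof.
move=> u v e; rewrite -(nth_index u (mem_enum A u)) e nth_index ?mem_enum //.
Qed.

Lemma below_code (s : seq A) : below #|A| (code s).
Proof. by apply/allP => _ /mapP[v _ ->]; apply: index_enum_lt. Qed.

Lemma code_cat (s s' : seq A) : code (s ++ s') = code s ++ code s'.
Proof. exact: map_cat. Qed.

Lemma code_surj j (s : seq nat) : size s = j -> below #|A| s ->
  exists z : j.-tuple A, code z = s.
Proof.
elim: j s => [|j IH] [|a s] //=; first by exists [tuple].
move=> [sj] /andP[aA sA].
have [z <-] := IH s sj sA.
have v : A by apply: (enum_val (Ordinal aA)).
exists [tuple of nth v (enum A) a :: z] => /=; congr (_ :: _).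
by rewrite index_uniq ?enum_uniq // -cardE.
Qed.

Lemma code_inj j : injective (fun z : j.-tuple A => code z).
Proof. by move=> z z' /(inj_map index_enum_inj)/val_inj. Qed.

Lemma nth_code j (z : j.-tuple A) (i : 'I_j) : nth 0 (code z) i = index (tnth z i) (enum A).
Proof. by rewrite (nth_map (tnth z i)) ?size_tuple // -tnth_nth. Qed.

Lemma code_tsub j k (z : j.-tuple A) (f : 'I_k -> 'I_j) :
  code (tsub z f) = [seq index (tnth z (f i)) (enum A) | i <- enum 'I_k].
Proof. by rewrite /code /tsub /= -map_comp. Qed.

Variables (N j : nat).
Hypothesis AN : #|A| <= N.

Lemma mem_code (s : seq nat) : s \in tups N j -> below #|A| s ->
  exists z : j.-tuple A, code z = s.
Proof. by rewrite mem_tups => /andP[/eqP sj _] /(code_surj sj). Qed.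

Lemma code_tups (z : j.-tuple A) : code z \in tups N j.
Proof. by rewrite mem_tups size_code size_tuple eqxx (below_leq AN (below_code z)). Qed.

Lemma sum_code (P : seq nat -> bool) :
  \sum_(z <- tups N j) (below #|A| z && P z) = #|[set z : j.-tuple A | P (code z)]|.
Proof.
transitivity (size [seq z <- tups N j | below #|A| z && P z]).
  by rewrite size_filter -sum1_count [RHS]big_mkcond; apply: eq_bigr => z _; case: ifP.
rewrite cardE -(size_map (fun z : j.-tuple A => code z)).
apply/perm_size/uniq_perm.
- exact/filter_uniq/uniq_tups.
- by rewrite map_inj_uniq ?enum_uniq //; apply: code_inj.
move=> s; rewrite mem_filter; apply/andP/mapP => [[/andP[sA Ps] sN]|[z]].
  have [z zs] := mem_code sN sA; exists z => //.
  by rewrite mem_enum inE zs.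
rewrite mem_enum inE => Pz ->; rewrite below_code Pz; split=> //.
exact: code_tups.
Qed.

Lemma all_code (P : seq nat -> bool) :
  all (fun r => ~~ below #|A| r || P r) (tups N j) = [forall z : j.-tuple A, P (code z)].
Proof.
apply/allP/forallP => [h z|h s sN].
  by have := h _ (code_tups z); rewrite below_code.
case: (boolP (below _ s)) => //= sA.
by have [z <-] := mem_code sN sA; apply: h.
Qed.

Lemma has_code (P : seq nat -> bool) :
  has (fun r => below #|A| r && P r) (tups N j) = [exists z : j.-tuple A, P (code z)].
Proof.
apply/hasP/existsP => [[s sN /andP[sA Ps]]|[z Pz]].
  by have [z zs] := mem_code sN sA; exists z; rewrite zs.
by exists (code z); rewrite ?code_tups // below_code.
Qed.

End Code.

Lemma nth_allpairs (A B C : Type) (a0 : A) (b0 : B) (c0 : C) (f : A -> B -> C)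
    (s : seq A) (s' : seq B) i j : i < size s -> j < size s' ->
  nth c0 [seq f x y | x <- s, y <- s'] (i * size s' + j) = f (nth a0 s i) (nth b0 s' j).
Proof.
elim: s i => // x s IH [|i] /= hi hj; rewrite nth_cat size_map.
  by rewrite mul0n add0n hj (nth_map b0).
by rewrite mulSn -addnA ltnNge leq_addr /= addKn IH.
Qed.

Lemma pick_vars_cons i s r : pick_vars (i :: s) r = nth 0 r i :: pick_vars s r.
Proof. by []. Qed.

Lemma index_lt_sq k i j : i < k -> j < k -> i * k + j < k * k.
Proof. by move=> ik jk; nia. Qed.

Lemma size_encode_graph (A : sgraph) : size (encode_graph A) = #|A|.+1 + #|A| * #|A|.
Proof. by rewrite size_cat size_nseq /= size_allpairs -cardE; lia. Qed.

Lemma nth_encode_graph (A : sgraph) (u v : A) :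
  nth false (encode_graph A)
    (#|A|.+1 + (index u (enum A) * #|A| + index v (enum A))) = edge u v.
Proof.
rewrite nth_cat size_nseq ifF; last by lia.
rewrite (_ : _ - #|A| = (index u (enum A) * #|A| + index v (enum A)).+1); last by lia.
rewrite /= cardE (nth_allpairs u v) ?index_mem ?mem_enum //.
by rewrite !nth_index ?mem_enum.
Qed.

(** * The program follows the refinement of an encoded pair of graphs *)

Section Link.
Variables (G H : sgraph) (t : nat).
Local Notation K := (t + t).
Hypothesis GH : #|G| = #|H|.

Let w := encode_pair (G, H).
Let N := size w.
Let n := #|G|.

Lemma size_encode : N = (n.+1 + n * n) + (n.+1 + n * n).
Proof. by rewrite /N size_cat !size_encode_graph -GH. Qed.

Lemma lead_encode : lead w 0 = n.
Proof. by rewrite /w /encode_pair /encode_graph -catA cat_cons; apply: (@lead_spec [::]). Qed.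

Let nA b : #|gr G H b| = n. Proof. by case: b; rewrite /= ?GH. Qed.

Let NA b : #|gr G H b| <= N. Proof. by rewrite nA size_encode; lia. Qed.

Lemma inedge_encode (b : bool) (u v : gr G H b) :
  inedge w b (index u (enum (gr G H b))) (index v (enum (gr G H b))) = edge u v.
Proof.
rewrite /inedge lead_encode; case: b u v => /= u v; last first.
  rewrite nth_cat size_encode_graph ifT ?nth_encode_graph //.
  by rewrite ltn_add2l index_lt_sq // index_enum_lt.
rewrite -addnA -/n nth_cat size_encode_graph ltnNge leq_addr /= addKn /n GH.
exact: nth_encode_graph.
Qed.

Definition represents (m : nat -> bool) (E : trel G H t) : Prop :=
  forall b (x : K.-tuple (gr G H b)) (y : K.-tuple G),
    m (addr N 0 ((b : nat) :: code x ++ code y)) = ~~ E b x y.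

Lemma addr0 u : addr N 0 (0 :: u) = addr N 0 u.
Proof. by rewrite /addr /= mul0n. Qed.

Lemma addr1 u : addr N 0 (1 :: u) = addr N 1 u.
Proof. by rewrite /addr /= mul0n. Qed.

Lemma represents_false m E (x y : K.-tuple G) : represents m E ->
  m (addr N 0 (code x ++ code y)) = ~~ E false x y.
Proof. by move=> hm; rewrite -addr0; apply: (hm false). Qed.

Lemma represents_true m E (x : K.-tuple H) (y : K.-tuple G) : represents m E ->
  m (addr N 1 (code x ++ code y)) = ~~ E true x y.
Proof. by move=> hm; rewrite -addr1; apply: (hm true). Qed.

Lemma atom_vars_code b (x : K.-tuple (gr G H b)) (y : K.-tuple G) :
  atom_vars t w ((b : nat) :: code x ++ code y) = atomeq x y.
Proof.
have ex (i : 'I_K) : nth 0 ((b : nat) :: code x ++ code y) (1 + i) =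
    index (tnth x i) (enum (gr G H b)).
  by rewrite add1n /= nth_cat size_code size_tuple ltn_ord nth_code.
have ey (i : 'I_K) : nth 0 ((b : nat) :: code x ++ code y) (1 + K + i) =
    index (tnth y i) (enum G).
  by rewrite -addnA add1n /= nth_cat size_code size_tuple ltnNge leq_addr /= addKn nth_code.
have e (i j : 'I_K) : (((nth 0 ((b : nat) :: code x ++ code y) (1 + i) ==
      nth 0 ((b : nat) :: code x ++ code y) (1 + j)) ==
     (nth 0 ((b : nat) :: code x ++ code y) (1 + K + i) ==
      nth 0 ((b : nat) :: code x ++ code y) (1 + K + j))) &&
    (inedge w b (nth 0 ((b : nat) :: code x ++ code y) (1 + i))
       (nth 0 ((b : nat) :: code x ++ code y) (1 + j)) ==
     inedge w 0 (nth 0 ((b : nat) :: code x ++ code y) (1 + K + i))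
       (nth 0 ((b : nat) :: code x ++ code y) (1 + K + j)))) =
   ((tnth x i == tnth x j) == (tnth y i == tnth y j)) &&
     (edge (tnth x i) (tnth x j) == edge (tnth y i) (tnth y j)) :> bool.
  rewrite !ex !ey inedge_encode (inedge_encode (b := false)).
  by rewrite !(inj_eq (@index_enum_inj _)).
apply/allP/forallP => [h i|h [i j] _].
  by apply/forallP => j; rewrite -e; apply: (h (i, j)); rewrite mem_enum.
by rewrite /= e; have /forallP := h i; apply.
Qed.

Lemma sub_vars_code b (x : K.-tuple (gr G H b)) (y : K.-tuple G) f :
  pick_vars (sub_vars f) ((b : nat) :: code x ++ code y) =
  (b : nat) :: code (tsub x f) ++ code (tsub y f).
Proof.
rewrite /sub_vars /pick_vars /= map_cat !code_tsub -!map_comp; congr (_ :: _ ++ _).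
  by apply: eq_map => i /=; rewrite nth_cat size_code size_tuple ltn_ord nth_code.
apply: eq_map => i /=.
by rewrite nth_cat size_code size_tuple ltnNge leq_addr /= addKn nth_code.
Qed.

Lemma code_half (A : finType) (x : K.-tuple A) :
  code x = code (lhalf x) ++ code (rhalf x).
Proof. by rewrite -{1}(tcat_half x) code_cat. Qed.

Lemma count_vars_code m E b (x : K.-tuple (gr G H b)) (y r s : K.-tuple G) :
  represents m E ->
  let a := ((((b : nat) :: code x ++ code y) ++ code r) ++ code s) in
  count_vars t (vars_xz t) (vars_zx t) w m a = tcount E x r s /\
  count_vars t (vars_yz t) (vars_zy t) w m a = tcount E (b := false) y r s.
Proof.
move=> hm a.
have sc (A : finType) k (z : k.-tuple A) : size (code z) = k.
  by rewrite size_code size_tuple.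
have aE : a = [:: (b : nat)] ++ code (lhalf x) ++ code (rhalf x) ++ code (lhalf y) ++
    code (rhalf y) ++ code r ++ code s.
  by rewrite /a (code_half x) (code_half y) /= -!catA.
have sa : size a = 1 + 4 * K.
  by rewrite aE /= !size_cat !sc ?card_ord; lia.
have P i k p u q z : a ++ z = p ++ u ++ q -> i = size p -> k = size u ->
    pick_vars (iota i k) (a ++ z) = u.
  by move=> ->; apply: pick_vars_block.
have pz z : size z = t -> pick_vars (iota (1 + 4 * K) t) (a ++ z) = z.
  by move=> sz; apply: pick_vars_right.
have pxl z : pick_vars (iota 1 t) (a ++ z) = code (lhalf x).
  apply: (P _ _ [:: (b : nat)]); [by rewrite aE -!catA|by []|].
  by rewrite sc ?card_ord.
have pxr z : pick_vars (iota (1 + t) t) (a ++ z) = code (rhalf x).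
  apply: (P _ _ ([:: (b : nat)] ++ code (lhalf x))); first by rewrite aE -!catA.
    by rewrite /= sc ?card_ord.
  by rewrite sc ?card_ord.
have pyl z : pick_vars (iota (1 + K) t) (a ++ z) = code (lhalf y).
  apply: (P _ _ ([:: (b : nat)] ++ code (lhalf x) ++ code (rhalf x))).
  - by rewrite aE -!catA.
  - by rewrite /= size_cat !sc ?card_ord.
  - by rewrite sc ?card_ord.
have pyr z : pick_vars (iota (1 + K + t) t) (a ++ z) = code (rhalf y).
  apply: (P _ _ ([:: (b : nat)] ++ code (lhalf x) ++ code (rhalf x) ++ code (lhalf y))).
  - by rewrite aE -!catA.
  - by rewrite /= !size_cat !sc ?card_ord; lia.
  - by rewrite sc ?card_ord.
have pr z : pick_vars (iota (1 + 2 * K) K) (a ++ z) = code r.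
  apply: (P _ _ ([:: (b : nat)] ++ code (lhalf x) ++ code (rhalf x) ++ code (lhalf y)
    ++ code (rhalf y))).
  - by rewrite aE -!catA.
  - by rewrite /= !size_cat !sc ?card_ord; lia.
  - by rewrite sc.
have ps z : pick_vars (iota (1 + 3 * K) K) (a ++ z) = code s.
  apply: (P _ _ ([:: (b : nat)] ++ code (lhalf x) ++ code (rhalf x) ++ code (lhalf y)
    ++ code (rhalf y) ++ code r)).
  - by rewrite aE -!catA.
  - by rewrite /= !size_cat !sc ?card_ord; lia.
  - by rewrite sc.
have p0 z : nth 0 (a ++ z) 0 = b by [].
split; rewrite /count_vars lead_encode -/N.
  rewrite -(nA b); transitivity (\sum_(z <- tups N t) (below #|gr G H b| z &&
    (~~ m (addr N 0 ((b : nat) :: (code (lhalf x) ++ z) ++ code r)) &&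
     ~~ m (addr N 0 ((b : nat) :: (z ++ code (rhalf x)) ++ code s))))).
    rewrite !big_seq; apply: eq_bigr => z; rewrite mem_tups => /andP[/eqP sz _].
    rewrite /vars_xz /vars_zx !pick_vars_cons !pick_vars_cat pz // p0 pxl pxr pr ps.
    by rewrite -!catA.
  rewrite sum_code //; apply: eq_card => z; rewrite !inE.
  by rewrite -!code_cat (hm b (tcat (lhalf x) z)) (hm b (tcat z (rhalf x))) !negbK.
rewrite -(nA false); transitivity (\sum_(z <- tups N t) (below #|G| z &&
    (~~ m (addr N 0 ((code (lhalf y) ++ z) ++ code r)) &&
     ~~ m (addr N 0 ((z ++ code (rhalf y)) ++ code s))))).
  rewrite !big_seq; apply: eq_bigr => z; rewrite mem_tups => /andP[/eqP sz _].
  rewrite /vars_yz /vars_zy !pick_vars_cat pz // pyl pyr pr ps.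
  by rewrite -!catA.
rewrite sum_code ?(NA false) //; apply: eq_card => z; rewrite !inE.
rewrite -(code_cat (lhalf y)) -(code_cat z) (represents_false (tcat (lhalf y) z) r hm).
by rewrite (represents_false (tcat z (rhalf y)) s hm) !negbK.
Qed.

Lemma refine_vars_code m E b (x : K.-tuple (gr G H b)) (y : K.-tuple G) :
  represents m E ->
  refine_vars t w m ((b : nat) :: code x ++ code y) = ~~ refine E x y.
Proof.
move=> hm; rewrite /refine_vars /refine; congr (~~ _).
set a := _ :: _.
rewrite -/N hm negbK atom_vars_code; congr [&& _, _, _ & _].
  apply/allP/forallP => [h f|h f _].
    by have := h f; rewrite mem_enum sub_vars_code hm negbK; apply.
  by rewrite sub_vars_code hm negbK.
have sa : size a = 1 + 2 * K by rewrite /= size_cat !size_code !size_tuple; lia.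
rewrite lead_encode /n.
(* The joint guard is distributed over the two loops, as [all_code] requires. *)
transitivity (all (fun r => ~~ below #|G| r || all (fun s => ~~ below #|G| s ||
      (count_vars t (vars_xz t) (vars_zx t) w m ((a ++ r) ++ s) ==
       count_vars t (vars_yz t) (vars_zy t) w m ((a ++ r) ++ s)))
     (tups N K)) (tups N K)).
  apply: eq_in_all => r; rewrite mem_tups => /andP[/eqP sr _].
  have e s : s \in tups N K ->
      pick_vars (iota (1 + 2 * K) K) ((a ++ r) ++ s) = r /\
      pick_vars (iota (1 + 3 * K) K) ((a ++ r) ++ s) = s.
    rewrite mem_tups => /andP[/eqP ss _]; split.
      by rewrite -catA pick_vars_block.
    by rewrite pick_vars_right // size_cat sa sr; lia.
  case: (boolP (below _ r)) => hr /=.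
    by apply: eq_in_all => s /e[-> ->]; rewrite hr.
  by apply/allP => s /e[-> _]; rewrite (negPf hr).
rewrite (all_code _ (NA false)); apply: eq_forallb => r.
rewrite (all_code _ (NA false)); apply: eq_forallb => s.
by have [-> ->] := count_vars_code x y r s hm.
Qed.

(** It makes 1, the mark of tuples of [H], a digit in base [N], and supplies the factor 2 in the
    number of rounds. *)
Lemma size_gt1 : 1 < N. Proof. by rewrite size_encode; lia. Qed.

Lemma update_represents m E : represents m E ->
  represents (update (1 + 2 * K) (@refine_vars t) w m) (refine E).
Proof.
move=> hm b x y; rewrite -(refine_vars_code x y hm).
apply: updateE => [w' m1 m2 z|]; first exact: refine_vars_ext.
rewrite mem_tups /= size_cat !size_code !size_tuple.
rewrite below_cat (below_leq (NA b) (below_code _)).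
rewrite (below_leq (NA false) (below_code _)) andbT.
have := size_gt1; rewrite -/N; case: (b); lia.
Qed.

Lemma accept_vars_code m E : represents m E -> accept_vars t w m = accepting E.
Proof.
move=> hm; rewrite /accept_vars /accepting /nvert2 lead_encode -/N.
have -> : lead w (n.+1 + n * n) = #|H|.
  rewrite (_ : n.+1 + n * n = size (encode_graph G)); last by rewrite size_encode_graph.
  by rewrite /w /encode_pair {2}/encode_graph; apply: lead_spec.
congr [&& _, _ & _].
  rewrite (all_code _ (NA false)); apply: eq_forallb => r.
  congr (_ == _).
    rewrite (sum_code _ (NA false) (fun x => ~~ m (addr N 0 (x ++ code r)))).
    by apply: eq_card => x; rewrite !inE (represents_false x r hm) negbK.
  rewrite -(nA true) (sum_code _ (NA true) (fun x => ~~ m (addr N 1 (x ++ code r)))).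
  by apply: eq_card => x; rewrite !inE (represents_true x r hm) negbK.
rewrite -{1}(nA true).
rewrite (all_code _ (NA true)); apply: eq_forallb => x.
rewrite (has_code _ (NA false) (fun r => ~~ m (addr N 1 (code x ++ r)))).
by apply: eq_existsb => r; rewrite (represents_true x r hm) negbK.
Qed.

End Link.

Lemma lead_encode_neq (G H : sgraph) m : #|G| != #|H| ->
  lead (encode_pair (G, H)) 0 == nvert2 (encode_pair (G, H)) m [::] = false.
Proof.
have l0 : lead (encode_pair (G, H)) 0 = #|G|.
  by rewrite /encode_pair /encode_graph -catA cat_cons; apply: (@lead_spec [::]).
rewrite /nvert2 l0 (_ : _.+1 + _ = size (encode_graph G)).
  by rewrite /encode_pair {2}/encode_graph lead_spec => /negPf.
by rewrite size_encode_graph.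
Qed.

Theorem theorem1p4 (R : realType) (t : nat) (ht : (1 <= t)%N) :
  poly_time_decidable encode_pair
    (fun GH : sgraph * sgraph => lasserre_equiv R t GH.1 GH.2).
Proof.
(* On graphs of equal order [n], [2 * n ^ (4 * t)] rounds suffice. The input is at least [n] and at
   least 2 bits long, so [4 * t] factors cover the power and one more covers the 2. *)
pose e := (t + t + (t + t)).+1.
pose up := update (1 + 2 * (t + t)) (@refine_vars t).
have hup := scomp_iter e (scomp_update (@bfun_refine_vars t)).
have [M [p hM]] := comp_decides (hup 0) (@bcomp_accept_vars t).
exists M, p => -[G H]; eexists; split; first exact: hM.
set w := encode_pair (G, H); set m := iter _ _ _.
(* For different orders the memory need not represent the refinement, but the first test rejects,
   and [las_card_vertex] excludes a solution. *)
have [GH|GH] := eqVneq #|G| #|H|; last first.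
  rewrite /accept_vars lead_encode_neq //; split=> //.
  by case=> y /las_card_vertex/eqP; rewrite (negPf GH).
have rep k : represents (iter k (up w) (fun=> false))
    (iter k (@refine G H t) (@trel0 G H t)).
  by elim: k => [|k IH] //=; apply: update_represents.
rewrite (accept_vars_code GH (rep _)).
apply: iff_sym; apply: lasserre_equivP => // _.
rewrite -expnD /e expnSr leq_mul ?size_gt1 // leq_exp2r; last by lia.
by rewrite size_encode //=; lia.
Qed.
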